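(* (1) Let $M$ be an open smooth manifold of dimension $\geq 4$ and let $\pi_0$ be a regular bivector field of rank $2$ on $M$. Then there exists a homotopy $\pi_t$, $t\in[0,1]$, of regular bivector fields of rank $2$ on $M$, starting at the given $\pi_0$, such that $\pi_1$ is a (regular) Poisson bivector field. (2) Let $M$ be a closed smooth $4$-manifold and let $\pi_0$ be a regular bivector field of rank $2$ on $M$. Then there exists a homotopy $\pi_t$, $t\in[0,1]$, of (not necessarily regular) bivector fields on $M$, starting at the given $\pi_0$, such that $\pi_1$ is a (not necessarily regular) Poisson bivector field.
   Context: A bivector field on $M$ is a smooth section $\pi\in\Gamma(\wedge^2TM)$. It induces the bundle map $\#\pi:T^*M\to TM$, $\#\pi(\eta)=\pi(\eta,-)$. The bivector field $\pi$ is called regular (of rank $2$) if the image $Im(\#\pi)$ is a regular distribution, i.e. a subbundle of $TM$ (of constant rank $2$). It is Poisson if its Schouten bracket satisfies $[\pi,\pi]=0$. A manifold is open if it has no closed (compact without boundary) components; it is closed if it is compact without boundary. A homotopy of bivector fields is a continuous path in the space of bivector fields with the compact-open topology. *)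

(* Defs.v *)
From HB Require Import structures.
From mathcomp Require Import all_boot all_order all_algebra.
From mathcomp Require Import all_classical all_reals all_analysis.

Set Implicit Arguments.
Unset Strict Implicit.
Unset Printing Implicit Defensive.

Import Order.TTheory GRing.Theory Num.Theory.
Import numFieldNormedType.Exports.

Local Open Scope classical_set_scope.
Local Open Scope ring_scope.

Section SmoothMaps.
Variable R : realType.

Definition partial n (l : 'I_n) (f : 'rV[R]_n -> R) : 'rV[R]_n -> R :=
  fun x => 'D_(delta_mx 0 l) f x.

(* Meant for open U, so that continuity and derivability at a point of U are
   taken in the ambient space. *)
Fixpoint Ck n (k : nat) (U : set 'rV[R]_n) (f : 'rV[R]_n -> R) : Prop :=
  (forall x, U x -> {for x, continuous f}) /\
  if k is k'.+1 then
    forall l, (forall x, U x -> derivable f x (delta_mx 0 l)) /\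
              Ck k' U (partial l f)
  else True.

Definition smooth_on m n p (U : set 'rV[R]_n) (F : 'rV[R]_n -> 'M[R]_(m, p)) :=
  forall i j k, Ck k U (fun x => F x i j).

End SmoothMaps.

(* Smooth manifolds without boundary, of pure dimension n, given by a smooth
   atlas (not necessarily maximal). [param c] is the inverse of the coordinate
   map [coord c]; it is irrelevant outside [coord c @` dom c]. Connectedness is
   not assumed. *)
Record manifold (R : realType) (n : nat) := Manifold {
  points :> topologicalType;
  points_hausdorff : hausdorff_space points;
  points_second_countable : @second_countable points;
  chart : Type;
  dom : chart -> set points;
  coord : chart -> points -> 'rV[R]_n;
  param : chart -> 'rV[R]_n -> points;
  dom_cover : forall p, exists c, dom c p;
  dom_open : forall c, open (dom c);
  coord_open : forall c, open (coord c @` dom c);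
  coordK : forall c p, dom c p -> param c (coord c p) = p;
  coord_continuous : forall c, {within dom c, continuous (coord c)};
  param_continuous : forall c, {within coord c @` dom c, continuous (param c)};
  transition_smooth : forall c d,
    smooth_on (coord c @` (dom c `&` dom d)) (coord d \o param c)
}.

Definition closed_manifold (R : realType) n (M : manifold R n) :=
  compact [set: M].

Definition open_manifold (R : realType) n (M : manifold R n) :=
  forall p : M, ~ compact (connected_component [set: M] p).

(* A tensor at p is the family of its component arrays in all the charts around
   p, related by the tensor transformation law (and 0 in the other charts, so
   that a tensor determines its family). Vectors and covectors are both written
   as rows; since [jacobian] acts on rows from the right, the components of a
   vector transform by X_d = X_c J, those of a covector by eta_c = eta_d J^T. *)
Section TensorsAtAPoint.
Variables (R : realType) (n : nat) (M : manifold R n).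

Definition jac (c d : chart M) (p : M) : 'M[R]_n :=
  jacobian (coord d \o param c) (coord c p).

Definition tangent (p : M) : set (chart M -> 'rV[R]_n) :=
  [set X | (forall c, ~ dom c p -> X c = 0) /\
           forall c d, dom c p -> dom d p -> X d = X c *m jac c d p].

Definition cotangent (p : M) : set (chart M -> 'rV[R]_n) :=
  [set eta | (forall c, ~ dom c p -> eta c = 0) /\
             forall c d, dom c p -> dom d p -> eta c = eta d *m (jac c d p)^T].

Definition bitangent (p : M) : set (chart M -> 'M[R]_n) :=
  [set w | [/\ forall c, ~ dom c p -> w c = 0,
               forall c, (w c)^T = - w c &
               forall c d, dom c p -> dom d p ->
                 w d = (jac c d p)^T *m w c *m jac c d p]].

(* The total space of the vector bundle wedge^2 TM. *)
Record bivector := Bivector {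
  base : M;
  components : chart M -> 'M[R]_n;
  components_bitangent : bitangent base components
}.

(* The bundle charts b |-> (base b, components b c), over [dom c], generate the
   topology of the total space. *)
Definition bivector_subbase : set (set bivector) :=
  [set W | exists c (U : set M) (V : set 'M[R]_n),
    [/\ open U, U `<=` dom c, open V &
        W = [set b | U (base b) /\ V (components b c)]]].

(* #b (eta) = b (eta, -) *)
Definition sharp (b : bivector) (eta : chart M -> 'rV[R]_n) :
    chart M -> 'rV[R]_n :=
  fun c => eta c *m components b c.

End TensorsAtAPoint.

HB.instance Definition _ (R : realType) n (M : manifold R n) :=
  gen_eqMixin (bivector M).
HB.instance Definition _ (R : realType) n (M : manifold R n) :=
  gen_choiceMixin (bivector M).
HB.instance Definition _ (R : realType) n (M : manifold R n) :=
  isSubBaseTopological.Build (bivector M) (@bivector_subbase R n M) id.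

Section Fields.
Variables (R : realType) (n : nat) (M : manifold R n).

Definition local_comp (pi : M -> bivector M) (c : chart M) :
    'rV[R]_n -> 'M[R]_n :=
  fun x => components (pi (param c x)) c.

Definition bivector_field (pi : M -> bivector M) : Prop :=
  (forall p, base (pi p) = p) /\
  forall c, smooth_on (coord c @` dom c) (local_comp pi c).

(* D is a smooth subbundle of rank k of TM: it has smooth local frames. *)
Definition subbundle (k : nat) (D : M -> set (chart M -> 'rV[R]_n)) : Prop :=
  forall p, exists (U : set M) (X : 'I_k -> M -> chart M -> 'rV[R]_n),
    [/\ open U /\ U p,
        forall a q, U q -> tangent q (X a q),
        forall a c, smooth_on (coord c @` (U `&` dom c))
                              (fun x => X a (param c x) c),
        forall q, U q -> forall r : 'I_k -> R,
          \sum_a r a *: X a q = 0 -> forall a, r a = 0 &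
        forall q, U q -> D q = range (fun r : 'I_k -> R => \sum_a r a *: X a q)].

Definition sharp_image (pi : M -> bivector M) (p : M) :
    set (chart M -> 'rV[R]_n) :=
  sharp (pi p) @` cotangent p.

Definition regular (k : nat) (pi : M -> bivector M) : Prop :=
  subbundle k (sharp_image pi).

(* Components in the chart c, at the point of coordinates x, of the Schouten
   bracket of P = 1/2 P^ij d_i ^ d_j and Q = 1/2 Q^ij d_i ^ d_j, where
   [P, Q] = 1/6 [P, Q]^ijk d_i ^ d_j ^ d_k and
   [X1 ^ X2, Y1 ^ Y2] = sum_(a, b) (-1)^(a+b) [Xa, Yb] ^ Xa' ^ Yb' with Xa', Yb'
   the remaining factors:
   [P, Q]^ijk = sum_l (P^il d_l Q^jk + Q^il d_l P^jk) + cyclic in (i, j, k). *)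
Definition schouten (P Q : M -> bivector M) (c : chart M) (x : 'rV[R]_n)
    (i j k : 'I_n) : R :=
  let p := local_comp P c in
  let q := local_comp Q c in
  let S a b d := \sum_(l < n) (p x a l * partial l (fun y => q y b d) x +
                               q x a l * partial l (fun y => p y b d) x) in
  S i j k + S j k i + S k i j.

Definition Poisson (pi : M -> bivector M) : Prop :=
  forall c x, (coord c @` dom c) x -> forall i j k, schouten pi pi c x i j k = 0.

(* A homotopy of bivector fields: a path, over [0, 1], in the set of smooth
   sections of wedge^2 TM, continuous for the compact-open topology. *)
Definition homotopy (pi_ : R -> {compact-open, M -> bivector M}) : Prop :=
  (forall t, t \in `[0, 1] -> bivector_field (pi_ t)) /\
  {within `[0, 1]%classic, continuous pi_}.

End Fields.

(* Main.v *)
(* The idea is to move a rank 2 bivector field only by "pulls" in charts.  For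
   f(x) = x + h(x) v(x) with Jacobian J the field D J^-T pi(f) J^-1 is Poisson
   at x whenever pi is Poisson at f(x); normalizing by D = det J / det (1 + h Dv)
   makes it polynomial in grad h, so that f may be degenerate.  Collapsing a
   neighbourhood of a hypersurface, transverse to pi, onto that hypersurface
   produces a product structure, which is Poisson; the collapse can be made along
   vectors tangent to pi, and then changes pi by little in the C^0 sense.  This
   makes pi Poisson near the walls of a locally finite family of cubes covering
   M without losing transversality to the walls still to be treated.  Once the
   walls of a cube are Poisson, pulls by maps that expand the cube from one of
   its points push the singular set of the cube into any prescribed open subset
   of it, for instance into an adjacent cube.  As M has no compact component,
   the singular set is pushed from cube to cube to infinity, and the locally
   finite infinite concatenation of the homotopies is a homotopy. *)

From HB Require Import structures.
Require Import Defs.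
From mathcomp Require Import all_boot all_order all_algebra.
From mathcomp Require Import all_classical all_reals all_analysis.
From mathcomp Require Import ring lra.

Set Implicit Arguments.
Unset Strict Implicit.
Unset Printing Implicit Defensive.

Import Order.TTheory GRing.Theory Num.Theory.
Import numFieldNormedType.Exports.

Local Open Scope classical_set_scope.
Local Open Scope ring_scope.

Local Notation coord := Defs.coord.

(** The normalization by D is harmless because rank 2 fields are decomposable: for a function c the
    bracket of c pi differs from c^2 [pi, pi] only by a multiple of pi wedge pi(dc), which vanishes
    by the Plucker relations. The obstacle is that a pulled field, though always decomposable, may
    vanish where D = 0. The two kinds of pull avoid this for different reasons. A collapse has D = 0
    by design, and its result is nonzero because it is C^0 close to pi. An expansion keeps D > 1/2
    because it is cut into many small steps. Poissonness of a pull at x is inherited from the single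
    point f(x), also when D(x) = 0: h is perturbed so that D(x) becomes nonzero while f(x) stays
    fixed, and the perturbation tends to 0. The escape to infinity has to be locally finite,
    although the chain of cubes along which one singular set leaves may return to cubes treated long
    before. This reduces to a statement on locally finite graphs, [escape_rate]: late cubes can
    escape through cubes of large index only. Statement (2) allows singular fields, and the path (1
    - t) pi_0 to the zero bivector answers it. *)

Lemma cvg_sumr (R : realType) (T I : Type) (F : set_system T) (FF : Filter F)
    (r : seq I) (P : pred I) (f : I -> T -> R) (l : I -> R) :
  (forall i, P i -> f i x @[x --> F] --> l i) ->
  \sum_(i <- r | P i) f i x @[x --> F] --> \sum_(i <- r | P i) l i.
Proof. by move=> H; apply: cvg_big => //; exact: add_continuous. Qed.

Lemma near_dist_le (R : realType) (T : topologicalType) (g : T -> R) (x : T) (e : R) :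
  0 < e -> {for x, continuous g} -> \forall z \near x, `|g z - g x| <= e.
Proof.
move=> e0 /cvgrPdist_le/(_ _ e0) H; near=> z.
by rewrite distrC; near: z.
Unshelve. all: by end_near. Qed.

Lemma half_dist_le (R : realType) (a b c e : R) :
  `|a - b| <= e / 2 -> `|a - c| <= e / 2 -> `|b - c| <= e.
Proof.
by move=> H1 H2; rewrite -(subrKA a) (splitr e) (le_trans (ler_normD _ _))// lerD// distrC.
Qed.

(** * Functions of class C^k *)

Section Partial.
Variables (R : realType) (n : nat).
Implicit Types (f g : 'rV[R]_n -> R) (x y z v : 'rV[R]_n) (U : set 'rV[R]_n).

Lemma is_derive_line f z v (t : R) : derivable f (z + t *: v) v ->
  is_derive t 1 (fun s : R => f (z + s *: v)) ('D_v f (z + t *: v)).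
Proof.
move=> df.
have E : (fun h : R => h^-1 *: (((fun s : R => f (z + s *: v)) \o shift t) (h *: 1)
     - f (z + t *: v))) =
   (fun h => h^-1 *: ((f \o shift (z + t *: v)) (h *: v) - f (z + t *: v))).
  apply/funext => h /=; congr (_ *: (f _ - _)).
  by rewrite [h *: 1]mulr1 scalerDl addrCA addrC -addrA.
apply: DeriveDef; last by rewrite /derive E.
by rewrite /derivable E.
Qed.

Lemma MVT_dir f z v (a : R) :
  (forall t, `|t| <= `|a| -> derivable f (z + t *: v) v) ->
  exists2 c : R, `|c| <= `|a| & f (z + a *: v) - f z = a * 'D_v f (z + c *: v).
Proof.
move=> df; pose g := fun s : R => f (z + s *: v).
have gd (t : R) : `|t| <= `|a| -> is_derive t 1 g ('D_v f (z + t *: v)).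
  by move=> /df; exact: is_derive_line.
have gc (t : R) : `|t| <= `|a| -> {for t, continuous g}.
  move=> /gd h; apply/differentiable_continuous/derivable1_diffP.
  exact: ex_derive.
have [a0|a0|->] := ltrgt0P a; last first.
- by exists 0; rewrite ?normr0// scale0r addr0 subrr mul0r.
- have [||c] := @MVT R g (fun t => 'D_v f (z + t *: v)) a 0 a0.
  + move=> t; rewrite in_itv/= => /andP[ta t0]; apply: gd.
    by rewrite !ltr0_norm// lerN2 ltW.
  + apply/continuous_in_subspaceT => t; rewrite inE/= in_itv/= => /andP[ta t0].
    by apply: gc; rewrite ler0_norm// ltr0_norm// lerN2.
  + rewrite in_itv/= => /andP[ac c0] E; exists c.
      by rewrite !ltr0_norm// lerN2 ltW.
    move: E; rewrite /g scale0r addr0 sub0r.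
    by move/(congr1 (@GRing.opp R)); rewrite opprB => ->; rewrite mulrN opprK mulrC.
- have [||c] := @MVT R g (fun t => 'D_v f (z + t *: v)) 0 a a0.
  + move=> t; rewrite in_itv/= => /andP[t0 ta]; apply: gd.
    by rewrite !gtr0_norm// ltW.
  + apply/continuous_in_subspaceT => t; rewrite inE/= in_itv/= => /andP[t0 ta].
    by apply: gc; rewrite ger0_norm// gtr0_norm.
  + rewrite in_itv/= => /andP[c0 ca] E; exists c.
      by rewrite !gtr0_norm// ltW.
    by move: E; rewrite /g scale0r addr0 subr0 mulrC.
Qed.

Lemma row_norm_coord x i : `|x 0 i| <= `|x|.
Proof.
rewrite [leRHS]/Num.Def.normr/= mx_normrE.
by apply: (le_trans _ (le_bigmax _ _ (0, i))).
Qed.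

Lemma row_norm_le x e : 0 <= e -> (forall i, `|x 0 i| <= e) -> `|x| <= e.
Proof.
move=> e0 H; rewrite /Num.Def.normr/= mx_normrE (bigmax_le _ e0)//= => -[i j] _.
by rewrite ord1 H.
Qed.

(** The points x + [trunc y k] form the staircase from x to x + y that changes one coordinate at a
    time. *)
Definition trunc x k : 'rV[R]_n := \row_i (if (i < k)%N then x 0 i else 0).

Lemma trunc_n x : trunc x n = x.
Proof. by apply/rowP => i; rewrite mxE ltn_ord. Qed.

Lemma trunc_0 x : trunc x 0 = 0.
Proof. by apply/rowP => i; rewrite !mxE. Qed.

Lemma truncS x (k : 'I_n) : trunc x k.+1 = trunc x k + x 0 k *: delta_mx 0 k.
Proof.
apply/rowP => i; rewrite !mxE eqxx/= ltnS leq_eqVlt.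
have [->|ik] := eqVneq i k; first by rewrite eqxx ltnn mulr1 add0r.
by rewrite (inj_eq val_inj) (negbTE ik)/= mulr0 addr0.
Qed.

Lemma norm_delta (i : 'I_n) : `|delta_mx 0 i : 'rV[R]_n| <= 1.
Proof.
apply: row_norm_le => // j; rewrite !mxE/= ; case: eqP => _/=; by rewrite ?normr1 ?normr0.
Qed.

Definition dotc (c : 'I_n -> R) (y : 'rV[R]_n) : R := \sum_k y 0 k * c k.

Lemma dotc_is_linear c : linear (dotc c).
Proof.
move=> a u w; rewrite /dotc scaler_sumr -big_split/=; apply: eq_bigr => k _.
by rewrite !mxE mulrDl -mulrA.
Qed.
HB.instance Definition _ c := GRing.isLinear.Build R 'rV[R]_n R _ (dotc c) (dotc_is_linear c).

Lemma dotc_continuous c : continuous (dotc c).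
Proof.
move=> y; apply: (@cvg_sumr R _ _ (nbhs y)) => k _.
by apply: cvgM; [exact: coord_continuous|exact: cvg_cst].
Qed.

(** Along the staircase [trunc] each increment is y_k times a partial derivative at a point near x;
    by continuity of the partials each of the n errors is a small multiple of |y|. *)
Lemma C1_differentiable f U x : open U -> U x -> Ck 1 U f -> differentiable f x.
Proof.
move=> oU Ux [fc Df].
pose L := dotc (fun k => partial k f x) : {linear _ -> _}.
suff fL : f \o shift x = cst (f x) + L +o_ (0 : 'rV[R]_n) id.
  by apply/diff_locallyP; rewrite (diff_unique (@dotc_continuous _) fL);
    split => //; exact: dotc_continuous.
apply/eqaddoP => _/posnumP[e].
(* There are n errors; n + 1 keeps the denominator positive in dimension 0. *)
pose e1 := e%:num / n.+1%:R.
have e10 : 0 < e1 by rewrite divr_gt0.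
have : \forall z \near x, U z /\ forall k, `|partial k f z - partial k f x| <= e1.
  apply: filterI; first exact: open_nbhs_nbhs.
  apply: (@filter_forall _ _ (fun k z => `|partial k f z - partial k f x| <= e1) (nbhs x)) => k.
  have [_ [pc _]] := Df k.
  have /cvgrPdist_le/(_ e1 e10) := pc x Ux.
  by apply: filterS => z; rewrite distrC.
move=> /nbhs_ballP[d /= d0 Hd].
apply/nbhs_ballP; exists d => //= y; rewrite mx_norm_ball /ball_/= sub0r normrN => yd.
have inball w : `|w| <= `|y| -> ball x d (x + w).
  by move=> wy; rewrite mx_norm_ball /ball_/= opprD addNKr normrN; apply: le_lt_trans yd.
have step (k : 'I_n) : `|f (x + trunc y k.+1) - f (x + trunc y k) - y 0 k * partial k f x|
     <= e1 * `|y|.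
  have tn t : `|t| <= `|y 0 k| -> `|trunc y k + t *: delta_mx 0 k| <= `|y|.
    move=> ty; apply: row_norm_le => // i; rewrite !mxE eqxx/=.
    have [->|ik] := eqVneq i k.
      by rewrite ltnn mulr1 add0r (le_trans ty)// row_norm_coord.
    by rewrite mulr0 addr0; case: ifP => _; rewrite ?normr0// row_norm_coord.
  have [|c cy E] := @MVT_dir f (x + trunc y k) (delta_mx 0 k) (y 0 k).
    move=> t ty; rewrite -addrA; have [_] := Hd _ (inball _ (tn t ty)).
    have [UU _] := Hd _ (inball _ (tn t ty)).
    by have [dd _] := Df k; move=> _; exact: dd.
  rewrite truncS addrA E -mulrBr normrM mulrC ler_pM// ?row_norm_coord//.
  by rewrite -addrA; have [_ ->] := Hd _ (inball _ (tn c cy)).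
have -> : (f \o shift x - (cst (f x) + L)) y =
   \sum_(k < n) (f (x + trunc y k.+1) - f (x + trunc y k) - y 0 k * partial k f x).
  rewrite sumrB -[LHS]/(f (y + x) - (f x + L y)) opprD addrA; congr (_ - _).
  rewrite -(big_mkord xpredT (fun k => f (x + trunc y k.+1) - f (x + trunc y k))).
  by rewrite telescope_sumr// trunc_n trunc_0 addr0 [y + x]addrC.
rewrite (le_trans (ler_norm_sum _ _ _))//.
rewrite (le_trans (ler_sum _ (fun k _ => step k)))// sumr_const card_ord.
rewrite -mulrnAl ler_wpM2r// /e1 -mulr_natr -mulrA ler_piMr//.
by rewrite mulrC ler_pdivrMr// mul1r ler_nat.
Qed.

(** Two applications of the mean value theorem turn the second difference over a square of side h
    into h^2 times a mixed partial at a nearby point. The second difference is symmetric in i and j,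
    so both mixed partials occur. *)
Lemma C2_sym f U x i j : open U -> U x -> Ck 2 U f ->
  partial i (partial j f) x = partial j (partial i f) x.
Proof.
move=> oU Ux C2.
have [_ Df] := C2.
have dfi k z : U z -> derivable f z (delta_mx 0 k) by have [h _] := Df k; exact: h.
have dfik k l z : U z -> derivable (partial k f) z (delta_mx 0 l).
  by have [_ [_ /(_ l)[h _]]] := Df k; exact: h.
have cf k l z : U z -> {for z, continuous (partial l (partial k f))}.
  by have [_ [_ /(_ l)[_ [h _]]]] := Df k; exact: h.
apply/eqP; rewrite -subr_eq0 -normr_le0; apply/ler_addgt0Pl => e e0; rewrite addr0.
have e20 : 0 < e / 2 by rewrite divr_gt0.
have : \forall z \near x, U z /\
   (`|partial i (partial j f) z - partial i (partial j f) x| <= e / 2 /\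
    `|partial j (partial i f) z - partial j (partial i f) x| <= e / 2).
  apply: filterI; first exact: open_nbhs_nbhs.
  apply: filterI; first exact: (near_dist_le e20 (cf j i x Ux)).
  exact: (near_dist_le e20 (cf i j x Ux)).
move=> /nbhs_ballP[d /= d0 Hd].
(* The square of side h has to stay in the ball of radius d, and h + h < d. *)
pose h := d / 4.
have h0 : 0 < h by rewrite divr_gt0.
have inU a b k l : `|a| <= `|h| -> `|b| <= `|h| ->
    ball x d (x + (a *: delta_mx 0 k + b *: delta_mx 0 l)).
  move=> ah bh; rewrite mx_norm_ball /ball_/= opprD addNKr normrN.
  apply: (le_lt_trans (ler_normD _ _)); rewrite !normrZ.
  have A := norm_delta k; have B := norm_delta l.
  have hh : `|h| = h by rewrite gtr0_norm.
  have : `|a| * `|delta_mx 0 k : 'rV[R]_n| <= h * 1 by rewrite ler_pM// -hh.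
  have : `|b| * `|delta_mx 0 l : 'rV[R]_n| <= h * 1 by rewrite ler_pM// -hh.
  rewrite /h; lra.
have key k l : exists z, [/\ ball x d z &
   f (x + h *: delta_mx 0 k + h *: delta_mx 0 l) - f (x + h *: delta_mx 0 k)
   - f (x + h *: delta_mx 0 l) + f x = h * (h * partial l (partial k f) z)].
  pose phi := fun y => f (y + h *: delta_mx 0 l) - f y.
  have dphi t : `|t| <= `|h| -> is_derive (x + t *: delta_mx 0 k) (delta_mx 0 k) phi
     (partial k f (x + t *: delta_mx 0 k + h *: delta_mx 0 l) - partial k f (x + t *: delta_mx 0 k)).
    move=> th; apply: is_deriveB.
      have D : derivable f (x + t *: delta_mx 0 k + h *: delta_mx 0 l) (delta_mx 0 k).
        by apply: dfi; rewrite -addrA; have [] := Hd _ (inU t h k l th (lexx _)).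
      have E : (fun s : R => s^-1 *: (((fun y => f (y + h *: delta_mx 0 l)) \o shift (x + t *: delta_mx 0 k))
           (s *: delta_mx 0 k) - f (x + t *: delta_mx 0 k + h *: delta_mx 0 l))) =
         (fun s => s^-1 *: ((f \o shift (x + t *: delta_mx 0 k + h *: delta_mx 0 l)) (s *: delta_mx 0 k) - f (x + t *: delta_mx 0 k + h *: delta_mx 0 l))).
        by apply/funext => s /=; rewrite !addrA.
      apply: DeriveDef; last by rewrite /derive E.
      by rewrite /derivable E.
    apply: DeriveDef => //; apply: dfi.
    by have := Hd _ (inU t 0 k l th _); rewrite normr0 scale0r addr0 => /(_ (normr_ge0 _))[].
  have [|c ch E] := @MVT_dir phi x (delta_mx 0 k) h.
    by move=> t /dphi D; exact: ex_derive.
  have [|b bh E2] := @MVT_dir (partial k f) (x + c *: delta_mx 0 k) (delta_mx 0 l) h.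
    by move=> t th; apply: dfik; rewrite -addrA; have [] := Hd _ (inU c t k l ch th).
  exists (x + (c *: delta_mx 0 k + b *: delta_mx 0 l)); split; first exact: (inU c b k l ch bh).
  have [_ D] := dphi _ ch.
  rewrite addrA -E2 -D -E /phi.
  by rewrite opprB -[LHS]addrA; congr (_ + _); rewrite addrC.
have [z1 [zb1 E1]] := key i j.
have [z2 [zb2 E2]] := key j i.
have [_ [_ H1]] := Hd _ zb1.
have [_ [H2 _]] := Hd _ zb2.
have : partial j (partial i f) z1 = partial i (partial j f) z2.
  apply: (mulfI (lt0r_neq0 h0)); apply: (mulfI (lt0r_neq0 h0)).
  rewrite -E1 -E2 [x + h *: delta_mx 0 i + h *: delta_mx 0 j]addrAC.
  by rewrite [X in X + f x]addrAC.
move=> E; rewrite E in H1.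
exact: (half_dist_le H2 H1).
Qed.

End Partial.

Lemma near_eq_continuous (T U : topologicalType) (f g : T -> U) (x : T) :
  (\forall y \near x, f y = g y) -> {for x, continuous f} -> {for x, continuous g}.
Proof.
move=> fg fc; rewrite /prop_for /continuous_at -(nbhs_singleton fg).
by apply: cvg_trans fc; apply: near_eq_cvg; apply: filterS fg => y ->.
Qed.

Lemma mx_continuous (R : realType) (T : topologicalType) m p (F : T -> 'M[R]_(m, p)) (x : T) :
  (forall i j, {for x, continuous (fun y => F y i j)}) -> {for x, continuous F}.
Proof.
move=> cF; apply/cvgrPdist_le => /= e e0; near=> y.
rewrite /Num.Def.normr/= mx_normrE (bigmax_le _ (ltW e0))//= => i _.
rewrite !mxE; move: i; near: y.
apply: (@filter_forall _ _ (fun i y => `|F x i.1 i.2 - F y i.1 i.2| <= e) (nbhs x)) => i.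
by have /cvgrPdist_le := cF i.1 i.2; exact.
Unshelve. all: by end_near. Qed.

Section CkAlgebra.
Variables (R : realType) (n : nat).
Implicit Types (f g : 'rV[R]_n -> R) (x y z v : 'rV[R]_n) (U V : set 'rV[R]_n) (k : nat).

Lemma CkS k U f : Ck k.+1 U f -> Ck k U f.
Proof.
elim: k f => [|k IH] f [fc Df]; first by split.
by split=> // l; have [dl Cl] := Df l; split => //; exact: IH.
Qed.

Lemma Ck_le k k' U f : (k' <= k)%N -> Ck k U f -> Ck k' U f.
Proof.
move=> /subnK <-; elim: (k - k')%N => [//|j IH]; rewrite addSn => H.
by apply: IH; exact: CkS.
Qed.

Lemma Ck_subset k U V f : V `<=` U -> Ck k U f -> Ck k V f.
Proof.
move=> VU; elim: k f => [|k IH] f [fc Df]; first by split=> // x /VU/fc.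
split=> [x /VU/fc//|l]; have [dl Cl] := Df l.
by split=> [x /VU/dl//|]; exact: IH.
Qed.

Lemma Ck_eq k U f g : open U -> (forall x, U x -> f x = g x) -> Ck k U f -> Ck k U g.
Proof.
move=> oU.
have nfg f1 g1 x : (forall x, U x -> f1 x = g1 x) -> U x -> \near x, f1 x = g1 x.
  by move=> fg Ux; apply: filterS (open_nbhs_nbhs (conj oU Ux)) => y; exact: fg.
have cfg f1 g1 x : (forall x, U x -> f1 x = g1 x) -> U x ->
    {for x, continuous f1} -> {for x, continuous g1}.
  by move=> fg Ux; exact: (near_eq_continuous (nfg _ _ _ fg Ux)).
elim: k f g => [|k IH] f g fg [fc Df].
  by split=> // x Ux; exact: (cfg f g x fg Ux (fc x Ux)).
split=> [x Ux|l]; first exact: (cfg f g x fg Ux (fc x Ux)).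
have [dl Cl] := Df l; split.
  by move=> x Ux; apply: near_eq_derivable (dl _ Ux); exact: (nfg _ _ _ fg Ux).
apply: IH Cl => x Ux; rewrite /partial; apply: near_eq_derive; exact: (nfg _ _ _ fg Ux).
Qed.

Lemma Ck_local k U f :
  (forall x, U x -> exists V, [/\ open V, V x & Ck k V f]) -> Ck k U f.
Proof.
elim: k f => [|k IH] f H.
  by split=> // x /H[V [_ Vx [fc _]]]; exact: fc.
split=> [x /H[V [_ Vx [fc _]]]|l]; first exact: fc.
split=> [x /H[V [_ Vx [_ /(_ l)[dl _]]]]|]; first exact: dl.
by apply: IH => x /H[V [oV Vx [_ /(_ l)[_ Cl]]]]; exists V.
Qed.

Lemma Ck_cst k U (a : R) : Ck k U (fun=> a).
Proof.
elim: k a => [|k IH] a; first by split=> // x _; exact: cst_continuous.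
split=> [x _|l]; first exact: cst_continuous.
split=> [x _|]; first exact: derivable_cst.
have -> : partial l (fun=> a) = (fun=> 0) :> ('rV[R]_n -> R).
  by apply/funext => x; rewrite /partial; exact: derive_cst.
exact: IH.
Qed.

Lemma is_derive_coord x v i : is_derive x v (fun y : 'rV[R]_n => y 0 i : R) (v 0 i).
Proof.
have E : (fun h : R => h^-1 *: (((fun y : 'rV[R]_n => y 0 i : R) \o shift x) (h *: v) - x 0 i)) @ 0^' --> v 0 i.
  apply: cvg_near_cst; near=> h => /=.
  rewrite !mxE addrK scalerA mulVf ?scale1r//.
  by near: h; exact: nbhs_dnbhs_neq.
apply: DeriveDef; first by apply/cvg_ex; exists (v 0 i).
exact: (cvg_lim _ E).
Unshelve. all: by end_near. Qed.

Lemma Ck_coord k U i : Ck k U (fun x => x 0 i).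
Proof.
case: k => [|k]; first by split=> // x _; exact: coord_continuous.
split=> [x _|l]; first exact: coord_continuous.
split=> [x _|]; first by have := is_derive_coord x (delta_mx 0 l) i; case.
have -> : partial l (fun x : 'rV[R]_n => x 0 i) = (fun=> (delta_mx 0 l : 'rV[R]_n) 0 i).
  by apply/funext => x; have := is_derive_coord x (delta_mx 0 l) i; case.
exact: Ck_cst.
Qed.

Lemma CkD k U f g : open U -> Ck k U f -> Ck k U g -> Ck k U (fun x => f x + g x).
Proof.
move=> oU; elim: k f g => [|k IH] f g [fc Df] [gc Dg].
  by split=> // x Ux; apply: continuousD; [exact: fc|exact: gc].
split=> [x Ux|l]; first by apply: continuousD; [exact: fc|exact: gc].
have [dfl Cfl] := Df l; have [dgl Cgl] := Dg l; split.
  by move=> x Ux; apply: derivableD; [exact: dfl|exact: dgl].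
apply: (Ck_eq oU _ (IH _ _ Cfl Cgl)) => x Ux; rewrite /partial.
by rewrite -deriveD; [|exact: dfl|exact: dgl].
Qed.

Lemma CkM k U f g : open U -> Ck k U f -> Ck k U g -> Ck k U (fun x => f x * g x).
Proof.
move=> oU; elim: k f g => [|k IH] f g Cf Cg.
  by split=> // x Ux; apply: continuousM; [have [+ _] := Cf|have [+ _] := Cg]; exact.
have [fc Df] := Cf; have [gc Dg] := Cg.
split=> [x Ux|l]; first by apply: continuousM; [exact: fc|exact: gc].
have [dfl Cfl] := Df l; have [dgl Cgl] := Dg l; split.
  by move=> x Ux; apply: derivableM; [exact: dfl|exact: dgl].
apply: (Ck_eq oU _ (CkD oU (IH _ _ (CkS Cf) Cgl) (IH _ _ (CkS Cg) Cfl))) => x Ux.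
by rewrite /partial [RHS]deriveM; [|exact: dfl|exact: dgl].
Qed.

Lemma CkN k U f : open U -> Ck k U f -> Ck k U (fun x => - f x).
Proof.
move=> oU Cf; apply: (Ck_eq oU _ (CkM oU (Ck_cst k U (-1)) Cf)) => x _.
by rewrite mulN1r.
Qed.

Lemma CkB k U f g : open U -> Ck k U f -> Ck k U g -> Ck k U (fun x => f x - g x).
Proof. by move=> oU Cf Cg; apply: CkD => //; exact: CkN. Qed.

Lemma Ck_sum (I : Type) (r : seq I) (P : pred I) k U (f : I -> 'rV[R]_n -> R) :
  open U -> (forall i, P i -> Ck k U (f i)) ->
  Ck k U (fun x => \sum_(i <- r | P i) f i x).
Proof.
move=> oU H; elim: r => [|i r IH].
  by apply: (Ck_eq oU _ (Ck_cst k U 0)) => x _; rewrite big_nil.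
case Pi : (P i).
  by apply: (Ck_eq oU _ (CkD oU (H i Pi) IH)) => x _; rewrite big_cons Pi.
by apply: (Ck_eq oU _ IH) => x _; rewrite big_cons Pi.
Qed.

Lemma Ck_prod (I : Type) (r : seq I) (P : pred I) k U (f : I -> 'rV[R]_n -> R) :
  open U -> (forall i, P i -> Ck k U (f i)) ->
  Ck k U (fun x => \prod_(i <- r | P i) f i x).
Proof.
move=> oU H; elim: r => [|i r IH].
  by apply: (Ck_eq oU _ (Ck_cst k U 1)) => x _; rewrite big_nil.
case Pi : (P i).
  by apply: (Ck_eq oU _ (CkM oU (H i Pi) IH)) => x _; rewrite big_cons Pi.
by apply: (Ck_eq oU _ IH) => x _; rewrite big_cons Pi.
Qed.

Lemma CkV k U f : open U -> (forall x, U x -> f x != 0) -> Ck k U f ->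
  Ck k U (fun x => (f x)^-1).
Proof.
move=> oU f0; elim: k => [|k IH] Cf; have [fc Df] := Cf.
  by split=> // x Ux; apply: continuousV; [exact: f0|exact: fc].
split=> [x Ux|l]; first by apply: continuousV; [exact: f0|exact: fc].
have [dfl Cfl] := Df l; split.
  by move=> x Ux; apply: derivableV; [exact: f0|exact: dfl].
have Ci := IH (CkS Cf).
apply: (Ck_eq oU _ (CkN oU (CkM oU (CkM oU Ci Ci) Cfl))) => x Ux.
rewrite /partial [RHS]deriveV; [|exact: f0|exact: dfl].
by rewrite expr2 invfM scaleNr.
Qed.

Lemma Ck_continuous k U f x : Ck k U f -> U x -> {for x, continuous f}.
Proof. by case: k => [|k] [fc _] Ux; exact: fc. Qed.

Lemma Ck_diff k U f x : open U -> Ck k.+1 U f -> U x -> differentiable f x.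
Proof.
by move=> oU Cf Ux; apply: (C1_differentiable oU Ux); apply: Ck_le Cf.
Qed.

(** [Ck] speaks of functions of row vectors only, so smoothness of a function of one real variable
    is expressed by membership in a family closed under derivation. *)
Lemma Ck_comp1 (S : (R -> R) -> Prop) k U f :
  (forall phi, S phi -> exists psi, S psi /\ forall t : R, is_derive t (1:R) phi (psi t)) ->
  open U -> Ck k U f -> forall phi, S phi -> Ck k U (fun x => phi (f x)).
Proof.
move=> dphi oU.
have cphi phi : S phi -> continuous phi.
  move=> /dphi[psi [_ H]] t; apply/differentiable_continuous/derivable1_diffP.
  by have := H t; case.
elim: k => [|k IH] Cf phi Sphi; have [fc Df] := Cf.
  by split=> // x Ux; apply: continuous_comp; [exact: fc|exact: cphi].
split=> [x Ux|l]; first by apply: continuous_comp; [exact: fc|exact: cphi].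
have [dfl Cfl] := Df l; have [psi [Spsi Dpsi]] := dphi _ Sphi.
have D x : U x -> is_derive x (delta_mx 0 l) (phi \o f) (partial l f x * psi (f x)).
  move=> Ux.
  have df : differentiable f x by exact: Ck_diff Cf Ux.
  have dp : differentiable phi (f x).
    by apply/derivable1_diffP; have := Dpsi (f x); case.
  apply: DeriveDef; first by apply: diff_derivable; exact: differentiable_comp.
  rewrite deriveE; last exact: differentiable_comp.
  rewrite diff_comp//= /partial deriveE// deriv1E; last first.
    by have := Dpsi (f x); case.
  by rewrite derive1E; have := Dpsi (f x); case=> _ ->.
split; first by move=> x /D; case.
have := CkM oU Cfl (IH (CkS Cf) _ Spsi).
by apply: Ck_eq => // x /D; case => _; rewrite /partial => <-.
Qed.

End CkAlgebra.

Section CkComp.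
Variables (R : realType) (n m : nat).
Implicit Types (g : 'rV[R]_m -> R) (F : 'rV[R]_n -> 'rV[R]_m).

Lemma differentiable_rowP F x :
  (forall i, differentiable (fun y => F y 0 i) x) -> differentiable F x.
Proof.
move=> H.
have -> : F = \sum_i (fun y => (F y 0 i) *: (delta_mx 0 i : 'rV[R]_m)).
  apply/funext => y; rewrite fct_sumE.
  by apply/rowP => j; rewrite summxE (bigD1 j)//= big1 ?addr0 => [|i ij]; rewrite !mxE ?eqxx ?mulr1//
     eq_sym (negbTE ij) mulr0.
apply: differentiable_sum => i; exact: differentiableZl.
Qed.

Lemma partial_comp g F x l : differentiable F x -> differentiable g (F x) ->
  partial l (g \o F) x = \sum_i partial i g (F x) * partial l (fun y => F y 0 i) x.
Proof.
move=> dF dg; rewrite /partial deriveE; last exact: differentiable_comp.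
have E : 'd F x (delta_mx 0 l) = \row_i partial l (fun y => F y 0 i) x.
  rewrite -deriveE// derive_mx; last exact: diff_derivable.
  by apply/rowP => i; rewrite !mxE.
rewrite diff_comp//= E [X in 'd g _ X]row_sum_delta linear_sum.
by apply: eq_bigr => i _; rewrite linearZ mxE -deriveE// mulrC.
Qed.

Lemma Ck_comp k (U : set 'rV[R]_n) (V : set 'rV[R]_m) g F :
  open U -> open V -> (forall i, Ck k U (fun y => F y 0 i)) -> Ck k V g ->
  (forall x, U x -> V (F x)) -> Ck k U (g \o F).
Proof.
move=> oU oV; elim: k g F => [|k IH] g F CF Cg UV.
  split=> // x Ux; apply: continuous_comp; last by apply: (Ck_continuous Cg); exact: UV.
  by apply: mx_continuous => i j; rewrite (ord1 i); exact: Ck_continuous (CF j) Ux.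
have dF x : U x -> differentiable F x.
  by move=> Ux; apply: differentiable_rowP => i; exact: Ck_diff (CF i) Ux.
have dg x : V x -> differentiable g x by move=> Vx; exact: Ck_diff Cg Vx.
have dgF x : U x -> differentiable (g \o F) x.
  by move=> Ux; apply: differentiable_comp; [exact: dF|apply: dg; exact: UV].
split=> [x /dgF/differentiable_continuous//|l].
split=> [x /dgF/diff_derivable|]; first exact.
apply: (@Ck_eq _ _ _ _ (fun x => \sum_i partial i g (F x) * partial l (fun y => F y 0 i) x)) => //.
  by move=> x Ux; rewrite partial_comp//; [exact: dF|apply: dg; exact: UV].
apply: Ck_sum => // i _; apply: CkM => //.
  apply: (IH (partial i g) F) => //; first by move=> j; exact: CkS.
  by have [_ /(_ i)[]] := Cg.
by have [_ /(_ l)[]] := CF i.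
Qed.

End CkComp.

Definition sm (R : realType) n (U : set 'rV[R]_n) (f : 'rV[R]_n -> R) :=
  forall k, Ck k U f.

(** * Bump functions *)

Section Bump.
Variable R : realType.
Implicit Types t s : R.

(** All derivatives of the flat function exp(-1/t) are combinations of these functions t^-k
    exp(-1/t). *)
Definition expinv k t : R := if 0 < t then t^-1 ^+ k * expR (- t^-1) else 0.

Lemma expinv_le0 k t : t <= 0 -> expinv k t = 0.
Proof. by rewrite /expinv leNgt => /negbTE ->. Qed.

(** With u = 1/t this is u^(k+1) / (k+1)! <= exp u, a single term of the exponential series. *)
Lemma expinv_bound k t : 0 < t -> `|expinv k t| <= (k.+1)`!%:R * t.
Proof.
move=> t0; rewrite /expinv t0 ger0_norm; last by rewrite mulr_ge0 ?expR_ge0// exprn_ge0// invr_ge0 ltW.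
rewrite expRN -ler_pdivlMr ?invr_gt0 ?expR_gt0// invrK.
have ti : 0 <= t^-1 by rewrite invr_ge0 ltW.
have H2 : t^-1 ^+ k.+1 / (k.+1)`!%:R <= expR t^-1.
  by apply: le_trans (expR_ge1Dxn k ti); rewrite lerDr.
have f0 : 0 < (k.+1)`!%:R :> R by rewrite ltr0n fact_gt0.
rewrite ler_pdivrMr// in H2.
rewrite -(ler_pM2r (x := t^-1)) ?invr_gt0// -exprSr (le_trans H2)//.
by rewrite [leRHS](_ : _ = expR t^-1 * (k.+1)`!%:R)//; field; rewrite gt_eqF.
Qed.

Lemma expinv_derive k t : is_derive t (1:R) (expinv k)
  (expinv k.+2 t - k%:R * expinv k.+1 t).
Proof.
have [t0|t0|->] := ltrgt0P t.
- have D : is_derive t (1:R) (fun s : R => s^-1 ^+ k * expR (- s^-1))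
    (expinv k.+2 t - k%:R * expinv k.+1 t).
    have Di : is_derive t (1:R) (fun s : R => s^-1) (- t ^- 2 *: 1).
      by apply: is_deriveV; rewrite gt_eqF.
    have De := @is_derive1_comp R expR (- (fun s : R => s^-1)) t _ _ (is_derive_expR (- t^-1)) (is_deriveN Di).
    have -> : (fun s : R => s^-1 ^+ k * expR (- s^-1)) =
      (fun s : R => s^-1) ^+ k * (expR \o - (fun s : R => s^-1)).
      by apply/funext => s; rewrite /= !fctE.
    apply: (is_derive_eq (is_deriveM (is_deriveX k Di) De)).
    rewrite !fctE/=.
    rewrite /expinv t0 /= /GRing.scale/= mulr1 exprVn.
    rewrite -!exprVn; set u := t^-1; set e := expR _.
    case: k => [|k]; first by rewrite !mul0r expr0; ring.
    by rewrite !exprS /=; move: (u ^+ k) => w; ring.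
  apply: near_eq_is_derive D; near=> s.
  by rewrite /expinv ifT//; near: s; apply: open_nbhs_nbhs; split; [exact: open_gt|].
- rewrite !expinv_le0 ?ltW// mulr0 subr0.
  apply: (near_eq_is_derive _ (is_derive_cst (0 : R) t (1 : R))).
  near=> s; by rewrite expinv_le0// ltW//; near: s; apply: open_nbhs_nbhs; split; [exact: open_lt|].
- rewrite !expinv_le0// mulr0 subr0.
  (* At 0 the difference quotient of [expinv k] is [expinv k.+1], up to sign zero on the left, and
     [expinv_bound] sends it to 0. *)
  have E : (fun h : R => h^-1 *: ((expinv k \o shift 0) (h *: 1) - expinv k 0)) @ 0^' --> (0 : R).
    apply/cvgrPdist_le => /= e e0; near=> h.
    rewrite [h *: 1]mulr1 addr0 (expinv_le0 _ (lexx _)) subr0 sub0r normrN normrM.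
    have [h0|h0] := leP h 0; first by rewrite expinv_le0// normr0 mulr0 ltW.
    have -> : `|h^-1| * `|expinv k h| = `|expinv k.+1 h|.
      by rewrite -normrM /expinv h0 exprS mulrA.
    rewrite (le_trans (expinv_bound _ h0))// -ler_pdivlMl ?ltr0n ?fact_gt0//.
    rewrite (le_trans (ler_norm _))//; near: h; apply: dnbhs0_le.
    by rewrite mulr_gt0// invr_gt0 ltr0n fact_gt0.
  apply: DeriveDef; first by apply/cvg_ex; exists 0.
  exact: (cvg_lim _ E).
Unshelve. all: by end_near. Qed.

(** The constructor [efamL] has the shape of the derivative in [expinv_derive], which makes the
    family closed under derivation, as [Ck_comp1] requires. *)
Inductive efam : (R -> R) -> Prop :=
| efam0 k : efam (expinv k)
| efamL c f g : efam f -> efam g -> efam (fun t => f t - c * g t).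

Lemma efam_derive f : efam f ->
  exists g, efam g /\ forall t : R, is_derive t (1:R) f (g t).
Proof.
elim=> [k|c {}f g _ [f' [Ef Df]] _ [g' [Eg Dg]]].
  exists (fun t => expinv k.+2 t - k%:R * expinv k.+1 t); split.
    by apply: efamL; exact: efam0.
  by move=> t; exact: expinv_derive.
exists (fun t => f' t - c * g' t); split; first exact: efamL.
move=> t; apply: is_deriveB; exact: (is_deriveZ (Dg t)).
Qed.

Definition flat t := expinv 0 t.

Lemma flat_gt0 t : 0 < t -> 0 < flat t.
Proof. by move=> t0; rewrite /flat /expinv t0 expr0 mul1r expR_gt0. Qed.

Lemma flat_ge0 t : 0 <= flat t.
Proof.
by have [/expinv_le0 E|/flat_gt0/ltW//] := leP t 0; rewrite /flat E.
Qed.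

Lemma flat0 t : t <= 0 -> flat t = 0. Proof. exact: expinv_le0. Qed.

Lemma sm_flat n (U : set 'rV[R]_n) f : open U -> sm U f -> sm U (fun x => flat (f x)).
Proof.
move=> oU fs k; apply: (Ck_comp1 efam_derive oU (fs k)); exact: efam0.
Qed.

Definition plateau t := flat (4 - t ^+ 2) / (flat (4 - t ^+ 2) + flat (t ^+ 2 - 1)).

Lemma plateau_den t : 0 < flat (4 - t ^+ 2) + flat (t ^+ 2 - 1).
Proof.
have [h|h] := ltP (t ^+ 2) 4.
  by rewrite ltr_pwDl ?flat_ge0// flat_gt0// subr_gt0.
by rewrite ltr_wpDl ?flat_ge0// flat_gt0// subr_gt0; apply: lt_le_trans h; lra.
Qed.

Lemma plateau1 t : `|t| <= 1 -> plateau t = 1.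
Proof.
move=> t1; have h := plateau_den t; rewrite /plateau.
have E : flat (t ^+ 2 - 1) = 0.
  by rewrite flat0// subr_le0 -real_normK ?num_real// expr_le1.
by move: h; rewrite E addr0 => h; rewrite divff// gt_eqF.
Qed.

Lemma plateau0 t : 2 <= `|t| -> plateau t = 0.
Proof.
move=> t2; rewrite /plateau [X in X / _]flat0 ?mul0r//.
rewrite subr_le0 -[t ^+ 2]real_normK ?num_real//.
by rewrite (_ : 4 = 2 ^+ 2); [rewrite ler_pXn2r// nnegrE | lra].
Qed.

Lemma sm_plateau n (U : set 'rV[R]_n) f : open U -> sm U f -> sm U (fun x => plateau (f x)).
Proof.
move=> oU fs k.
have C2 : sm U (fun x => f x ^+ 2) by move=> j; apply: CkM.
have F1 : sm U (fun x => flat (4 - f x ^+ 2)).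
  by apply: sm_flat => // j; apply: CkB => //; exact: Ck_cst.
have F2 : sm U (fun x => flat (f x ^+ 2 - 1)).
  by apply: sm_flat => // j; apply: CkB => //; exact: Ck_cst.
apply: CkM => //; apply: CkV => //; last exact: CkD.
by move=> x _; rewrite gt_eqF// plateau_den.
Qed.

End Bump.

(** * Smooth matrix-valued maps *)

Section SmoothMatrices.
Variables (R : realType) (n : nat).
Implicit Types (U V : set 'rV[R]_n).

Lemma sm_eq U (f g : 'rV[R]_n -> R) : open U -> (forall x, U x -> f x = g x) -> sm U f -> sm U g.
Proof. by move=> oU fg fs k; apply: (Ck_eq oU fg). Qed.

Lemma smooth_on_eq m p U (F G : 'rV[R]_n -> 'M[R]_(m, p)) : open U ->
  (forall x, U x -> F x = G x) -> smooth_on U F -> smooth_on U G.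
Proof. by move=> oU FG Fs i j k; apply: (Ck_eq oU _ (Fs i j k)) => x /FG ->. Qed.

Lemma smooth_on_subset m p U V (F : 'rV[R]_n -> 'M[R]_(m, p)) :
  V `<=` U -> smooth_on U F -> smooth_on V F.
Proof. by move=> VU Fs i j k; apply: (Ck_subset VU (Fs i j k)). Qed.

Lemma smooth_on_cst m p U (A : 'M[R]_(m, p)) : smooth_on U (fun=> A).
Proof. by move=> i j k; exact: Ck_cst. Qed.

Lemma smooth_on_id U : smooth_on U (fun x : 'rV[R]_n => x).
Proof. by move=> i j k; rewrite (ord1 i); exact: Ck_coord. Qed.

Lemma smooth_onD m p U (F G : 'rV[R]_n -> 'M[R]_(m, p)) : open U ->
  smooth_on U F -> smooth_on U G -> smooth_on U (fun x => F x + G x).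
Proof.
move=> oU Fs Gs i j k; apply: (Ck_eq oU _ (CkD oU (Fs i j k) (Gs i j k))) => x _.
by rewrite mxE.
Qed.

Lemma smooth_onZ m p U (f : 'rV[R]_n -> R) (G : 'rV[R]_n -> 'M[R]_(m, p)) : open U ->
  sm U f -> smooth_on U G -> smooth_on U (fun x => f x *: G x).
Proof.
move=> oU Fs Gs i j k; apply: (Ck_eq oU _ (CkM oU (Fs k) (Gs i j k))) => x _.
by rewrite mxE.
Qed.

Lemma smooth_onN m p U (F : 'rV[R]_n -> 'M[R]_(m, p)) : open U ->
  smooth_on U F -> smooth_on U (fun x => - F x).
Proof.
move=> oU Fs i j k; apply: (Ck_eq oU _ (CkN oU (Fs i j k))) => x _.
by rewrite mxE.
Qed.

Lemma smooth_onB m p U (F G : 'rV[R]_n -> 'M[R]_(m, p)) : open U ->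
  smooth_on U F -> smooth_on U G -> smooth_on U (fun x => F x - G x).
Proof. by move=> oU Fs Gs; apply: smooth_onD => //; exact: smooth_onN. Qed.

Lemma smooth_on_tr m p U (F : 'rV[R]_n -> 'M[R]_(m, p)) : open U ->
  smooth_on U F -> smooth_on U (fun x => (F x)^T).
Proof. by move=> oU Fs i j k; apply: (Ck_eq oU _ (Fs j i k)) => x _; rewrite mxE. Qed.

Lemma smooth_onM m p q U (F : 'rV[R]_n -> 'M[R]_(m, p)) (G : 'rV[R]_n -> 'M[R]_(p, q)) :
  open U -> smooth_on U F -> smooth_on U G -> smooth_on U (fun x => F x *m G x).
Proof.
move=> oU Fs Gs i j k.
apply: (@Ck_eq _ _ _ _ (fun x => \sum_l F x i l * G x l j)) => // [x _|].
  by rewrite mxE.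
by apply: Ck_sum => // l _; exact: CkM.
Qed.

Lemma sm_det m U (F : 'rV[R]_n -> 'M[R]_m) : open U -> smooth_on U F ->
  sm U (fun x => \det (F x)).
Proof.
move=> oU Fs k; rewrite /determinant; apply: Ck_sum => // s _.
by apply: CkM => //; [exact: Ck_cst|apply: Ck_prod => // i _; exact: Fs].
Qed.

Lemma smooth_on_inv m U (F : 'rV[R]_n -> 'M[R]_m) : open U -> smooth_on U F ->
  (forall x, U x -> F x \in unitmx) -> smooth_on U (fun x => invmx (F x)).
Proof.
move=> oU Fs Fu.
apply: (@smooth_on_eq _ _ _ (fun x => (\det (F x))^-1 *: \adj (F x))) => // [x Ux|].
  by rewrite /invmx Fu.
apply: smooth_onZ => //.
  move=> k; apply: CkV => // [x Ux|]; last exact: sm_det.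
  by have := Fu _ Ux; rewrite unitmxE unitfE.
move=> i j k; apply: (@Ck_eq _ _ _ _ (fun x => cofactor (F x) j i)) => // [x _|].
  by rewrite mxE.
rewrite /cofactor; apply: CkM => //; first exact: Ck_cst.
apply: sm_det => // a b l.
by apply: (Ck_eq oU _ (Fs (lift j a) (lift i b) l)) => x _; rewrite !mxE.
Qed.

Lemma sm_partial U (f : 'rV[R]_n -> R) l : sm U f -> sm U (partial l f).
Proof. by move=> fs k; have [_ /(_ l)[]] := fs k.+1. Qed.

Lemma sm_derivable U (f : 'rV[R]_n -> R) l x : sm U f -> U x -> derivable f x (delta_mx 0 l).
Proof. by move=> fs Ux; have [_ /(_ l)[+ _]] := fs 1; exact. Qed.

Lemma sm_continuous U (f : 'rV[R]_n -> R) x : sm U f -> U x -> {for x, continuous f}.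
Proof. by move=> fs Ux; have [+ _] := fs 0; exact. Qed.

Lemma sm_diff U (f : 'rV[R]_n -> R) x : open U -> sm U f -> U x -> differentiable f x.
Proof. by move=> oU fs Ux; exact: (Ck_diff oU (fs 1) Ux). Qed.

Lemma smooth_on_continuous m p U (F : 'rV[R]_n -> 'M[R]_(m, p)) x : smooth_on U F -> U x ->
  {for x, continuous F}.
Proof.
by move=> Fs Ux; apply: mx_continuous => i j; exact: sm_continuous (Fs i j) Ux.
Qed.

Definition dmx m p (b : 'I_n) (F : 'rV[R]_n -> 'M[R]_(m, p)) x : 'M[R]_(m, p) :=
  \matrix_(i, j) partial b (fun y => F y i j) x.

Lemma dmxM m p q U b (F : 'rV[R]_n -> 'M[R]_(m, p)) (G : 'rV[R]_n -> 'M[R]_(p, q)) x :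
  smooth_on U F -> smooth_on U G -> U x ->
  dmx b (fun y => F y *m G y) x = dmx b F x *m G x + F x *m dmx b G x.
Proof.
move=> Fs Gs Ux; apply/matrixP => i j; rewrite !mxE -big_split/=.
have D l : is_derive x (delta_mx 0 b) ((fun y => F y i l) * (fun y => G y l j))
    (F x i l *: partial b (fun y => G y l j) x + G x l j *: partial b (fun y => F y i l) x).
  have DF := derivableP (sm_derivable (l := b) (Fs i l : sm U _) Ux).
  have DG := derivableP (sm_derivable (l := b) (Gs l j : sm U _) Ux).
  exact: (is_deriveM DF DG).
have -> : (fun y => (F y *m G y) i j) = \sum_l ((fun y => F y i l) * (fun y => G y l j)).
  by apply/funext => y; rewrite mxE fct_sumE.
rewrite /partial derive_sum; last by move=> l; have := D l; case.
apply: eq_bigr => l _; have [_ ->] := D l.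
by rewrite !mxE /GRing.scale/= addrC; congr (_ + _); rewrite mulrC.
Qed.

Lemma partialM U (f g : 'rV[R]_n -> R) l x : sm U f -> sm U g -> U x ->
  partial l (fun y => f y * g y) x = f x * partial l g x + g x * partial l f x.
Proof.
move=> fs gs Ux.
have Df := derivableP (sm_derivable (l := l) fs Ux).
have Dg := derivableP (sm_derivable (l := l) gs Ux).
by have [_ E] := is_deriveM Df Dg; exact: E.
Qed.

Lemma partialD U (f g : 'rV[R]_n -> R) l x : sm U f -> sm U g -> U x ->
  partial l (fun y => f y + g y) x = partial l f x + partial l g x.
Proof.
move=> fs gs Ux.
by apply: deriveD; [exact: (sm_derivable fs Ux)|exact: (sm_derivable gs Ux)].
Qed.

Lemma Ck_coord_sm U i : sm U (fun x : 'rV[R]_n => x 0 i).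
Proof. by move=> k; exact: Ck_coord. Qed.

Lemma dmx_tr m p b (F : 'rV[R]_n -> 'M[R]_(m, p)) x :
  dmx b (fun y => (F y)^T) x = (dmx b F x)^T.
Proof.
apply/matrixP => i j; rewrite !mxE; congr (partial b _ x).
by apply/funext => y; rewrite mxE.
Qed.

Lemma partial_eq U (f g : 'rV[R]_n -> R) b x : open U -> U x ->
  (forall y, U y -> f y = g y) -> partial b f x = partial b g x.
Proof.
move=> oU Ux fg; rewrite /partial; apply: near_eq_derive.
exact: filterS (open_nbhs_nbhs (conj oU Ux)).
Qed.

(* The transpose of the usual Jacobian matrix: vectors are rows. *)
Definition jacm m (f : 'rV[R]_n -> 'rV[R]_m) x : 'M[R]_(n, m) :=
  \matrix_(i, j) partial i (fun y => f y 0 j) x.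

Definition grad (h : 'rV[R]_n -> R) x : 'rV[R]_n := \row_i partial i h x.

Lemma smooth_on_grad U h : open U -> sm U h -> smooth_on U (grad h).
Proof.
move=> oU hs i j; apply: (sm_eq oU _ (sm_partial j hs)) => x _.
by rewrite mxE.
Qed.

Lemma smooth_on_jacm m U (f : 'rV[R]_n -> 'rV[R]_m) : open U -> smooth_on U f -> smooth_on U (jacm f).
Proof.
move=> oU fs i j; apply: (sm_eq oU _ (sm_partial i (fs 0 j))) => x _.
by rewrite mxE.
Qed.

Lemma smooth_on_differentiable m U (f : 'rV[R]_n -> 'rV[R]_m) x : open U -> U x ->
  smooth_on U f -> differentiable f x.
Proof.
by move=> oU Ux fs; apply: differentiable_rowP => i; exact: (sm_diff oU (fs 0 i)).
Qed.

Lemma jacobianE m U (f : 'rV[R]_n -> 'rV[R]_m) x : open U -> U x ->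
  smooth_on U f -> jacobian f x = jacm f x.
Proof.
move=> oU Ux fs; have df := smooth_on_differentiable oU Ux fs.
apply/row_matrixP => i; rewrite !rowE.
rewrite -deriveEjacobian//; last first.
rewrite derive_mx; last exact: diff_derivable.
by apply/rowP => j; rewrite -rowE !mxE.
Qed.

End SmoothMatrices.

Lemma sm_comp (R : realType) n m (U : set 'rV[R]_n) (V : set 'rV[R]_m) g
    (F : 'rV[R]_n -> 'rV[R]_m) : open U -> open V -> smooth_on U F -> sm V g ->
  (forall x, U x -> V (F x)) -> sm U (fun x => g (F x)).
Proof. by move=> oU oV Fs gs UV k; apply: (Ck_comp oU oV _ (gs k) UV) => i; exact: Fs. Qed.

Lemma smooth_on_comp (R : realType) n m p q (U : set 'rV[R]_n) (V : set 'rV[R]_m)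
    (G : 'rV[R]_m -> 'M[R]_(p, q)) (F : 'rV[R]_n -> 'rV[R]_m) :
  open U -> open V -> smooth_on U F -> smooth_on V G ->
  (forall x, U x -> V (F x)) -> smooth_on U (fun x => G (F x)).
Proof. by move=> oU oV Fs Gs UV i j; apply: (sm_comp oU oV Fs (Gs i j) UV). Qed.

Lemma partial_chain (R : realType) n m (U : set 'rV[R]_n) (V : set 'rV[R]_m) g
    (F : 'rV[R]_n -> 'rV[R]_m) x l : open U -> open V -> smooth_on U F -> sm V g ->
  U x -> V (F x) ->
  partial l (fun y => g (F y)) x = \sum_i jacm F x l i * partial i g (F x).
Proof.
move=> oU oV Fs gs Ux VFx.
rewrite [LHS](partial_comp (g := g)); last first.
- exact: (sm_diff oV gs).
- exact: (smooth_on_differentiable oU Ux Fs).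
by apply: eq_bigr => i _; rewrite mxE mulrC.
Qed.

Lemma jacm_chain (R : realType) n m p (U : set 'rV[R]_n) (V : set 'rV[R]_m)
    (G : 'rV[R]_m -> 'rV[R]_p)
    (F : 'rV[R]_n -> 'rV[R]_m) x : open U -> open V -> smooth_on U F -> smooth_on V G ->
  U x -> V (F x) ->
  jacm (G \o F) x = jacm F x *m jacm G (F x).
Proof.
move=> oU oV Fs Gs Ux VFx; apply/matrixP => i j; rewrite !mxE.
rewrite [LHS](partial_chain i oU oV Fs (Gs 0 j) Ux VFx).
by apply: eq_bigr => l _; rewrite !mxE.
Qed.

Lemma jacm_id (R : realType) n (x : 'rV[R]_n) : jacm id x = 1%:M.
Proof.
apply/matrixP => i j; rewrite !mxE /partial.
by have [_ ->] := is_derive_coord x (delta_mx 0 i) j; rewrite mxE eqxx/= eq_sym.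
Qed.

(** * The Schouten bracket in coordinates *)

Section Schouten.
Local Opaque partial.
Variables (R : realType) (n : nat).
Implicit Types (U V : set 'rV[R]_n) (p : 'rV[R]_n -> 'M[R]_n) (w : 'M[R]_n).

Definition sch0 p x (i j k : 'I_n) : R :=
  \sum_l p x i l * partial l (fun y => p y j k) x.

(** Half of the bracket of p with itself: the two sums in [schouten] coincide when both arguments
    are equal. *)
Definition sch p x i j k : R := sch0 p x i j k + sch0 p x j k i + sch0 p x k i j.

Lemma sch_eq U p q x i j k : open U -> U x -> (forall y, U y -> p y = q y) ->
  sch p x i j k = sch q x i j k.
Proof.
move=> oU Ux pq; rewrite /sch /sch0.
have E a b d : \sum_l p x a l * partial l (fun y => p y b d) x =
    \sum_l q x a l * partial l (fun y => q y b d) x.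
  apply: eq_bigr => l _; rewrite pq//; congr (_ * _).
  by apply: (partial_eq _ oU Ux) => y /pq ->.
by rewrite (E i j k) (E j k i) (E k i j).
Qed.

(** Naturality of the bracket for f-related fields. Differentiating J^T r J = p(f) gives the
    transformed derivative of r plus two terms with second derivatives of f; these cancel in the
    cyclic sum because second derivatives commute and r is antisymmetric. *)
Lemma sch_related U V (f : 'rV[R]_n -> 'rV[R]_n) r p x i j k :
  open U -> open V -> smooth_on U f -> smooth_on U r -> smooth_on V p ->
  (forall y, U y -> V (f y)) -> (forall y, U y -> (r y)^T = - r y) ->
  (forall y, U y -> (jacm f y)^T *m r y *m jacm f y = p (f y)) -> U x ->
  sch p (f x) i j k =
  \sum_a \sum_b \sum_c jacm f x a i * jacm f x b j * jacm f x c k * sch r x a b c.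
Proof.
move=> oU oV fs rs ps UV ra rel Ux.
have Js := smooth_on_jacm oU fs.
(* The abbreviations come from existential statements so that they are opaque to the rewriting
   below. *)
have [J JE] : exists J, J = jacm f x by exists (jacm f x).
have [P PE] : exists P, P = r x by exists (r x).
have [u uE] : exists u, u = J^T *m P by exists (J^T *m P).
have [H HE] : exists H : 'I_n -> 'M[R]_n, forall b, H b = dmx b (jacm f) x.
  by exists (fun b => dmx b (jacm f) x).
have [D DE] : exists D : 'I_n -> 'M[R]_n, forall b, D b = dmx b r x.
  by exists (fun b => dmx b r x).
have PJ : P *m J = - u^T.
  by rewrite uE trmx_mul trmxK PE (ra _ Ux) mulNmx opprK.
have Hsym b c m : H b c m = H c b m.
  have E b' c' : H b' c' m = partial b' (partial c' (fun y => f y 0 m)) x.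
    rewrite HE mxE; congr (partial b' _ x).
    by apply/funext => y; rewrite mxE.
  by rewrite (E b c) (E c b); exact: (C2_sym _ _ oU Ux (fs 0 m 2)).
rewrite -JE.
have key a b d : sch0 p (f x) a b d =
   \sum_m u a m * ((J^T *m D m *m J) b d) - \sum_m \sum_c u a m * H m c b * u d c
   + \sum_m \sum_c u a m * H m c d * u b c.
  rewrite /sch0.
  have E1 m : \sum_l J m l * partial l (fun y => p y b d) (f x) =
     (J^T *m D m *m J) b d - \sum_c H m c b * u d c + \sum_c H m c d * u b c.
    rewrite JE -(partial_chain m oU oV fs (ps b d) Ux (UV _ Ux)) -JE.
    have -> : partial m (fun y => p (f y) b d) x =
       dmx m (fun y => (jacm f y)^T *m r y *m jacm f y) x b d.
      rewrite mxE; apply: (partial_eq _ oU Ux) => y Uy.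
      by rewrite rel.
    have Jts := smooth_on_tr oU Js.
    rewrite (dmxM _ (smooth_onM oU Jts rs) Js Ux) (dmxM _ Jts rs Ux) dmx_tr.
    rewrite -JE -PE -HE -DE.
    have A1 : ((H m)^T *m P *m J) b d = - \sum_c H m c b * u d c.
      rewrite -mulmxA PJ mulmxN mxE; congr (- _).
      by rewrite mxE; apply: eq_bigr => c _; rewrite [(H m)^T b c]mxE [u^T c d]mxE.
    have A2 : (J^T *m P *m H m) b d = \sum_c H m c d * u b c.
      by rewrite -uE mxE; apply: eq_bigr => c _; rewrite mulrC.
    rewrite mulmxDl mxE A2 [X in X + _]mxE A1; congr (_ + _); exact: addrC.
  have E2 l : p (f x) a l = \sum_m u a m * J m l.
    by rewrite -(rel _ Ux) -JE -PE -uE mxE.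
  under eq_bigr do rewrite E2 mulr_suml.
  rewrite exchange_big/=.
  have -> : \sum_m \sum_l u a m * J m l * partial l (fun y => p y b d) (f x) =
      \sum_m u a m * ((J^T *m D m *m J) b d - \sum_c H m c b * u d c + \sum_c H m c d * u b c).
    apply: eq_bigr => m _; rewrite -E1 mulr_sumr.
    by apply: eq_bigr => l _; rewrite mulrA.
  rewrite -sumrB -big_split/=; apply: eq_bigr => m _.
  rewrite mulrDr mulrBr; congr (_ - _ + _).
    by rewrite mulr_sumr; apply: eq_bigr => c _; rewrite mulrA.
  by rewrite mulr_sumr; apply: eq_bigr => c _; rewrite mulrA.
have hsym a b d : \sum_m \sum_c u a m * H m c b * u d c = \sum_m \sum_c u d m * H m c b * u a c.
  rewrite exchange_big/=; apply: eq_bigr => m _; apply: eq_bigr => c _.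
  by rewrite Hsym mulrC mulrA mulrAC.
have main a b d : \sum_m u a m * ((J^T *m D m *m J) b d) =
   \sum_a' \sum_b' \sum_d' J a' a * J b' b * J d' d * sch0 r x a' b' d'.
  transitivity (\sum_m \sum_a' \sum_b' \sum_d' J a' a * P a' m * (J b' b * D m b' d' * J d' d)).
    apply: eq_bigr => m _.
    have JDJ : (J^T *m D m *m J) b d = \sum_b' \sum_d' J b' b * D m b' d' * J d' d.
      rewrite mxE exchange_big/=; apply: eq_bigr => d' _.
      by rewrite mxE mulr_suml; apply: eq_bigr => b' _; rewrite [J^T b b']mxE.
    have ua : u a m = \sum_a' J a' a * P a' m.
      by rewrite uE mxE; apply: eq_bigr => a' _; rewrite [J^T a a']mxE.
    rewrite ua JDJ mulr_suml; apply: eq_bigr => a' _.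
    rewrite mulr_sumr; apply: eq_bigr => b' _.
    by rewrite mulr_sumr.
  rewrite exchange_big/=; apply: eq_bigr => a' _.
  rewrite exchange_big/=; apply: eq_bigr => b' _.
  rewrite exchange_big/=; apply: eq_bigr => d' _.
  rewrite /sch0 mulr_sumr; apply: eq_bigr => m _.
  by rewrite DE mxE PE; ring.
have perm1 a b d : \sum_a' \sum_b' \sum_d' J a' b * J b' d * J d' a * sch0 r x a' b' d' =
   \sum_a' \sum_b' \sum_d' J a' a * J b' b * J d' d * sch0 r x b' d' a'.
  rewrite [RHS]exchange_big/=; apply: eq_bigr => b' _.
  rewrite [RHS]exchange_big/=; apply: eq_bigr => d' _.
  by apply: eq_bigr => a' _; congr (_ * _); ring.
have perm2 a b d : \sum_a' \sum_b' \sum_d' J a' d * J b' a * J d' b * sch0 r x a' b' d' =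
   \sum_a' \sum_b' \sum_d' J a' a * J b' b * J d' d * sch0 r x d' a' b'.
  rewrite exchange_big/=; apply: eq_bigr => a' _.
  rewrite exchange_big/=; apply: eq_bigr => b' _.
  by apply: eq_bigr => d' _; congr (_ * _); ring.
rewrite /sch !key !main (perm1 i j k) (perm2 i j k).
rewrite (hsym i j k) (hsym j k i) (hsym k i j).
transitivity (\sum_a' \sum_b' \sum_d' J a' i * J b' j * J d' k * sch0 r x a' b' d' +
  \sum_a' \sum_b' \sum_d' J a' i * J b' j * J d' k * sch0 r x b' d' a' +
  \sum_a' \sum_b' \sum_d' J a' i * J b' j * J d' k * sch0 r x d' a' b').
  ring.
rewrite -!big_split/=; apply: eq_bigr => a' _.
rewrite -!big_split/=; apply: eq_bigr => b' _.
by rewrite -!big_split/=; apply: eq_bigr => d' _; rewrite -!mulrDr.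
Qed.

(** The invertible J is cancelled from one index at a time. *)
Lemma trilinear0 (J : 'M[R]_n) (T : 'I_n -> 'I_n -> 'I_n -> R) : J \in unitmx ->
  (forall i j k, \sum_a \sum_b \sum_c J a i * J b j * J c k * T a b c = 0) ->
  forall a b c, T a b c = 0.
Proof.
move=> Ju H.
have inj (r : 'I_n -> R) : (forall i, \sum_a J a i * r a = 0) -> forall a, r a = 0.
  move=> h a.
  have E : (\row_a r a) *m J = 0.
    by apply/rowP => i; rewrite !mxE -[RHS](h i); apply: eq_bigr => b _; rewrite mxE mulrC.
  have : (\row_a r a) = 0 by rewrite -[LHS](mulmxK Ju) E mul0mx.
  by move/rowP/(_ a); rewrite !mxE.
have H1 j k a : \sum_b \sum_c J b j * J c k * T a b c = 0.
  apply: (inj (fun a => \sum_b \sum_c J b j * J c k * T a b c)) => i.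
  rewrite -[RHS](H i j k); apply: eq_bigr => a' _; rewrite mulr_sumr.
  apply: eq_bigr => b _; rewrite mulr_sumr; apply: eq_bigr => c _.
  by rewrite !mulrA.
have H2 k a b : \sum_c J c k * T a b c = 0.
  apply: (inj (fun b => \sum_c J c k * T a b c)) => i.
  rewrite -[RHS](H1 i k a); apply: eq_bigr => b' _; rewrite mulr_sumr.
  by apply: eq_bigr => c _; rewrite !mulrA.
by move=> a b c; apply: (inj (fun c => T a b c)) => i; exact: H2.
Qed.

Definition wedge (a b : 'rV[R]_n) : 'M[R]_n := a^T *m b - b^T *m a.

Definition dec w := exists a b, w = wedge a b.

Lemma wedgeE a b i j : wedge a b i j = a 0 i * b 0 j - b 0 i * a 0 j.
Proof. by rewrite !mxE !big_ord1 !mxE. Qed.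

Lemma wedge_anti a b : (wedge a b)^T = - wedge a b.
Proof. by apply/matrixP => i j; rewrite mxE wedgeE mxE wedgeE; ring. Qed.

Lemma dec_anti w : dec w -> w^T = - w.
Proof. by move=> [a [b ->]]; exact: wedge_anti. Qed.

Lemma dec_pluecker w i j k l : dec w -> w i j * w k l + w j k * w i l + w k i * w j l = 0.
Proof. by move=> [a [b ->]]; rewrite !wedgeE; ring. Qed.

Lemma dec_congr w (M : 'M[R]_n) : dec w -> dec (M^T *m w *m M).
Proof.
move=> [a [b ->]]; exists (a *m M), (b *m M).
by rewrite /wedge !trmx_mul mulmxBr mulmxBl !mulmxA.
Qed.

Lemma decZ (c : R) w : dec w -> dec (c *: w).
Proof.
move=> [a [b ->]]; exists (c *: a), b.
by apply/matrixP => i j; rewrite mxE !wedgeE !mxE; ring.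
Qed.

(** The terms containing derivatives of c are contractions of grad c with the cyclic sum of p^il
    p^jk, which is a Plucker relation. Decomposability is what allows rescaling by an arbitrary
    function. *)
Lemma schZ U (c : 'rV[R]_n -> R) p x : sm U c -> smooth_on U p -> U x -> dec (p x) ->
  (forall i j k, sch p x i j k = 0) ->
  forall i j k, sch (fun y => c y *: p y) x i j k = 0.
Proof.
move=> cs ps Ux dp H i j k.
have E a b d : sch0 (fun y => c y *: p y) x a b d = c x ^+ 2 * sch0 p x a b d +
   c x * \sum_l partial l c x * (p x a l * p x b d).
  rewrite /sch0 !mulr_sumr -big_split/=; apply: eq_bigr => l _.
  have -> : partial l (fun y => (c y *: p y) b d) x =
     c x * partial l (fun y => p y b d) x + p x b d * partial l c x.
    rewrite -(partialM l cs (ps b d) Ux); congr (partial l _ x).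
    by apply/funext => y; rewrite mxE.
  rewrite mxE; ring.
rewrite /sch !E.
have -> : forall a b d e f g h : R, a * b + c x * e + (a * d + c x * f) + (a * h + c x * g) =
   a * (b + d + h) + c x * (e + f + g) by move=> *; ring.
rewrite -/(sch p x i j k) H mulr0 add0r -!big_split/= big1 ?mulr0// => l _.
rewrite -!mulrDr (_ : _ + _ + _ = 0) ?mulr0//.
rewrite -[RHS](dec_pluecker i j k l dp); ring.
Qed.

End Schouten.

Lemma open_preim (T : topologicalType) (S : topologicalType) (U : set T) (f : T -> S) (V : set S) :
  open U -> (forall x, U x -> {for x, continuous f}) -> open V ->
  open (U `&` f @^-1` V).
Proof.
move=> oU fc oV; rewrite openE => x [Ux Vfx].
apply: filterI; first exact: open_nbhs_nbhs.
exact: (fc x Ux _ (open_nbhs_nbhs (conj oV Vfx))).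
Qed.

(** * Pulls *)

Section Pull.
Variables (R : realType) (n : nat).
Local Opaque partial.
Implicit Types (U V : set 'rV[R]_n) (p : 'rV[R]_n -> 'M[R]_n) (v : 'rV[R]_n -> 'rV[R]_n).

(** For antisymmetric T, B = 1 + g^T e and D = det B = 1 + e g^T, this is D B^-T T B^-1. In that
    product the term with 1/D contains g T g^T = 0, so the rest is polynomial in g and makes sense
    for D = 0. *)
Definition Phi (T : 'M[R]_n) (e g : 'rV[R]_n) : 'M[R]_n :=
  (1 + (e *m g^T) 0 0) *: T - T *m (g^T *m e) - (e^T *m g) *m T.

Lemma scal_mid (a b c d : 'rV[R]_n) :
  (a^T *m b) *m (c^T *m d) = (b *m c^T) 0 0 *: (a^T *m d).
Proof.
rewrite mulmxA -(mulmxA a^T) [b *m c^T]mx11_scalar mul_mx_scalar.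
by rewrite -scalemxAl !mxE.
Qed.

Lemma anti_quad (T : 'M[R]_n) (g : 'rV[R]_n) : T^T = - T -> g *m T *m g^T = 0.
Proof.
move=> aT; apply/matrixP => i j; rewrite !ord1.
have E : (g *m T *m g^T)^T = - (g *m T *m g^T).
  by rewrite !trmx_mul trmxK aT mulmxA mulmxN mulNmx.
move: (g *m T *m g^T) E => M E; move/matrixP/(_ 0 0): E.
by rewrite !mxE => E; lra.
Qed.

Lemma dot_sym (e g : 'rV[R]_n) : (g *m e^T) 0 0 = (e *m g^T) 0 0.
Proof. by rewrite -[g *m e^T]trmxK trmx_mul trmxK mxE. Qed.

Lemma Phi_rel (T : 'M[R]_n) (e g : 'rV[R]_n) : T^T = - T ->
  (1%:M + g^T *m e)^T *m Phi T e g *m (1%:M + g^T *m e) = (1 + (e *m g^T) 0 0) *: T.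
Proof.
move=> aT; rewrite /Phi.
have -> : (1%:M + g^T *m e)^T = 1%:M + e^T *m g.
  by rewrite [LHS]linearD/= trmx1 trmx_mul trmxK.
set s := (e *m g^T) 0 0; set G := g^T *m e; set H := e^T *m g.
have GG : G *m G = s *: G by rewrite /G scal_mid.
have HH : H *m H = s *: H by rewrite /H scal_mid dot_sym.
have HTG : H *m T *m G = 0.
  by rewrite /H /G -!mulmxA [g *m _]mulmxA [g *m _ *m _]mulmxA anti_quad// mul0mx mulmx0.
rewrite -[LHS]mulmxA.
have -> : ((1 + s) *: T - T *m G - H *m T) *m (1%:M + G) = (1 + s) *: T - H *m T.
  rewrite mulmxDr mulmx1 !mulmxBl HTG -(mulmxA T) GG -scalemxAr -scalemxAl.
  by move: (T *m G) (H *m T) => a b; apply/matrixP => i j; rewrite !mxE; ring.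
rewrite mulmxDl mul1mx mulmxBr mulmxA HH -scalemxAl -scalemxAr.
by move: (H *m T) => b; apply/matrixP => i j; rewrite !mxE; ring.
Qed.

(** Where D = 0 the formula reduces to the wedge of e and - g T. Elsewhere the two factors of T are
    corrected by multiples of e. *)
Lemma Phi_dec (T : 'M[R]_n) e g : dec T -> dec (Phi T e g).
Proof.
move=> [p [q ->]]; rewrite /Phi.
have [D0|D0] := eqVneq (1 + (e *m g^T) 0 0) 0.
  exists e, (- (g *m wedge p q)).
  rewrite D0 scale0r sub0r; set W := wedge p q.
  have aW : W^T = - W by exact: wedge_anti.
  rewrite /wedge.
  have -> : (- (g *m W))^T = W *m g^T by rewrite [LHS]linearN/= trmx_mul aW mulNmx opprK.
  by rewrite mulmxN addrC !mulmxA.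
pose al := (p *m g^T) 0 0; pose be := (q *m g^T) 0 0.
exists ((1 + (e *m g^T) 0 0) *: p - al *: e), (q - (be / (1 + (e *m g^T) 0 0)) *: e).
have A1 : wedge p q *m (g^T *m e) = be *: (p^T *m e) - al *: (q^T *m e).
  by rewrite /wedge mulmxBl !scal_mid.
have A2 : (e^T *m g) *m wedge p q = al *: (e^T *m q) - be *: (e^T *m p).
  by rewrite /wedge mulmxBr !scal_mid !(dot_sym _ g).
rewrite {}A1 {}A2; move: (1 + _) D0 al be => D D0 al be.
by apply/matrixP => i j; rewrite wedgeE !mxE !big_ord1 !mxE; field.
Qed.

Definition Amat v (h : R) y : 'M[R]_n := 1%:M + h *: jacm v y.

(* For f(y) = y + h(y) v(y), g = grad h and A = 1 + h Dv one has
   J = A + g^T v, and [Psi p v h g y] is D J^-T p(f y) J^-1 with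
   D = 1 + v A^-1 g^T, expanded so as to make sense when D = 0. *)
Definition Psi p v (h : R) (g : 'rV[R]_n) y : 'M[R]_n :=
  let A := Amat v h y in
  Phi ((invmx A)^T *m p (y + h *: v y) *m invmx A) (v y *m invmx A) g.

Lemma Psi0 p v y : Psi p v 0 0 y = p y.
Proof.
rewrite /Psi /Amat !scale0r !addr0 invmx1 trmx1 mul1mx !mulmx1 /Phi.
by rewrite trmx0 !(mul0mx, mulmx0) mxE addr0 scale1r !subr0.
Qed.

Lemma Psi_dec p v h g y : dec (p (y + h *: v y)) -> dec (Psi p v h g y).
Proof. by move=> dp; apply: Phi_dec; exact: dec_congr. Qed.

Lemma shear_jacm U (h : 'rV[R]_n -> R) v y : open U -> sm U h -> smooth_on U v -> U y ->
  jacm (fun y => y + h y *: v y) y = Amat v (h y) y + (grad h y)^T *m v y.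
Proof.
move=> oU hs vs Uy; apply/matrixP => i j.
have AE : Amat v (h y) y i j = (i == j)%:R + h y * partial i (fun z => v z 0 j) y.
  rewrite /Amat [LHS]mxE; congr (_ + _); first by rewrite mxE.
  by rewrite [LHS]mxE; congr (_ * _); rewrite mxE.
have GE : ((grad h y)^T *m v y) i j = partial i h y * v y 0 j.
  by rewrite [LHS]mxE big_ord1; congr (_ * _); rewrite [LHS]mxE mxE.
rewrite [LHS]mxE [RHS]mxE AE GE -addrA.
have -> : h y * partial i (fun z => v z 0 j) y + partial i h y * v y 0 j =
    partial i (fun z => h z * v z 0 j) y.
  by rewrite (partialM i hs (vs 0 j) Uy) [v y 0 j * _]mulrC.
have -> : (i == j)%:R = partial i (fun z : 'rV[R]_n => z 0 j) y.
  by have := congr1 (fun M : 'M[R]_n => M i j) (jacm_id y); rewrite !mxE.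
rewrite -(partialD i (Ck_coord_sm U j) _ Uy).
  by congr (partial i _ y); apply/funext => z; rewrite !mxE.
by move=> k; exact: (CkM oU (hs k) (vs 0 j k)).
Qed.

(** The point, the height and the gradient are functions on an auxiliary space of dimension N.
    Besides N = n, the value N = 1 + n makes a perturbation parameter one of the variables. *)
Lemma smooth_on_Psi N (W : set 'rV[R]_N) U V p v (X : 'rV[R]_N -> 'rV[R]_n)
   (h : 'rV[R]_N -> R) (g : 'rV[R]_N -> 'rV[R]_n) :
  open W -> open U -> open V -> smooth_on W X -> sm W h -> smooth_on W g ->
  smooth_on U v -> smooth_on V p ->
  (forall z, W z -> U (X z)) -> (forall z, W z -> V (X z + h z *: v (X z))) ->
  (forall z, W z -> Amat v (h z) (X z) \in unitmx) ->
  smooth_on W (fun z => Psi p v (h z) (g z) (X z)).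
Proof.
move=> oW oU oV Xs hs gs vs ps WU WV Au.
have vX : smooth_on W (fun z => v (X z)) by apply: (smooth_on_comp oW oU Xs vs WU).
have As : smooth_on W (fun z => Amat v (h z) (X z)).
  apply: smooth_onD => //; first exact: smooth_on_cst.
  apply: smooth_onZ => //.
  exact: (smooth_on_comp oW oU Xs (smooth_on_jacm oU vs) WU).
have iAs := smooth_on_inv oW As Au.
have fs : smooth_on W (fun z => X z + h z *: v (X z)).
  by apply: smooth_onD => //; exact: smooth_onZ.
have Ts : smooth_on W (fun z => (invmx (Amat v (h z) (X z)))^T *m p (X z + h z *: v (X z)) *m invmx (Amat v (h z) (X z))).
  apply: smooth_onM => //; apply: smooth_onM => //; first exact: smooth_on_tr.
  exact: (smooth_on_comp oW oV fs ps WV).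
have es : smooth_on W (fun z => v (X z) *m invmx (Amat v (h z) (X z))) by exact: smooth_onM.
have gts : smooth_on W (fun z => (g z)^T) by exact: smooth_on_tr.
rewrite /Psi /Phi; apply: smooth_onB => //; [apply: smooth_onB => //|].
- apply: smooth_onZ => //.
  have egs : smooth_on W (fun z => v (X z) *m invmx (Amat v (h z) (X z)) *m (g z)^T) by exact: smooth_onM.
  by move=> k; apply: (CkD oW (Ck_cst k W 1) (egs 0 0 k)).
- by do 2 apply: smooth_onM => //.
- by apply: smooth_onM => //; apply: smooth_onM => //; exact: smooth_on_tr.
Qed.

End Pull.

Lemma open_neq0 (R : realType) : open [set s : R | s != 0].
Proof. exact: open_neq. Qed.

(** * Pulls of Poisson fields are Poisson, also at degenerate points *)

Section Perturbation.
Variables (R : realType) (n : nat).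
Implicit Types (U V : set 'rV[R]_n) (p : 'rV[R]_n -> 'M[R]_n) (v : 'rV[R]_n -> 'rV[R]_n).

(** The perturbation parameter s becomes an extra first coordinate. Smoothness on R^(1 + n) then
    gives continuity in s of the partial derivatives of the slices. *)
Definition emb (s : R) (y : 'rV[R]_n) : 'rV[R]_(1 + n) := row_mx s%:M y.

Lemma partial_emb (phi : 'rV[R]_(1 + n) -> R) s y l :
  partial l (fun z => phi (emb s z)) y = partial (rshift 1 l) phi (emb s y).
Proof.
have E : delta_mx 0 (rshift 1 l) = row_mx 0 (delta_mx 0 l) :> 'rV[R]_(1 + n).
  apply/rowP => j; rewrite !mxE; case: splitP => k jk; rewrite !mxE.
    by apply/eqP; rewrite eqxx/= -val_eqE/= jk; case: k {jk} => -[].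
  by rewrite eqxx/= -val_eqE/= jk eqn_add2l.
rewrite /partial /derive.
suff -> : (fun h : R => h^-1 *: (((fun z => phi (emb s z)) \o shift y) (h *: delta_mx 0 l) - phi (emb s y)))
  = (fun h => h^-1 *: ((phi \o shift (emb s y)) (h *: delta_mx 0 (rshift 1 l)) - phi (emb s y))) by [].
apply/funext => t /=; congr (_ *: (phi _ - _)).
by rewrite E /emb scale_row_mx add_row_mx scaler0 add0r.
Qed.

Lemma is_derive_quot (f : 'rV[R]_n -> R) x w (d : R) :
  (forall h : R, f (h *: w + x) - f x = h * d) -> 'D_w f x = d.
Proof.
move=> H; rewrite /derive.
have E : (fun h : R => h^-1 *: ((f \o shift x) (h *: w) - f x)) @ 0^' --> d.
  apply: cvg_near_cst; near=> h => /=.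
  rewrite H /GRing.scale/= mulrA mulVf ?mul1r//.
  by near: h; exact: nbhs_dnbhs_neq.
exact: (cvg_lim _ E).
Unshelve. all: by end_near. Qed.

Lemma partial_affine (a c : 'I_n -> R) l x :
  partial l (fun y => \sum_m (y 0 m - a m) * c m) x = c l.
Proof.
apply: is_derive_quot => h; rewrite -sumrB.
have -> : h * c l = \sum_m (if m == l then h * c l else 0) by rewrite -big_mkcond big_pred1_eq.
apply: eq_bigr => m _; rewrite !mxE eqxx/=.
case: eqP => [->|_]/=; first by ring.
by rewrite mulr0 add0r subrr.
Qed.

Lemma partial_sum_lin (f : 'I_n -> 'rV[R]_n -> R) (c : 'I_n -> R) l x :
  (forall m, derivable (f m) x (delta_mx 0 l)) ->
  partial l (fun y => \sum_m f m y * c m) x = \sum_m partial l (f m) x * c m.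
Proof.
move=> df; have D m : is_derive x (delta_mx 0 l) (c m \*: f m) (c m *: partial l (f m) x).
  by apply: is_deriveZ; exact: derivableP.
have -> : (fun y => \sum_m f m y * c m) = \sum_m (c m \*: f m).
  by apply/funext => y; rewrite fct_sumE; apply: eq_bigr => m _; rewrite mulrC.
rewrite /partial derive_sum; last by move=> m; have := D m; case.
by apply: eq_bigr => m _; have [_ ->] := D m; rewrite mulrC.
Qed.

Lemma partial_cst (c : R) l (x : 'rV[R]_n) : partial l (fun=> c) x = 0.
Proof. exact: derive_cst. Qed.

Lemma emb_continuous_l y : continuous (emb ^~ y).
Proof.
move=> s; apply: mx_continuous => i j; rewrite (ord1 i) /emb.
case: (split_ordP j) => k ->.
  have -> : (fun s' : R => row_mx s'%:M y 0 (lshift n k)) = id.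
    by apply/funext => t; rewrite row_mxEl (ord1 k) !mxE.
  exact: cvg_id.
have -> : (fun s' : R => row_mx s'%:M y 0 (rshift 1 k)) = (fun=> y 0 k).
  by apply/funext => t; rewrite row_mxEr.
exact: cst_continuous.
Qed.

Lemma emb_continuous_r s : continuous (emb s).
Proof.
move=> y; apply: mx_continuous => i j; rewrite (ord1 i) /emb.
case: (split_ordP j) => k ->.
  have -> : (fun y : 'rV[R]_n => row_mx s%:M y 0 (lshift n k)) = (fun=> s).
    by apply/funext => t; rewrite row_mxEl (ord1 k) !mxE.
  exact: cst_continuous.
have -> : (fun y : 'rV[R]_n => row_mx s%:M y 0 (rshift 1 k)) = (fun y => y 0 k).
  by apply/funext => t; rewrite row_mxEr.
exact: coord_continuous.
Qed.

Lemma continuous_eq0 (F : R -> R) : {for 0, continuous F} ->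
  (forall s, s != 0 -> F s = 0) -> F 0 = 0.
Proof.
move=> Fc F0; apply/eqP; rewrite -normr_eq0 eq_le normr_ge0 andbT.
apply/ler_addgt0Pl => e e0; rewrite addr0.
have /nbhs_ballP[d /= d0 Hd] := near_dist_le e0 Fc.
have : ball 0 d (d / 2).
  by rewrite /ball/= sub0r normrN gtr0_norm ?divr_gt0//; lra.
by move/Hd; rewrite (F0 (d / 2)) ?sub0r ?normrN// gt_eqF// divr_gt0.
Qed.

Local Opaque partial.

Lemma pull_rel U h v p y : open U -> sm U h -> smooth_on U v -> U y ->
  Amat v (h y) y \in unitmx -> (p (y + h y *: v y))^T = - p (y + h y *: v y) ->
  let J := jacm (fun y => y + h y *: v y) y in
  J^T *m Psi p v (h y) (grad h y) y *m J =
  (1 + (v y *m invmx (Amat v (h y) y) *m (grad h y)^T) 0 0) *: p (y + h y *: v y).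
Proof.
move=> oU hs vs Uy Au pa; rewrite /= (shear_jacm oU hs vs Uy) /Psi.
set A := Amat v (h y) y in Au *; set g := grad h y; set q := p _ in pa *.
set T := (invmx A)^T *m q *m invmx A; set e := v y *m invmx A.
pose B := 1%:M + g^T *m e.
have -> : A + g^T *m v y = B *m A.
  by rewrite mulmxDl mul1mx -mulmxA mulmxKV.
have aT : T^T = - T by rewrite !trmx_mul trmxK pa mulNmx mulmxN mulmxA.
have -> : (B *m A)^T *m Phi T e g *m (B *m A) = A^T *m (B^T *m Phi T e g *m B) *m A.
  by rewrite trmx_mul !mulmxA.
rewrite (Phi_rel e g aT) -scalemxAr -scalemxAl; congr (_ *: _).
by rewrite /T !mulmxA -trmx_mul mulVmx// trmx1 mul1mx mulmxKV.
Qed.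

(** The inverse is given by the Sherman-Morrison formula. *)
Lemma shear_unit (e g : 'rV[R]_n) : 1 + (e *m g^T) 0 0 != 0 ->
  1%:M + g^T *m e \in unitmx.
Proof.
set s := (e *m g^T) 0 0 => D0.
have : (1%:M + g^T *m e) *m (1%:M - (1 + s)^-1 *: (g^T *m e)) = 1%:M.
  have GG : (g^T *m e) *m (g^T *m e) = s *: (g^T *m e) by rewrite scal_mid.
  rewrite mulmxDl mul1mx mulmxBr mulmx1 -scalemxAr GG.
  move: (g^T *m e) => G; apply/matrixP => i j; rewrite !mxE.
  by field.
by case/mulmx1_unit.
Qed.

Section PB.
Variables (U V : set 'rV[R]_n) (v : 'rV[R]_n -> 'rV[R]_n) (p : 'rV[R]_n -> 'M[R]_n).
Hypotheses (oU : open U) (oV : open V) (vs : smooth_on U v) (ps : smooth_on V p).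
Hypothesis pd : forall z, V z -> dec (p z).

(** Near x the field r = D^-1 Psi is f-related to p, and J is invertible at x, so the bracket of r
    vanishes there by [sch_related] and [trilinear0]. The factor D is put back by [schZ]. *)
Lemma sch_Psi_D h x : sm U h -> (forall y, U y -> V (y + h y *: v y)) ->
  (forall y, U y -> Amat v (h y) y \in unitmx) -> U x ->
  1 + (v x *m invmx (Amat v (h x) x) *m (grad h x)^T) 0 0 != 0 ->
  (forall i j k, sch p (x + h x *: v x) i j k = 0) ->
  forall i j k, sch (fun y => Psi p v (h y) (grad h y) y) x i j k = 0.
Proof.
move=> hs UV Au Ux D0 H.
pose D (y : 'rV[R]_n) : R := 1 + (v y *m invmx (Amat v (h y) y) *m (grad h y)^T) 0 0.
have As : smooth_on U (fun y => Amat v (h y) y).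
  apply: smooth_onD => //; first exact: smooth_on_cst.
  by apply: smooth_onZ => //; exact: smooth_on_jacm.
have gs := smooth_on_grad oU hs.
have Ds : sm U D.
  have E : smooth_on U (fun y => v y *m invmx (Amat v (h y) y) *m (grad h y)^T).
    apply: smooth_onM => //; last exact: smooth_on_tr.
    by apply: smooth_onM => //; exact: smooth_on_inv.
  by move=> k; apply: (CkD oU (Ck_cst k U 1) (E 0 0 k)).
pose U' := U `&` D @^-1` [set s : R | s != 0].
have oU' : open U'.
  apply: (open_preim oU); last exact: open_neq0.
  by move=> y Uy; exact: sm_continuous Ds Uy.
have U'U : U' `<=` U by move=> y [].
have U'x : U' x by split.
pose P y := Psi p v (h y) (grad h y) y.
have Ps : smooth_on U P.
  exact: (smooth_on_Psi oU oU oV (@smooth_on_id _ _ U) hs gs vs ps).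
pose r y := (D y)^-1 *: P y.
have Ds' : sm U' D by move=> k; apply: Ck_subset (Ds k).
have iDs : sm U' (fun y => (D y)^-1).
  by move=> k; apply: (CkV oU' _ (Ds' k)) => y [].
have rs : smooth_on U' r by apply: smooth_onZ => //; exact: smooth_on_subset Ps.
have rd y : U y -> dec (r y) by move=> Uy; apply: decZ; apply: Psi_dec; apply: pd; exact: UV.
have fs : smooth_on U (fun y => y + h y *: v y).
  apply: smooth_onD => //; first exact: smooth_on_id.
  exact: smooth_onZ.
have rel y : U' y -> (jacm (fun y => y + h y *: v y) y)^T *m r y *m jacm (fun y => y + h y *: v y) y
     = p (y + h y *: v y).
  move=> [Uy Dy]; rewrite /r -scalemxAr -scalemxAl /P.
  rewrite (pull_rel oU hs vs Uy (Au _ Uy)); last by apply: dec_anti; apply: pd; exact: UV.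
  by rewrite scalerA mulVf// scale1r.
have r0 : forall a b c, sch r x a b c = 0.
  apply: (@trilinear0 _ _ (jacm (fun y => y + h y *: v y) x)).
    rewrite (shear_jacm oU hs vs Ux).
    have -> : Amat v (h x) x + (grad h x)^T *m v x =
       (1%:M + (grad h x)^T *m (v x *m invmx (Amat v (h x) x))) *m Amat v (h x) x.
      by rewrite mulmxDl mul1mx mulmxA mulmxKV// Au.
    by rewrite unitmx_mul Au// andbT shear_unit.
  move=> i j k.
  rewrite -(sch_related i j k oU' oV (smooth_on_subset U'U fs) rs ps _ _ rel U'x)//.
    by move=> y /U'U; exact: UV.
  by move=> y /U'U Uy; apply: dec_anti; exact: rd.
move=> i j k.
rewrite (@sch_eq _ _ U' _ (fun y => D y *: r y))//; last first.
  by move=> y [_ Dy]; rewrite /r scalerA mulfV// scale1r.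
exact: (schZ Ds' rs U'x (rd x Ux) r0).
Qed.

End PB.

(* Where D = 0, h is perturbed to h + s (linear form), and s -> 0. *)
Lemma sch_Psi U V v p h x : open U -> open V -> smooth_on U v -> smooth_on V p ->
  (forall z, V z -> dec (p z)) -> sm U h -> (forall y, U y -> V (y + h y *: v y)) ->
  (forall y, U y -> Amat v (h y) y \in unitmx) -> U x ->
  (forall i j k, sch p (x + h x *: v x) i j k = 0) ->
  forall i j k, sch (fun y => Psi p v (h y) (grad h y) y) x i j k = 0.
Proof.
move=> oU oV vs ps pd hs UV Au Ux H i j k.
have [D0|] := eqVneq (1 + (v x *m invmx (Amat v (h x) x) *m (grad h x)^T) 0 0) 0; last first.
  by move=> D0; exact: (sch_Psi_D oU oV vs ps pd).
pose g0 := grad h x.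
(* [lin] vanishes at x and has gradient g0. Adding s [lin] to h keeps f(x) fixed and multiplies the
   gradient at x by 1 + s, which changes D(x) from 0 to - s. *)
pose lin y := ((y - x) *m g0^T) 0 0.
have gs := smooth_on_grad oU hs.
have lins W : open W -> sm W lin.
  move=> oW; apply: (smooth_onM oW _ (smooth_on_cst W g0^T) 0 0).
  by apply: smooth_onB => //; [exact: smooth_on_id|exact: smooth_on_cst].
pose X (z : 'rV[R]_(1 + n)) : 'rV[R]_n := rsubmx z.
pose S (z : 'rV[R]_(1 + n)) : R := z 0 (lshift n 0).
have Xemb s y : X (emb s y) = y by rewrite /X /emb row_mxKr.
have Semb s y : S (emb s y) = s by rewrite /S /emb row_mxEl !mxE.
have Xs W : open W -> smooth_on W X.
  move=> oW a b; apply: (sm_eq oW _ (Ck_coord_sm W (rshift 1 b))) => z _.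
  by rewrite (ord1 a) mxE.
have Ss W : sm W S by exact: Ck_coord_sm.
have oX W : open W -> open (X @^-1` W).
  move=> oW; have := @open_preim _ _ setT X W openT _ oW.
  by rewrite setTI; apply => z _; exact: (smooth_on_continuous (Xs _ openT)).
pose hh z := h (X z) + S z * lin (X z).
pose gg z := grad h (X z) + S z *: g0.
pose W1 := X @^-1` U.
have oW1 : open W1 by exact: oX.
have hhs : sm W1 hh.
  move=> q; apply: CkD => //; first exact: (sm_comp oW1 oU (Xs _ oW1) hs).
  by apply: CkM => //; [exact: Ss|apply: (sm_comp oW1 oU (Xs _ oW1) (lins _ oU))].
have ggs : smooth_on W1 gg.
  apply: smooth_onD => //; first exact: (smooth_on_comp oW1 oU (Xs _ oW1) gs).
  by apply: smooth_onZ => //; exact: smooth_on_cst.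
have vXs : smooth_on W1 (fun z => v (X z)) by exact: (smooth_on_comp oW1 oU (Xs _ oW1) vs).
pose ff z := X z + hh z *: v (X z).
have ffs : smooth_on W1 ff.
  by apply: smooth_onD => //; [exact: Xs|exact: smooth_onZ].
have AAs : smooth_on W1 (fun z => Amat v (hh z) (X z)).
  apply: smooth_onD => //; first exact: smooth_on_cst.
  apply: smooth_onZ => //.
  by exact: (smooth_on_comp oW1 oU (Xs _ oW1) (smooth_on_jacm oU vs)).
pose W2 := W1 `&` ff @^-1` V.
have oW2 : open W2.
  by apply: (open_preim oW1 _ oV) => z W1z; exact: (smooth_on_continuous ffs).
(* The pairs (s, y) at which the perturbed pull is defined. All pairs (s, x) belong to it, since the
   height at x is not perturbed. *)
pose W3 := W2 `&` (fun z => \det (Amat v (hh z) (X z)) : R) @^-1` [set s : R | s != 0].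
have oW3 : open W3.
  apply: (open_preim oW2); last exact: open_neq0.
  by move=> z [W1z _]; exact: (sm_continuous (sm_det oW1 AAs)).
have W31 : W3 `<=` W1 by move=> z [[]].
pose PP z := Psi p v (hh z) (gg z) (X z).
have Ps : smooth_on W3 PP.
  apply: (smooth_on_Psi oW3 oU oV (Xs _ oW3) _ _ vs ps) => //.
  - by move=> q; exact: (Ck_subset W31).
  - exact: (smooth_on_subset W31).
  - by move=> z [[]].
  - by move=> z [_]; rewrite unitmxE unitfE.
have W3x s : W3 (emb s x).
  have E : hh (emb s x) = h x.
    by rewrite /hh Xemb /lin subrr mul0mx mxE mulr0 addr0.
  split; last by rewrite /= E Xemb; have := Au _ Ux; rewrite unitmxE unitfE.
  by split; rewrite /W1/= ?Xemb//= /ff E Xemb; exact: UV.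
pose hs_ s y := h y + s * lin y.
pose Us s := U `&` emb s @^-1` W3.
have oUs s : open (Us s).
  by apply: (open_preim oU _ oW3) => y _; exact: emb_continuous_r.
have hs_s s : sm U (hs_ s).
  move=> q; apply: CkD => //; apply: CkM => //; first exact: Ck_cst.
  exact: lins.
have grads s y : U y -> grad (hs_ s) y = grad h y + s *: g0.
  move=> Uy; apply/rowP => l; rewrite [LHS]mxE.
  have linl : partial l lin y = g0 0 l.
    have -> : lin = (fun y => \sum_m (y 0 m - x 0 m) * g0 0 m).
      apply/funext => z; rewrite /lin mxE; apply: eq_bigr => m _.
      by rewrite [g0^T m 0]mxE [(z - x) 0 m]mxE [(- x) 0 m]mxE.
    exact: partial_affine.
  have Dl : sm U (fun y => s * lin y).
    by move=> q; apply: (CkM oU (Ck_cst q U s) (lins _ oU q)).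
  rewrite (partialD l hs Dl Uy) (partialM l _ (lins _ oU) Uy); last by move=> q; exact: Ck_cst.
  rewrite linl partial_cst mulr0 addr0.
  by rewrite [RHS]mxE; congr (_ + _); rewrite [RHS]mxE// mxE.
have PPE s y : U y -> PP (emb s y) = Psi p v (hs_ s y) (grad (hs_ s) y) y.
  by move=> Uy; rewrite /PP /gg /hh !Xemb !Semb grads.
have UsU s : Us s `<=` U by move=> y [].
have Usx s : Us s x by split; last exact: W3x.
have e0 : (v x *m invmx (Amat v (h x) x) *m g0^T) 0 0 = -1.
  by apply/eqP; rewrite -addr_eq0 addrC D0.
have zero s : s != 0 -> sch (fun y => PP (emb s y)) x i j k = 0.
  move=> s0.
  rewrite (sch_eq i j k (oUs s) (Usx s) (fun y Uy => PPE s y (UsU s y Uy))).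
  have hx : hs_ s x = h x by rewrite /hs_ /lin subrr mul0mx mxE mulr0 addr0.
  apply: (sch_Psi_D (oUs s) oV (smooth_on_subset (UsU s) vs) ps pd).
  - by move=> q; exact: (Ck_subset (UsU s) (hs_s s q)).
  - by move=> y [_ [[_]]] /=; rewrite /ff /hh Xemb Semb.
  - by move=> y [_ [_]] /=; rewrite /hh Xemb Semb unitmxE unitfE.
  - exact: Usx.
  - rewrite hx (grads s x Ux) -/g0 -[X in X + s *: _]scale1r -scalerDl.
    rewrite linearZ/= -scalemxAr mxE e0 mulrN1 opprD addrA subrr sub0r.
    by rewrite oppr_eq0.
  - by rewrite hx.
(* The bracket at x in terms of partial derivatives on R^(1 + n), hence continuous at s = 0. *)
pose G s a b d : R := \sum_l PP (emb s x) a l * partial (rshift 1 l) (fun z => PP z b d) (emb s x).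
have FE s : sch (fun y => PP (emb s y)) x i j k = G s i j k + G s j k i + G s k i j.
  have E a b d : sch0 (fun y => PP (emb s y)) x a b d = G s a b d.
    by apply: eq_bigr => l _; rewrite -partial_emb.
  by rewrite /sch (E i j k) (E j k i) (E k i j).
have Gc a b d : {for 0, continuous (fun s => G s a b d)}.
  apply: (@cvg_sumr R R _ (nbhs (0 : R))) => l _.
  apply: cvgM.
    apply: (@continuous_comp R 'rV[R]_(1 + n) R (emb ^~ x) (fun z => PP z a l)).
      exact: emb_continuous_l.
    exact: (sm_continuous (Ps a l) (W3x 0)).
  apply: (@continuous_comp R 'rV[R]_(1 + n) R (emb ^~ x)).
    exact: emb_continuous_l.
  exact: (sm_continuous (sm_partial _ (Ps b d)) (W3x 0)).
have : sch (fun y => PP (emb 0 y)) x i j k = 0.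
  rewrite FE; apply: (@continuous_eq0 (fun s => G s i j k + G s j k i + G s k i j)).
    by apply: continuousD; [apply: continuousD|]; exact: Gc.
  by move=> s s0; rewrite -FE zero.
have hs0 : hs_ 0 = h by apply/funext => y; rewrite /hs_ mul0r addr0.
have E := sch_eq i j k oU Ux (PPE 0).
by rewrite hs0 in E => Z; exact: (etrans (esym E) Z).
Qed.

End Perturbation.

(** * Splitting off a transverse direction; collapse onto a hyperplane *)

Section Transverse.
Variables (R : realType) (n : nat).
Implicit Types (U V : set 'rV[R]_n) (p : 'rV[R]_n -> 'M[R]_n) (v : 'rV[R]_n -> 'rV[R]_n).
Implicit Types (w : 'rV[R]_n) (q : 'M[R]_n).

Lemma derive_dir (f : 'rV[R]_n -> R) x w : differentiable f x ->
  'D_w f x = \sum_l w 0 l * partial l f x.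
Proof.
move=> df; rewrite /partial deriveE//.
rewrite [X in 'd f x X]row_sum_delta linear_sum; apply: eq_bigr => i _.
by rewrite linearZ -deriveE.
Qed.

Local Opaque partial.

Definition nsq w : R := (w *m w^T) 0 0.

Lemma nsqE w : nsq w = \sum_i w 0 i ^+ 2.
Proof. by rewrite /nsq mxE; apply: eq_bigr => i _; rewrite mxE expr2. Qed.

Lemma nsq_neq0 w : w != 0 -> nsq w != 0.
Proof.
apply: contraNneq; rewrite nsqE => /psumr_eq0P H.
apply/eqP/rowP => i; rewrite mxE; apply/eqP; rewrite -sqrf_eq0; apply/eqP.
by apply: H => // j _; exact: sqr_ge0.
Qed.

Definition lrow (l : 'cV[R]_n) q : 'rV[R]_n := l^T *m q.

(** With w = l^T q this is the image under q of the covector - w / |w|^2. It is a choice, smooth in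
    q, of a vector v in the plane of q with l(v) = 1; then q = v wedge w. *)
Definition lvec (l : 'cV[R]_n) q : 'rV[R]_n := - (nsq (lrow l q))^-1 *: (lrow l q *m q).

Lemma lvecP (l : 'cV[R]_n) q : dec q -> lrow l q != 0 ->
  [/\ lvec l q *m l = 1%:M, q = wedge (lvec l q) (lrow l q) & lrow l q *m l = 0].
Proof.
move=> [a [b ->]] /nsq_neq0 N0.
pose al := (a *m l) 0 0; pose be := (b *m l) 0 0.
have la : a *m l = al%:M by rewrite [LHS]mx11_scalar.
have lb : b *m l = be%:M by rewrite [LHS]mx11_scalar.
have lta : l^T *m a^T = al%:M by rewrite -trmx_mul la tr_scalar_mx.
have ltb : l^T *m b^T = be%:M by rewrite -trmx_mul lb tr_scalar_mx.
have wE : lrow l (wedge a b) = al *: b - be *: a.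
  by rewrite /lrow /wedge mulmxBr !mulmxA lta ltb !mul_scalar_mx.
pose x := (lrow l (wedge a b) *m a^T) 0 0; pose y := (lrow l (wedge a b) *m b^T) 0 0.
have xE : lrow l (wedge a b) *m a^T = x%:M by rewrite [LHS]mx11_scalar.
have yE : lrow l (wedge a b) *m b^T = y%:M by rewrite [LHS]mx11_scalar.
have NE : nsq (lrow l (wedge a b)) = al * y - be * x.
  have wT : (lrow l (wedge a b))^T = al *: b^T - be *: a^T.
    by rewrite wE [LHS]linearB/= !linearZ.
  rewrite /nsq wT mulmxBr -!scalemxAr xE yE.
  by rewrite !mxE eqxx !mulr1n.
have vE : lvec l (wedge a b) = (al * y - be * x)^-1 *: (y *: a - x *: b).
  rewrite /lvec NE [X in _ *: (_ *m X)]/wedge mulmxBr !mulmxA xE yE !mul_scalar_mx.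
  by rewrite scaleNr -scalerN opprB.
rewrite NE in N0; split.
- rewrite vE -scalemxAl mulmxBl -!scalemxAl la lb.
  by apply/matrixP => i j; rewrite (ord1 i) (ord1 j) !mxE eqxx !mulr1n; field.
- rewrite vE wE; move: N0; move: al be x y {la lb lta ltb wE xE yE NE vE} => al be x y N0.
  apply/matrixP => i j; rewrite !wedgeE !mxE; field.
  by [].
- by rewrite wE mulmxBl -!scalemxAl la lb !scale_scalar_mx mulrC subrr.
Qed.

Lemma wedge_mulr a b (l : 'cV[R]_n) :
  wedge a b *m l = (b *m l) 0 0 *: a^T - (a *m l) 0 0 *: b^T.
Proof.
rewrite /wedge mulmxBl -!mulmxA.
by rewrite [b *m l]mx11_scalar [a *m l]mx11_scalar !mul_mx_scalar !mxE !eqxx !mulr1n.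
Qed.

(** Here D = 0, and T enters only through its contraction with l. *)
Lemma Phi_flat (T : 'M[R]_n) e (l : 'cV[R]_n) : e *m l = 1%:M ->
  Phi T e (- l^T) = (T *m l) *m e + e^T *m (l^T *m T).
Proof.
move=> el; have gT : (- l^T)^T = - l by rewrite [LHS]linearN/= trmxK.
rewrite /Phi gT mulmxN el !mxE eqxx subrr scale0r sub0r.
by rewrite mulNmx mulmxN opprK mulmxN mulNmx opprK !mulmxA.
Qed.

(** The bracket of e wedge om with itself is a multiple of [e, om] wedge e wedge om, and [e, om] = 0
    because e is constant and om is constant along e. *)
Lemma sch_cylinder U (e : 'rV[R]_n) (om : 'rV[R]_n -> 'rV[R]_n) x i j k :
  open U -> smooth_on U om -> U x ->
  (forall (t : R) y, om (t *: e + y) = om y) ->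
  sch (fun y => wedge e (om y)) x i j k = 0.
Proof.
move=> oU oms Ux inv.
have dz a : \sum_l e 0 l * partial l (fun y => om y 0 a) x = 0.
  rewrite -derive_dir; last exact: (sm_diff oU (oms 0 a)).
  by apply: is_derive_quot => h; rewrite inv subrr mulr0.
have dw a b l : partial l (fun y => wedge e (om y) a b) x =
    e 0 a * partial l (fun y => om y 0 b) x - e 0 b * partial l (fun y => om y 0 a) x.
  have cs c (q : set 'rV[R]_n) : sm q (fun=> c : R) by move=> k'; exact: Ck_cst.
  have -> : (fun y => wedge e (om y) a b) =
     (fun y => e 0 a * om y 0 b + (- e 0 b) * om y 0 a).
    by apply/funext => y; rewrite wedgeE mulNr mulrC [in X in _ - X]mulrC mulrC.
  have s1 : sm U (fun y => e 0 a * om y 0 b).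
    by move=> q; apply: (CkM oU (Ck_cst q U _) (oms 0 b q)).
  have s2 : sm U (fun y => (- e 0 b) * om y 0 a).
    by move=> q; apply: (CkM oU (Ck_cst q U _) (oms 0 a q)).
  rewrite (partialD l s1 s2 Ux) (partialM l (cs _ _) (oms 0 b : sm U _) Ux).
  rewrite (partialM l (cs _ _) (oms 0 a : sm U _) Ux) !partial_cst !mulr0 !addr0.
  by rewrite mulNr.
pose W a := \sum_l om x 0 l * partial l (fun y => om y 0 a) x.
have S0 a b c : sch0 (fun y => wedge e (om y)) x a b c = e 0 a * (e 0 b * W c - e 0 c * W b).
  rewrite /sch0.
  transitivity (e 0 a * (e 0 b * W c - e 0 c * W b) - om x 0 a *
    (e 0 b * (\sum_l e 0 l * partial l (fun y => om y 0 c) x)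
     - e 0 c * (\sum_l e 0 l * partial l (fun y => om y 0 b) x))); last first.
    by rewrite !dz !mulr0 subrr mulr0 subr0.
  rewrite /W !mulr_sumr -!sumrB !mulr_sumr -sumrB; apply: eq_bigr => l _.
  by rewrite dw wedgeE; ring.
by rewrite /sch !S0; ring.
Qed.

(* Here f collapses U into the hyperplane l = c0, and Psi is the wedge of the
   direction of collapse with a field that is constant along it. *)
Lemma sch_Psi_flat U V v p h (l : 'cV[R]_n) (c0 : R) x : open U -> open V -> smooth_on U v -> smooth_on V p ->
  (forall z, V z -> dec (p z)) -> sm U h -> (forall y, U y -> V (y + h y *: v y)) ->
  (forall y, U y -> Amat v (h y) y \in unitmx) -> U x ->
  (forall y, U y -> v y *m l = 1%:M) -> (forall y, U y -> h y = c0 - (y *m l) 0 0) ->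
  forall i j k, sch (fun y => Psi p v (h y) (grad h y) y) x i j k = 0.
Proof.
move=> oU oV vs ps pd hs UV Au Ux vl hl i j k.
have gl y : U y -> grad h y = - l^T.
  move=> Uy; apply/rowP => m; rewrite [LHS]mxE (partial_eq m oU Uy hl).
  have -> : (fun y : 'rV[R]_n => c0 - (y *m l) 0 0) = (fun y : 'rV[R]_n => c0 + \sum_m (y 0 m - 0) * - l m 0).
    apply/funext => z; congr (_ + _); rewrite mxE -sumrN; apply: eq_bigr => a _.
    by rewrite subr0 mulrN.
  have cs (q : set 'rV[R]_n) : sm q (fun=> c0 : R) by move=> k'; exact: Ck_cst.
  have ls : sm U (fun y : 'rV[R]_n => \sum_m (y 0 m - 0) * - l m 0).
    move=> q; apply: Ck_sum => // a _; apply: CkM => //; last exact: Ck_cst.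
    by apply: CkB => //; [exact: Ck_coord|exact: Ck_cst].
  rewrite (partialD m (cs U) ls Uy) partial_cst add0r.
  by rewrite (partial_affine (fun=> 0) (fun m => - l m 0)) [RHS]mxE mxE.
(* As v l = 1 is constant, the derivative of v is killed by l; hence A and its inverse fix l. *)
have jl y : U y -> jacm v y *m l = 0.
  move=> Uy; apply/matrixP => a b; rewrite (ord1 b) mxE [RHS]mxE.
  have E : forall z, U z -> \sum_c v z 0 c * l c 0 = 1.
    by move=> z Uz; have := congr1 (fun M : 'M[R]_1 => M 0 0) (vl _ Uz); rewrite mxE => ->; rewrite mxE eqxx.
  have : partial a (fun z => \sum_c v z 0 c * l c 0) y = 0.
    by rewrite (partial_eq a oU Uy E) partial_cst.
  have dv c : derivable (fun z => v z 0 c) y (delta_mx 0 a).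
    exact: (sm_derivable (vs 0 c : sm U _) Uy).
  rewrite (partial_sum_lin (fun c => l c 0) dv) => E0.
  by rewrite -[RHS]E0; apply: eq_bigr => c _; rewrite mxE.
have Al y : U y -> invmx (Amat v (h y) y) *m l = l.
  move=> Uy; have : Amat v (h y) y *m l = l.
    by rewrite /Amat mulmxDl mul1mx -scalemxAl jl// scaler0 addr0.
  by move=> E; rewrite -[in LHS]E mulKmx// Au.
(* By [Phi_flat] the pull sees only the contraction of p with l, at points of the hyperplane. So p
   may be replaced by e wedge om with the constant vector e = v(x) and with om extended off the
   hyperplane by projection along e. That field is Poisson by [sch_cylinder]. *)
pose e := v x.
have el : e *m l = 1%:M by exact: vl.
pose proj (z : 'rV[R]_n) := z - ((z *m l) 0 0 - c0) *: e.
pose om z := lrow l (p (proj z)).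
pose V' := proj @^-1` V.
have lins : forall W : set 'rV[R]_n, open W -> sm W (fun z : 'rV[R]_n => (z *m l) 0 0).
  move=> W oW; apply: (smooth_onM oW _ (smooth_on_cst W l) 0 0); exact: smooth_on_id.
have projs W : open W -> smooth_on W proj.
  move=> oW; apply: smooth_onB => //; first exact: smooth_on_id.
  apply: smooth_onZ => //; last exact: smooth_on_cst.
  by move=> q; apply: CkB => //; [exact: lins|exact: Ck_cst].
have oV' : open V'.
  have := @open_preim _ _ setT proj V openT _ oV.
  by rewrite setTI; apply => z _; exact: (smooth_on_continuous (projs _ openT)).
have oms : smooth_on V' om.
  apply: smooth_onM => //; first exact: smooth_on_cst.
  exact: (smooth_on_comp oV' oV (projs _ oV') ps).
have projinv (t : R) z : proj (t *: e + z) = proj z.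
  have E : ((t *: e + z) *m l) 0 0 = t + (z *m l) 0 0.
    by rewrite mulmxDl -scalemxAl el !mxE eqxx mulr1.
  rewrite /proj E; move: ((z *m l) 0 0) => s.
  by apply/rowP => a; rewrite !mxE; ring.
pose ph z := wedge e (om z).
have fproj y : U y -> proj (y + h y *: v y) = y + h y *: v y.
  move=> Uy; have E : ((y + h y *: v y) *m l) 0 0 = c0.
    by rewrite mulmxDl -scalemxAl vl// hl// !mxE eqxx mulr1 addrC subrK.
  by rewrite /proj E subrr scale0r subr0.
have UV' y : U y -> V' (y + h y *: v y) by move=> Uy; rewrite /V'/= fproj//; exact: UV.
have pll z : V z -> lrow l (p z) *m l = 0.
  move=> Vz; have := anti_quad l^T (dec_anti (pd _ Vz)).
  by rewrite trmxK.
have phl y : U y -> ph (y + h y *: v y) *m l = p (y + h y *: v y) *m l.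
  move=> Uy; have pa := dec_anti (pd _ (UV _ Uy)).
  have e1 : (e *m l) 0 0 = 1 by rewrite el mxE eqxx.
  have omE : om (y + h y *: v y) = lrow l (p (y + h y *: v y)) by rewrite /om fproj.
  have w0 : (om (y + h y *: v y) *m l) 0 0 = 0 by rewrite omE pll; [rewrite mxE|exact: UV].
  rewrite /ph wedge_mulr e1 w0 scale0r scale1r sub0r omE.
  by rewrite /lrow trmx_mul trmxK pa mulNmx opprK.
have lph y : U y -> l^T *m ph (y + h y *: v y) = l^T *m p (y + h y *: v y).
  move=> Uy; have pa := dec_anti (pd _ (UV _ Uy)).
  have pha : (ph (y + h y *: v y))^T = - ph (y + h y *: v y) by exact: wedge_anti.
  apply: trmx_inj; rewrite !trmx_mul !trmxK pa pha !mulNmx; congr (- _); exact: phl.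
have PE y : U y -> Psi p v (h y) (grad h y) y = Psi ph v (h y) (grad h y) y.
  move=> Uy; rewrite /Psi gl//.
  have el' : v y *m invmx (Amat v (h y) y) *m l = 1%:M by rewrite -mulmxA Al// vl.
  rewrite !(Phi_flat _ el').
  have lA : l^T *m (invmx (Amat v (h y) y))^T = l^T by rewrite -trmx_mul Al.
  have Tl (q : 'M[R]_n) : (invmx (Amat v (h y) y))^T *m q *m invmx (Amat v (h y) y) *m l =
     (invmx (Amat v (h y) y))^T *m (q *m l) by rewrite -mulmxA Al// mulmxA.
  have lT (q : 'M[R]_n) : l^T *m ((invmx (Amat v (h y) y))^T *m q *m invmx (Amat v (h y) y)) =
     (l^T *m q) *m invmx (Amat v (h y) y) by rewrite !mulmxA lA.
  by rewrite !Tl !lT phl// lph.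
rewrite (sch_eq i j k oU Ux PE).
apply: (sch_Psi oU oV' vs _ _ hs UV' Au Ux).
- apply: smooth_onB => //; apply: smooth_onM => //; try exact: smooth_on_cst.
  exact: smooth_on_tr.
- by move=> z _; exists e, (om z).
move=> a b c; apply: (sch_cylinder a b c oV' oms (UV' _ Ux)) => t z.
by rewrite /om projinv.
Qed.

End Transverse.

Lemma cont_fst (A B : topologicalType) : continuous (@fst A B).
Proof. by move=> x; exact: cvg_fst. Qed.

Lemma cont_snd (A B : topologicalType) : continuous (@snd A B).
Proof. by move=> x; exact: cvg_snd. Qed.

(** * Continuity of the pulled field *)

Section MatrixContinuity.
Variables (R : realType) (Y : topologicalType) (y0 : Y).

Lemma entry_continuous m p (F : Y -> 'M[R]_(m, p)) i j :
  {for y0, continuous F} -> {for y0, continuous (fun y => F y i j : R)}.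
Proof.
move=> Fc; apply: (@continuous_comp _ _ _ F (fun M : 'M[R]_(m, p) => M i j : R) y0 Fc).
exact: coord_continuous.
Qed.

Lemma mulmx_continuous m p q (F : Y -> 'M[R]_(m, p)) (G : Y -> 'M[R]_(p, q)) :
  {for y0, continuous F} -> {for y0, continuous G} ->
  {for y0, continuous (fun y => F y *m G y)}.
Proof.
move=> Fc Gc; apply: mx_continuous => i j.
have -> : (fun y => (F y *m G y) i j) = (fun y => \sum_k F y i k * G y k j).
  by apply/funext => y; rewrite mxE.
rewrite /prop_for /continuous_at.
apply: (@cvg_sumr R _ _ (nbhs y0)) => k _.
by apply: cvgM; exact: entry_continuous.
Qed.

Lemma trmx_continuous m p (F : Y -> 'M[R]_(m, p)) :
  {for y0, continuous F} -> {for y0, continuous (fun y => (F y)^T)}.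
Proof.
move=> Fc; apply: mx_continuous => i j.
have -> : (fun y => (F y)^T i j) = (fun y => F y j i) by apply/funext => y; rewrite mxE.
exact: entry_continuous.
Qed.

Lemma prodr_continuous (I : Type) (r : seq I) (f : I -> Y -> R) :
  (forall i, {for y0, continuous (f i)}) -> {for y0, continuous (fun y => \prod_(i <- r) f i y)}.
Proof.
move=> fc; elim: r => [|i r IH].
  have -> : (fun y => \prod_(i <- [::]) f i y) = (fun=> 1) by apply/funext => y; rewrite big_nil.
  exact: cst_continuous.
have -> : (fun y => \prod_(j <- i :: r) f j y) = (fun y => f i y * \prod_(j <- r) f j y).
  by apply/funext => y; rewrite big_cons.
exact: continuousM.
Qed.

Lemma sumr_continuous (I : Type) (r : seq I) (f : I -> Y -> R) :
  (forall i, {for y0, continuous (f i)}) -> {for y0, continuous (fun y => \sum_(i <- r) f i y)}.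
Proof. by move=> fc; apply: (@cvg_sumr R _ _ (nbhs y0)) => i _; exact: fc. Qed.

Lemma det_continuous m (F : Y -> 'M[R]_m) :
  {for y0, continuous F} -> {for y0, continuous (fun y => \det (F y))}.
Proof.
move=> Fc; rewrite /determinant; apply: sumr_continuous => s.
apply: continuousM; first exact: cst_continuous.
by apply: (prodr_continuous _ (f := fun i y => F y i _)) => i; exact: entry_continuous.
Qed.

Lemma near_unitmx m (F : Y -> 'M[R]_m) : {for y0, continuous F} -> F y0 \in unitmx ->
  \forall y \near y0, F y \in unitmx.
Proof.
move=> Fc; rewrite unitmxE unitfE => u.
have Hn : nbhs (\det (F y0)) [set s : R | s != 0].
  by apply: open_nbhs_nbhs; split => //; exact: open_neq0.
have : nbhs y0 (fun y => \det (F y) != 0) by exact: (det_continuous Fc Hn).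
by apply: filterS => y; rewrite unitmxE unitfE.
Qed.

Lemma invmx_continuous m (F : Y -> 'M[R]_m) : {for y0, continuous F} -> F y0 \in unitmx ->
  {for y0, continuous (fun y => invmx (F y))}.
Proof.
move=> Fc Fu.
apply: (@near_eq_continuous _ _ (fun y => (\det (F y))^-1 *: \adj (F y))).
  by apply: filterS (near_unitmx Fc Fu) => y uy; rewrite /invmx uy.
apply: mx_continuous => i j.
have -> : (fun y => ((\det (F y))^-1 *: \adj (F y)) i j) =
    (fun y => (\det (F y))^-1 * ((-1) ^+ (j + i) * \det (row' j (col' i (F y))))).
  by apply/funext => y; rewrite !mxE.
apply: continuousM.
  apply: continuousV; last exact: det_continuous.
  by move: Fu; rewrite unitmxE unitfE.
apply: continuousM; first exact: cst_continuous.
apply: det_continuous; apply: mx_continuous => a b.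
have -> : (fun y => row' j (col' i (F y)) a b) = (fun y => F y (lift j a) (lift i b)).
  by apply/funext => y; rewrite !mxE.
exact: entry_continuous.
Qed.

Lemma scalemx_continuous m p (f : Y -> R) (F : Y -> 'M[R]_(m, p)) :
  {for y0, continuous f} -> {for y0, continuous F} ->
  {for y0, continuous (fun y => f y *: F y)}.
Proof.
move=> fc Fc; apply: mx_continuous => i j.
have -> : (fun y => (f y *: F y) i j) = (fun y => f y * F y i j).
  by apply/funext => y; rewrite mxE.
by apply: continuousM => //; exact: entry_continuous.
Qed.

Lemma addmx_continuous m p (F G : Y -> 'M[R]_(m, p)) :
  {for y0, continuous F} -> {for y0, continuous G} ->
  {for y0, continuous (fun y => F y + G y)}.
Proof.
move=> Fc Gc; apply: mx_continuous => i j.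
have -> : (fun y => (F y + G y) i j) = (fun y => F y i j + G y i j).
  by apply/funext => y; rewrite mxE.
by apply: continuousD; exact: entry_continuous.
Qed.

Lemma submx_continuous m p (F G : Y -> 'M[R]_(m, p)) :
  {for y0, continuous F} -> {for y0, continuous G} ->
  {for y0, continuous (fun y => F y - G y)}.
Proof.
move=> Fc Gc; have -> : (fun y => F y - G y) = (fun y => F y + (-1) *: G y).
  by apply/funext => y; rewrite scaleN1r.
apply: (addmx_continuous Fc); apply: (scalemx_continuous _ Gc); exact: cst_continuous.
Qed.

Lemma Phi_continuous n (T : Y -> 'M[R]_n) (e g : Y -> 'rV[R]_n) :
  {for y0, continuous T} -> {for y0, continuous e} -> {for y0, continuous g} ->
  {for y0, continuous (fun y => Phi (T y) (e y) (g y))}.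
Proof.
move=> Tc ec gc.
have gt := trmx_continuous gc; have et := trmx_continuous ec.
have A1 := entry_continuous (i := 0) (j := 0) (mulmx_continuous ec gt).
apply: submx_continuous; [apply: submx_continuous|].
- by apply: (scalemx_continuous _ Tc); apply: (continuousD _ A1); exact: cst_continuous.
- exact: (mulmx_continuous Tc (mulmx_continuous gt ec)).
- exact: (mulmx_continuous (mulmx_continuous et gc) Tc).
Qed.

Section Psi_continuity.
Variables (n : nat) (U V : set 'rV[R]_n) (p : 'rV[R]_n -> 'M[R]_n) (v : 'rV[R]_n -> 'rV[R]_n).
Variables (X : Y -> 'rV[R]_n) (h : Y -> R).
Hypotheses (oU : open U) (vs : smooth_on U v).
Hypotheses (Xc : {for y0, continuous X}) (hc : {for y0, continuous h}) (UX : U (X y0)).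

Lemma Amat_continuous : {for y0, continuous (fun y => Amat v (h y) (X y))}.
Proof.
apply: addmx_continuous; first exact: cst_continuous.
apply: (scalemx_continuous hc).
apply: (continuous_comp Xc); exact: (smooth_on_continuous (smooth_on_jacm oU vs)).
Qed.

Lemma shift_continuous : {for y0, continuous (fun y => X y + h y *: v (X y))}.
Proof.
apply: (addmx_continuous Xc); apply: (scalemx_continuous hc).
by apply: (continuous_comp Xc); exact: (smooth_on_continuous vs).
Qed.

(** The parameter space is arbitrary because the time of a homotopy enters through [clamp], which is
    continuous but not smooth. *)
Lemma Psi_continuous (g : Y -> 'rV[R]_n) : open V -> smooth_on V p -> {for y0, continuous g} ->
  V (X y0 + h y0 *: v (X y0)) -> Amat v (h y0) (X y0) \in unitmx ->
  {for y0, continuous (fun y => Psi p v (h y) (g y) (X y))}.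
Proof.
move=> oV ps gc VX Au.
have iA := invmx_continuous Amat_continuous Au.
apply: (Phi_continuous _ _ gc).
  apply: (mulmx_continuous _ iA); apply: (mulmx_continuous (trmx_continuous iA)).
  by apply: (continuous_comp shift_continuous); exact: (smooth_on_continuous ps).
apply: (mulmx_continuous _ iA).
by apply: (continuous_comp Xc); exact: (smooth_on_continuous vs).
Qed.

End Psi_continuity.

End MatrixContinuity.

(** * The profile of a collapse *)

Section Sigma.
Variable R : realType.

(** Displacement as a function of the rescaled signed distance t to the hyperplane: - t near it,
    nothing far from it. *)
Definition sig (t : R) : R := - t * plateau t.
(** A copy on R^1, since [partial] acts on functions of row vectors. *)
Definition sig1 (y : 'rV[R]_1) : R := sig (y 0 0).
Definition dsig (t : R) : R := partial 0 sig1 (const_mx t).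

Lemma sig_mid t : `|t| <= 1 -> sig t = - t.
Proof. by move=> h; rewrite /sig plateau1// mulr1. Qed.

Lemma sig_out t : 2 <= `|t| -> sig t = 0.
Proof. by move=> h; rewrite /sig plateau0// mulr0. Qed.

Lemma sm_sig1 : sm setT sig1.
Proof.
have c1 : sm setT (fun y : 'rV[R]_1 => y 0 0) by exact: Ck_coord_sm.
move=> k; apply: CkM; [exact: openT|apply: CkN; [exact: openT|exact: c1]|].
exact: (sm_plateau openT c1).
Qed.

Lemma const_mx_continuous : continuous (fun t : R => const_mx t : 'rV[R]_1).
Proof.
move=> t; apply: mx_continuous => i j.
have -> : (fun s : R => (const_mx s : 'rV[R]_1) i j) = id by apply/funext => s; rewrite mxE.
exact: cvg_id.
Qed.

Lemma sig_continuous : continuous sig.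
Proof.
move=> t.
have -> : sig = (fun s => sig1 (const_mx s)) by apply/funext => s; rewrite /sig1 mxE.
apply: continuous_comp; first exact: const_mx_continuous.
exact: (sm_continuous sm_sig1).
Qed.

Lemma dsig_continuous : continuous dsig.
Proof.
move=> t; apply: continuous_comp; first exact: const_mx_continuous.
exact: (sm_continuous (sm_partial 0 sm_sig1)).
Qed.

Lemma dsig_out t : 2 < `|t| -> dsig t = 0.
Proof.
move=> h; pose W := setT `&` (fun y : 'rV[R]_1 => `|y 0 0|) @^-1` [set s | 2 < s].
have oW : open W.
  apply: (open_preim openT); last exact: open_gt.
  move=> y _; apply: continuous_comp; first exact: coord_continuous.
  exact: norm_continuous.
rewrite /dsig (partial_eq (U := W) 0 oW (g := fun=> 0)); first exact: partial_cst.
  by split; rewrite //= mxE.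
by move=> y [_ /= /ltW hy]; rewrite /sig1 sig_out.
Qed.

End Sigma.

(** * Thin collapses are C^0 small *)

Section FaceLocal.
Variables (R : realType) (n : nat).
Variables (O : set 'rV[R]_n) (p : 'rV[R]_n -> 'M[R]_n) (l : 'cV[R]_n) (c0 : R).
Variable chi : 'rV[R]_n -> R.
Hypotheses (oO : open O) (ps : smooth_on O p) (pd : forall x, O x -> dec (p x)).
Hypothesis chis : sm setT chi.

(** Transversality of p to the hyperplanes of l, which [lvec] needs; the squared norm makes it
    visibly an open condition. *)
Definition Og := O `&` (fun x => nsq (lrow l (p x))) @^-1` [set s | s != 0].

Lemma sm_nsq : sm O (fun x => nsq (lrow l (p x))).
Proof.
have ls : smooth_on O (fun x => lrow l (p x)) by apply: smooth_onM => //; exact: smooth_on_cst.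
exact: (smooth_onM oO ls (smooth_on_tr oO ls) 0 0).
Qed.

Lemma open_Og : open Og.
Proof.
apply: (open_preim oO); last exact: open_neq0.
by move=> x Ox; exact: (sm_continuous sm_nsq).
Qed.

Lemma OgO : Og `<=` O. Proof. by move=> x []. Qed.

Lemma OgP x : Og x <-> O x /\ lrow l (p x) != 0.
Proof.
split=> -[Ox h]; split => //; last exact: nsq_neq0.
by apply: contraNneq h => ->; rewrite /nsq mul0mx mxE.
Qed.

Definition face_field x := lvec l (p x).

Lemma smooth_face_field : smooth_on Og face_field.
Proof.
have ls : smooth_on Og (fun x => lrow l (p x)).
  apply: smooth_onM; [exact: open_Og|exact: smooth_on_cst|exact: (smooth_on_subset OgO)].
apply: smooth_onZ; first exact: open_Og.
  move=> k; apply: CkN; first exact: open_Og.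
  apply: CkV; first exact: open_Og.
    by move=> x [].
  exact: (Ck_subset OgO (sm_nsq k)).
by apply: smooth_onM => //; [exact: open_Og|exact: (smooth_on_subset OgO)].
Qed.

Definition face_coord (x : 'rV[R]_n) : R := (x *m l) 0 0 - c0.

(** Where chi = 1 and the face coordinate u satisfies |u| <= e, the height is - u. Since l takes the
    value 1 on [face_field], such a point lands exactly on the hyperplane. *)
Definition face_height (e : R) x := chi x * (e * sig (face_coord x / e)).

Lemma sm_face_coord W : open W -> sm W face_coord.
Proof.
move=> oW k; apply: CkB => //; last exact: Ck_cst.
exact: (smooth_onM oW (@smooth_on_id _ _ W) (smooth_on_cst W l) 0 0).
Qed.

Definition fF e (x : 'rV[R]_n) : 'rV[R]_1 := e^-1 *: (x *m l - const_mx c0).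

Lemma smooth_fF e W : open W -> smooth_on W (fF e).
Proof.
move=> oW; apply: smooth_onZ => //; first by move=> k; exact: Ck_cst.
apply: smooth_onB => //; last exact: smooth_on_cst.
by apply: smooth_onM => //; [exact: smooth_on_id|exact: smooth_on_cst].
Qed.

Lemma fF_E e x : fF e x = const_mx (face_coord x / e).
Proof. by apply/rowP => i; rewrite (ord1 i) /fF /face_coord !mxE mulrC. Qed.

Lemma sm_fsig e : sm setT (fun x => sig (face_coord x / e)).
Proof.
have -> : (fun x => sig (face_coord x / e)) = (fun x => sig1 (fF e x)).
  by apply/funext => x; rewrite fF_E /sig1 mxE.
exact: (sm_comp openT openT (smooth_fF e openT) (@sm_sig1 R)).
Qed.

Lemma sm_face_height e : sm setT (face_height e).
Proof.
move=> k; apply: CkM; [exact: openT|exact: chis|].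
by apply: CkM; [exact: openT|exact: Ck_cst|exact: sm_fsig].
Qed.

Lemma partial_face_coord i x : partial i face_coord x = l i 0.
Proof.
have -> : face_coord = (fun y : 'rV[R]_n => \sum_m (y 0 m - 0) * l m 0 + (- c0)).
  by apply/funext => y; rewrite /face_coord mxE; congr (_ - _); apply: eq_bigr => m _; rewrite subr0.
rewrite (partialD (U := setT)) ?partial_cst ?addr0 ?(partial_affine (fun=> 0) (fun m => l m 0))//.
  move=> k; apply: Ck_sum; first exact: openT.
  move=> m _; apply: CkM; [exact: openT| |exact: Ck_cst].
  by apply: CkB; [exact: openT|exact: Ck_coord|exact: Ck_cst].
by move=> k; exact: Ck_cst.
Qed.

Lemma grad_face_height e x : e != 0 ->
  grad (face_height e) x = (e * sig (face_coord x / e)) *: grad chi x + (chi x * dsig (face_coord x / e)) *: l^T.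
Proof.
move=> e0; apply/rowP => i.
have cse c : sm [set: 'rV[R]_n] (fun=> c : R) by move=> k; exact: Ck_cst.
have s2 : sm setT (fun x => e * sig (face_coord x / e)).
  by move=> k; apply: CkM; [exact: openT|exact: Ck_cst|exact: sm_fsig].
rewrite [LHS]mxE (partialM i chis s2 I) (partialM i (cse e) (@sm_fsig e) I).
rewrite partial_cst mulr0 addr0.
have -> : partial i (fun x => sig (face_coord x / e)) x = e^-1 * l i 0 * dsig (face_coord x / e).
  have -> : (fun x => sig (face_coord x / e)) = (fun x => sig1 (fF e x)).
    by apply/funext => y; rewrite fF_E /sig1 mxE.
  rewrite (partial_chain i openT openT (smooth_fF e openT) (@sm_sig1 R) I I).
  rewrite big_ord1 fF_E; congr (_ * _).
  rewrite mxE.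
  have -> : (fun y => fF e y 0 0) = (fun y => e^-1 * face_coord y).
    by apply/funext => y; rewrite fF_E mxE mulrC.
  rewrite (partialM i (cse e^-1) (sm_face_coord openT) I) partial_cst mulr0 addr0.
  by rewrite partial_face_coord.
rewrite [RHS]mxE [X in _ = X + _]mxE [X in _ = _ + X]mxE [grad chi x 0 i]mxE [l^T 0 i]mxE.
by field.
Qed.

(* Parametrizing by t = u / e on a compact interval makes the limit e -> 0 a
   matter of continuity. *)
Definition fQh e s t x : R := s * (chi x * (e * sig t)).
Definition fQg e s t x : 'rV[R]_n := s *: ((e * sig t) *: grad chi x + (chi x * dsig t) *: l^T).

(** The value t = 3 stands for all far points, where [sig] and [dsig] vanish as they do at 3. The
    bound is larger than 2 because [dsig_out] is strict. *)
Lemma face_height_param e x : e != 0 -> exists t, [/\ -3 <= t <= 3, (forall s, s * face_height e x = fQh e s t x) &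
  (forall s, s *: grad (face_height e) x = fQg e s t x)].
Proof.
move=> e0; rewrite grad_face_height// /face_height /fQh /fQg.
have [h|h] := leP `|face_coord x / e| 3.
  by exists (face_coord x / e); split => //; rewrite -ler_norml.
have h2 : 2 < `|face_coord x / e| by apply: lt_trans h; lra.
have n3 : `|3 : R| = 3 by rewrite ger0_norm.
exists 3; split; first by lra.
  by move=> s; rewrite (sig_out (ltW h2)) sig_out// n3; lra.
move=> s; rewrite (sig_out (ltW h2)) dsig_out// sig_out ?dsig_out// n3; lra.
Qed.

(** With p = v wedge w and l(v) = 1, the two terms linear in p and g add up to - m p and cancel the
    m of D = 1 + m. A gradient along l, however large, leaves the field unchanged. *)
Lemma Phi_lvec (x : 'rV[R]_n) (m : R) : Og x -> Phi (p x) (face_field x) (m *: l^T) = p x.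
Proof.
move=> /OgP[Ox w0]; have [vl pw wl] := lvecP (pd Ox) w0.
rewrite -/(face_field x) in vl pw.
have pl : p x *m l = - (lrow l (p x))^T.
  by rewrite /lrow trmx_mul trmxK (dec_anti (pd Ox)) mulNmx opprK.
have gT : (m *: l^T)^T = m *: l by rewrite [LHS]linearZ/= trmxK.
have E1 : p x *m (m *: l *m face_field x) = - (m *: ((lrow l (p x))^T *m face_field x)).
  by rewrite -scalemxAl -scalemxAr mulmxA pl mulNmx scalerN.
have E2 : ((face_field x)^T *m (m *: l^T)) *m p x = m *: ((face_field x)^T *m lrow l (p x)).
  by rewrite -scalemxAr -scalemxAl -mulmxA.
have E3 : (face_field x *m (m *: l)) 0 0 = m by rewrite -scalemxAr vl !mxE eqxx mulr1.
rewrite /Phi gT E1 E2 E3 opprK scalerDl scale1r [X in m *: X]pw /wedge.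
move: (_ *m lrow l (p x)) (_ *m face_field x) => a b.
by apply/matrixP => i j; rewrite !mxE; ring.
Qed.

(** At e = 0 the height is 0 and the gradient is a multiple of l^T, so the pulled field is p by
    [Phi_lvec]. Continuity at e = 0 and compactness of the rectangle of all (s, t) give closeness
    uniformly in s and t. *)
Lemma face_close x1 (W : set 'M[R]_n) (N : set 'rV[R]_n) : Og x1 -> nbhs (p x1) W -> nbhs x1 N ->
  \forall z \near (x1, 0 : R), forall s t, 0 <= s <= 1 -> -3 <= t <= 3 ->
   [/\ W (Psi p face_field (fQh z.2 s t z.1) (fQg z.2 s t z.1) z.1),
       N (z.1 + fQh z.2 s t z.1 *: face_field z.1) &
       Amat face_field (fQh z.2 s t z.1) z.1 \in unitmx].
Proof.
move=> Ogx Wp Nx.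
pose K := [set st : R * R | (0 <= st.1 <= 1) /\ (-3 <= st.2 <= 3)].
have cK : compact K.
  have -> : K = `[0, 1]%classic `*` `[-3, 3]%classic.
    by apply/seteqP; split => -[s t] /=; rewrite !in_itv.
  by apply: compact_setX; exact: segment_compact.
pose P (z : 'rV[R]_n * R) (st : R * R) :=
   [/\ W (Psi p face_field (fQh z.2 st.1 st.2 z.1) (fQg z.2 st.1 st.2 z.1) z.1),
       N (z.1 + fQh z.2 st.1 st.2 z.1 *: face_field z.1) &
       Amat face_field (fQh z.2 st.1 st.2 z.1) z.1 \in unitmx].
have /compact_near_coveringP/(_ _ (nbhs (x1, 0 : R)) P _) := cK.
suff H : forall st, K st -> \forall st' \near st & z \near (x1, 0 : R), P z st'.
  move=> /(_ H); apply: filterS => z Hz s t hs ht.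
  by apply: (Hz (s, t)).
move=> [s0 t0] _.
pose Y := ((R * R) * ('rV[R]_n * R))%type.
pose y0 : Y := ((s0, t0), (x1, 0)).
pose cs (y : Y) := y.1.1; pose ct (y : Y) := y.1.2; pose cx (y : Y) := y.2.1; pose ce (y : Y) := y.2.2.
have csc : {for y0, continuous cs}.
  by apply: continuous_comp; [exact: cont_fst|exact: cont_fst].
have ctc : {for y0, continuous ct}.
  by apply: continuous_comp; [exact: cont_fst|exact: cont_snd].
have cxc : {for y0, continuous cx}.
  by apply: continuous_comp; [exact: cont_snd|exact: cont_fst].
have cec : {for y0, continuous ce}.
  by apply: continuous_comp; [exact: cont_snd|exact: cont_snd].
have sigc : {for y0, continuous (fun y => sig (ct y))}.
  by apply: (continuous_comp ctc); exact: sig_continuous.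
have dsigc : {for y0, continuous (fun y => dsig (ct y))}.
  by apply: (continuous_comp ctc); exact: dsig_continuous.
have chic : {for y0, continuous (fun y => chi (cx y))}.
  by apply: (continuous_comp cxc); exact: (sm_continuous chis).
have gchic : {for y0, continuous (fun y => grad chi (cx y))}.
  by apply: (continuous_comp cxc); exact: (smooth_on_continuous (smooth_on_grad openT chis)).
have esig : {for y0, continuous (fun y => ce y * sig (ct y))} by exact: continuousM.
have hc : {for y0, continuous (fun y => fQh (ce y) (cs y) (ct y) (cx y))}.
  exact: (continuousM csc (continuousM chic esig)).
have gc : {for y0, continuous (fun y => fQg (ce y) (cs y) (ct y) (cx y))}.
  apply: (scalemx_continuous csc); apply: (addmx_continuous (scalemx_continuous esig gchic)).
  apply: (scalemx_continuous (continuousM chic dsigc)); exact: cst_continuous.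
have h0 : fQh (ce y0) (cs y0) (ct y0) (cx y0) = 0.
  by rewrite /fQh /ce/= mul0r !mulr0.
have g0 : fQg (ce y0) (cs y0) (ct y0) (cx y0) = (s0 * (chi x1 * dsig t0)) *: l^T.
  by rewrite /fQg /ce /cs /ct /cx/= mul0r scale0r add0r scalerA.
have A1 : Amat face_field 0 x1 = 1%:M by rewrite /Amat scale0r addr0.
have Psi_c : {for y0, continuous (fun y => Psi p face_field (fQh (ce y) (cs y) (ct y) (cx y))
     (fQg (ce y) (cs y) (ct y) (cx y)) (cx y))}.
  apply: (@Psi_continuous _ _ _ _ Og O p face_field) => //; first exact: open_Og.
  - exact: smooth_face_field.
  - by rewrite h0 scale0r addr0; exact: OgO.
  - by rewrite h0 A1 unitmx1.
have PsiE : Psi p face_field (fQh (ce y0) (cs y0) (ct y0) (cx y0))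
     (fQg (ce y0) (cs y0) (ct y0) (cx y0)) (cx y0) = p x1.
  rewrite h0 g0 /Psi A1 invmx1 trmx1 mul1mx !mulmx1 scale0r addr0.
  exact: Phi_lvec.
have shc : {for y0, continuous (fun y => cx y + fQh (ce y) (cs y) (ct y) (cx y) *: face_field (cx y))}.
  exact: (shift_continuous smooth_face_field cxc hc Ogx).
have Ac : {for y0, continuous (fun y => Amat face_field (fQh (ce y) (cs y) (ct y) (cx y)) (cx y))}.
  exact: (Amat_continuous open_Og smooth_face_field cxc hc Ogx).
have B1 : \forall y \near y0, W (Psi p face_field (fQh (ce y) (cs y) (ct y) (cx y))
     (fQg (ce y) (cs y) (ct y) (cx y)) (cx y)).
  by apply: Psi_c; rewrite PsiE.
have B2 : \forall y \near y0, N (cx y + fQh (ce y) (cs y) (ct y) (cx y) *: face_field (cx y)).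
  by apply: shc; rewrite h0 scale0r addr0.
have B3 := near_unitmx Ac.
rewrite h0 A1 unitmx1 in B3.
have B : \forall y \near y0, P (cx y, ce y) (cs y, ct y).
  near=> y; split; near: y; [exact: B1|exact: B2|exact: B3].
have [[/= A B'] [HA HB] AB] := B.
exists (A, B') => // -[st z] [/= Ast Bz].
Unshelve. all: by end_near. Qed.

End FaceLocal.

(** * Bivector fields on manifolds *)

Section ManifoldBasics.
Variables (R : realType) (n : nat) (M : manifold R n).
Local Opaque partial.
Implicit Types (c d e : chart M) (p q : M).

Definition cimg c : set 'rV[R]_n := coord c @` dom c.

Lemma coord_cimg c p : dom c p -> cimg c (coord c p).
Proof. by move=> dp; exists p. Qed.

Lemma param_dom c x : cimg c x -> dom c (param c x).
Proof. by move=> [p dp <-]; rewrite coordK. Qed.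

Lemma paramK c x : cimg c x -> coord c (param c x) = x.
Proof. by move=> [p dp <-]; rewrite coordK. Qed.

Lemma coord_cont c p : dom c p -> {for p, continuous (coord c)}.
Proof.
move=> dp; have := @Defs.coord_continuous _ _ M c.
rewrite continuous_open_subspace; last exact: dom_open.
by apply; rewrite inE.
Qed.

Lemma param_cont c x : cimg c x -> {for x, continuous (param c)}.
Proof.
move=> dx; have := @param_continuous _ _ M c.
rewrite continuous_open_subspace; last exact: coord_open.
by apply; rewrite inE.
Qed.

Lemma open_coord_image c (U : set M) : open U -> U `<=` dom c -> open (coord c @` U).
Proof.
move=> oU Uc.
have -> : coord c @` U = cimg c `&` param c @^-1` U.
  apply/seteqP; split => x.
    by move=> [p Up <-]; split; [apply: coord_cimg; exact: Uc|rewrite /= coordK//; exact: Uc].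
  by move=> [cx Ux]; exists (param c x) => //; rewrite paramK.
by apply: open_preim => //; [exact: coord_open|move=> x cx; exact: param_cont].
Qed.

Lemma open_param_image c (U : set 'rV[R]_n) : open U -> U `<=` cimg c -> open (param c @` U).
Proof.
move=> oU Uc.
have -> : param c @` U = dom c `&` coord c @^-1` U.
  apply/seteqP; split => p.
    by move=> [x Ux <-]; split; [apply: param_dom; exact: Uc|rewrite /= paramK//; exact: Uc].
  by move=> [cp Up]; exists (coord c p) => //; rewrite coordK.
by apply: open_preim => //; [exact: dom_open|move=> p cp; exact: coord_cont].
Qed.

Lemma compact_param_image c (K : set 'rV[R]_n) : compact K -> K `<=` cimg c -> compact (param c @` K).
Proof.
move=> cK Kc; apply: continuous_compact => //.
by apply: continuous_in_subspaceT => x; rewrite inE => /Kc; exact: param_cont.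
Qed.

Definition trans c d : set 'rV[R]_n := coord c @` (dom c `&` dom d).

Lemma open_trans c d : open (trans c d).
Proof.
by apply: open_coord_image; [apply: openI; exact: dom_open|move=> p []].
Qed.

Lemma trans_coord c d p : dom c p -> dom d p -> trans c d (coord c p).
Proof. by move=> cp dp; exists p. Qed.

Definition tmap c d : 'rV[R]_n -> 'rV[R]_n := coord d \o param c.

Lemma tmap_smooth c d : smooth_on (trans c d) (tmap c d).
Proof. exact: transition_smooth. Qed.

Lemma tmap_coord c d p : dom c p -> tmap c d (coord c p) = coord d p.
Proof. by move=> cp; rewrite /tmap/= coordK. Qed.

Lemma jacE c d p : dom c p -> dom d p -> jac c d p = jacm (tmap c d) (coord c p).
Proof.
move=> cp dp; rewrite /jac; apply: (jacobianE (@open_trans c d)).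
  exact: trans_coord.
exact: tmap_smooth.
Qed.

Lemma jac_id c p : dom c p -> jac c c p = 1%:M.
Proof.
move=> cp; rewrite jacE// -(jacm_id (coord c p)).
apply/matrixP => i j; rewrite mxE [RHS]mxE.
apply: (partial_eq i (@coord_open _ _ M c)); first exact: coord_cimg.
by move=> y cy; rewrite /tmap/= paramK.
Qed.

Lemma jac_comp c d e p : dom c p -> dom d p -> dom e p ->
  jac c d p *m jac d e p = jac c e p.
Proof.
move=> cp dp ep; rewrite !jacE//.
pose W := coord c @` (dom c `&` dom d `&` dom e).
have oW : open W.
  apply: open_coord_image; last by move=> q [[]].
  by apply: openI; [apply: openI|]; exact: dom_open.
have Wc : W `<=` trans c d by move=> _ [q [[cq dq] _] <-]; exists q.
have Wx : W (coord c p) by exists p.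
have TE : tmap c d (coord c p) = coord d p by exact: tmap_coord.
have H := jacm_chain oW (@open_trans d e) (smooth_on_subset Wc (@tmap_smooth c d)) (@tmap_smooth d e) Wx.
rewrite -TE -H; last by rewrite TE; exact: trans_coord.
apply/matrixP => i j; rewrite mxE [RHS]mxE.
apply: (partial_eq i oW Wx) => y [q [[cq dq] eq] <-].
by rewrite /= !tmap_coord.
Qed.

Lemma jac_inv c d p : dom c p -> dom d p -> jac c d p *m jac d c p = 1%:M.
Proof. by move=> cp dp; rewrite jac_comp// jac_id. Qed.

Lemma jac_smooth c d : smooth_on (trans c d) (fun x => jac c d (param c x)).
Proof.
apply: (@smooth_on_eq _ _ _ _ _ (jacm (tmap c d))).
- exact: open_trans.
- by move=> x [p [cp dp] <-]; rewrite coordK// jacE.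
- by apply: smooth_on_jacm; [exact: open_trans|exact: tmap_smooth].
Qed.

Lemma jac_cont c d p : dom c p -> dom d p -> {for p, continuous (jac c d)}.
Proof.
move=> cp dp.
apply: (@near_eq_continuous _ _ (fun q => jacm (tmap c d) (coord c q))).
  apply: filterS (open_nbhs_nbhs (conj (openI (dom_open c) (dom_open d)) (conj cp dp))).
  by move=> q [cq dq]; rewrite jacE.
apply: (continuous_comp (coord_cont cp)).
apply: (smooth_on_continuous (smooth_on_jacm (@open_trans c d) (@tmap_smooth c d))).
exact: trans_coord.
Qed.

Lemma comp_change (b : bivector M) c d : dom c (base b) -> dom d (base b) ->
  components b d = (jac c d (base b))^T *m components b c *m jac c d (base b).
Proof. by move=> cb db; have [_ _ H] := components_bitangent b; exact: H. Qed.

Lemma comp_anti (b : bivector M) c : (components b c)^T = - components b c.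
Proof. by have [_ H _] := components_bitangent b; exact: H. Qed.

Lemma biv_eq (b b' : bivector M) c : base b = base b' -> dom c (base b) ->
  components b c = components b' c -> b = b'.
Proof.
move=> bb cb E.
have F : components b = components b'.
  apply/funext => d.
  have [db|ndb] := pselect (dom d (base b)).
    by rewrite (comp_change cb db) (@comp_change b' c d) -?bb// E.
  have [H _ _] := components_bitangent b; have [H' _ _] := components_bitangent b'.
  by rewrite H// H' -?bb.
case: b b' bb F {cb E} => [p w Hw] [q w' Hw'] /= pq ww; subst q; subst w'.
by congr Bivector; exact: Prop_irrelevance.
Qed.

Lemma biv_ex c p (w : 'M[R]_n) : dom c p -> w^T = - w ->
  exists b : bivector M, base b = p /\ components b c = w.
Proof.
move=> cp aw.
pose W d := if pselect (dom d p) then (jac c d p)^T *m w *m jac c d p else 0.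
have WE d : dom d p -> W d = (jac c d p)^T *m w *m jac c d p.
  by move=> dp; rewrite /W; case: pselect.
have W0 d : ~ dom d p -> W d = 0 by move=> nd; rewrite /W; case: pselect.
have HW : bitangent p W.
  split=> [d nd|d|d e dp ep]; first exact: W0.
    have [dp|nd] := pselect (dom d p); last by rewrite W0// trmx0 oppr0.
    by rewrite WE// !trmx_mul trmxK aw mulNmx mulmxN mulmxA.
  by rewrite (WE _ dp) (WE _ ep) -(jac_comp cp dp ep) trmx_mul !mulmxA.
exists (Bivector HW); split => //=.
by rewrite WE// jac_id// trmx1 mul1mx mulmx1.
Qed.

Lemma biv_open c (U : set M) (V : set 'M[R]_n) : open U -> U `<=` dom c -> open V ->
  open [set b : bivector M | U (base b) /\ V (components b c)].
Proof.
move=> oU Uc oV; set W := [set b | _].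
exists [set W]; last by rewrite bigcup_set1.
by move=> _ ->; apply: (@finI_from1 _ _ _ id); exists c, U, V.
Qed.

(** One chart suffices: components in any other chart arise by congruence with the Jacobian, which
    is continuous in the base point. *)
Lemma biv_cont (Y : topologicalType) (F : Y -> bivector M) y0 c :
  {for y0, continuous (fun y => base (F y))} -> dom c (base (F y0)) ->
  {for y0, continuous (fun y => components (F y) c)} -> {for y0, continuous F}.
Proof.
move=> bc cb cc.
suff H : forall W, bivector_subbase W -> W (F y0) -> nbhs y0 (F @^-1` W).
  move=> A; rewrite nbhsE => -[B [[D DB <-] [i Di iF]] BA].
  rewrite /= /nbhs/=.
  have : nbhs y0 (F @^-1` i).
    have [E ED Ei] := DB _ Di; rewrite -Ei in iF *.
    rewrite preimage_bigcap.
    apply: filter_bigI => W WE; apply: H; last exact: iF.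
    by have := ED _ WE; rewrite inE.
  by apply: filterS => y Fy; apply: BA; exists i.
move=> W [d [U [V [oU Ud oV ->]]]] [Ub Vb].
have db := Ud _ Ub.
have n1 : \forall y \near y0, U (base (F y)).
  by apply: bc; exact: open_nbhs_nbhs.
have n2 : \forall y \near y0, dom c (base (F y)).
  by apply: bc; apply: open_nbhs_nbhs; split; [exact: dom_open|].
have jc : {for y0, continuous (fun y => jac c d (base (F y)))}.
  by apply: (continuous_comp bc); exact: jac_cont.
have wc := mulmx_continuous (mulmx_continuous (trmx_continuous jc) cc) jc.
have n3 : \forall y \near y0, V ((jac c d (base (F y)))^T *m components (F y) c *m jac c d (base (F y))).
  by apply: wc; rewrite -comp_change//; exact: open_nbhs_nbhs.
near=> y; split; first by near: y.
rewrite (@comp_change _ c d).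
- by near: y.
- by near: y.
- by apply: Ud; near: y.
Unshelve. all: by end_near. Qed.

(** The pointwise form of [regular 2], to which [regular_rank2] and [rank2_regular] reduce it for
    smooth fields. *)
Definition rank2 (b : bivector M) := forall c, dom c (base b) ->
  dec (components b c) /\ components b c != 0.

Lemma jac_unit c d p : dom c p -> dom d p -> jac c d p \in unitmx.
Proof. by move=> cp dp; have [u _] := mulmx1_unit (jac_inv cp dp); exact: u. Qed.

Lemma congr_neq0 (w J : 'M[R]_n) : J \in unitmx -> w != 0 -> J^T *m w *m J != 0.
Proof.
move=> Ju; apply: contraNneq => E.
have JTu : J^T \in unitmx by rewrite unitmx_tr.
have : J^T *m w = 0 by rewrite -[LHS](mulmxK Ju) E mul0mx.
by move=> E2; rewrite -[w](mulKmx JTu) E2 mulmx0.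
Qed.

Lemma rank2_chart b c : dom c (base b) -> dec (components b c) -> components b c != 0 -> rank2 b.
Proof.
move=> cb dw w0 d db; rewrite (comp_change cb db); split; first exact: dec_congr.
by apply: congr_neq0 => //; exact: jac_unit.
Qed.

End ManifoldBasics.

(** The 3 x 3 minor on rows i, k, l and columns j, k, l vanishes. By antisymmetry it is divisible by
    w_kl, and the quotient expresses w_ij through rows k and l. *)
Lemma rank_le2_dec (R : realType) n (w : 'M[R]_n) (a b x y : 'rV[R]_n) k l :
  w^T = - w -> w = a^T *m x + b^T *m y -> w k l != 0 -> dec w.
Proof.
move=> aw wE wkl.
have anti i j : w j i = - w i j.
  by have := congr1 (fun A : 'M[R]_n => A i j) aw; rewrite !mxE.
have E i j : w i j = a 0 i * x 0 j + b 0 i * y 0 j.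
  by rewrite wE !mxE !big_ord1 !mxE.
have wkk i : w i i = 0 by have := anti i i; lra.
exists ((w k l)^-1 *: row k w), (row l w).
apply/matrixP => i j; rewrite wedgeE !mxE.
have minor : w i j * (w k k * w l l - w k l * w l k) - w i k * (w k j * w l l - w k l * w l j)
   + w i l * (w k j * w l k - w k k * w l j) = 0 by rewrite !E; ring.
rewrite !wkk (anti k l) (anti l i) (anti k i) in minor.
move: minor wkl; move: (w i j) (w k l) (w k i) (w l j) (w l i) (w k j).
move=> A B C D E' F minor B0.
have -> : B^-1 * C * D - E' * (B^-1 * F) = (C * D - E' * F) / B by field.
apply: (mulIf B0); rewrite mulfVK//; apply: (mulIf B0); lra.
Qed.

(** * Regular of rank 2 means decomposable and nonzero *)

Section Regular.
Variables (R : realType) (n : nat) (M : manifold R n).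
Local Opaque partial.
Implicit Types (c d e : chart M) (p q : M) (pi : M -> bivector M).

Lemma cot_ex c p (eta0 : 'rV[R]_n) : dom c p -> exists eta, cotangent p eta /\ eta c = eta0.
Proof.
move=> cp.
pose eta d := if pselect (dom d p) then eta0 *m (jac d c p)^T else 0.
have etaE d : dom d p -> eta d = eta0 *m (jac d c p)^T by rewrite /eta; case: pselect.
exists eta; split; last by rewrite etaE// jac_id// trmx1 mulmx1.
split=> [d|d e dp ep]; first by rewrite /eta; case: pselect.
by rewrite (etaE _ dp) (etaE _ ep) -(jac_comp dp ep cp) trmx_mul mulmxA.
Qed.

Lemma tangent_eq c p (X Y : chart M -> 'rV[R]_n) : dom c p -> tangent p X -> tangent p Y ->
  X c = Y c -> X = Y.
Proof.
move=> cp [X0 XE] [Y0 YE] E; apply/funext => d.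
have [dp|nd] := pselect (dom d p); last by rewrite X0// Y0.
by rewrite (XE c d)// (YE c d)// E.
Qed.

Lemma sharp_tangent (b : bivector M) eta : cotangent (base b) eta -> tangent (base b) (sharp b eta).
Proof.
move=> [eta0 etaE]; split=> [d nd|c d cp dp]; first by rewrite /sharp eta0// mul0mx.
by rewrite /sharp (comp_change cp dp) (etaE c d cp dp) !mulmxA.
Qed.

Lemma tangent_lin p (X Y : chart M -> 'rV[R]_n) (r s : R) : tangent p X -> tangent p Y ->
  tangent p (r *: X + s *: Y).
Proof.
move=> [X0 XE] [Y0 YE]; split=> [d nd|c d cp dp].
  by rewrite !fctE X0// Y0// !scaler0 addr0.
by rewrite !fctE (XE c d)// (YE c d)// mulmxDl -!scalemxAl.
Qed.

Lemma sum2 (V : nmodType) (f : 'I_2 -> V) : \sum_a f a = f 0 + f 1.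
Proof. by rewrite big_ord_recl big_ord1; congr (_ + f _); apply: val_inj. Qed.

(** The rows of the component matrix are images of the coordinate covectors, hence combinations of
    the two frame vectors; independence of the frame excludes the zero matrix. *)
Lemma regular_rank2 pi : bivector_field pi -> regular 2 pi -> forall p, rank2 (pi p).
Proof.
move=> [bp _] reg p c; rewrite bp => cp.
have [U [X [[oU Up] tX _ indX rg]]] := reg p.
have tX0 := tX 0 p Up; have tX1 := tX 1 p Up.
have w0 : components (pi p) c != 0.
  apply/eqP => w0.
  have c0 d : components (pi p) d = 0.
    have [dp|nd] := pselect (dom d p); last first.
      by have [H _ _] := components_bitangent (pi p); apply: H; rewrite bp.
    by rewrite (@comp_change _ _ _ _ c d) ?bp// w0 mulmx0 mul0mx.
  have : sharp_image pi p (X 0 p).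
    rewrite rg//; exists (fun a => if a == 0 then 1 else 0) => //.
    by rewrite sum2/= scale1r scale0r addr0.
  move=> [eta _ E].
  have X00 : X 0 p = 0 by rewrite -E; apply/funext => d; rewrite /sharp c0 mulmx0.
  have := indX p Up (fun a => if a == 0 then 1 else 0).
  rewrite sum2/= scale1r scale0r addr0 => /(_ X00 0)/=.
  by move/eqP; rewrite oner_eq0.
have [k [l wkl]] : exists k l, components (pi p) c k l != 0.
  apply: contra_notP (elimN eqP w0) => H; apply/matrixP => i j; rewrite mxE.
  by apply: contra_notP H => /eqP h; exists i, j.
split => //.
have rows i : exists r : 'I_2 -> R, row i (components (pi p) c) = r 0 *: X 0 p c + r 1 *: X 1 p c.
  have [eta [ceta etac]] := cot_ex (delta_mx 0 i) cp.
  have : sharp_image pi p (sharp (pi p) eta) by exists eta.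
  rewrite rg// => -[r _ E]; exists r.
  have := congr1 (fun Z => Z c) E; rewrite sum2 !fctE => ->.
  by rewrite /sharp etac rowE.
have [r rE] := choice rows.
apply: (@rank_le2_dec _ _ _ (\row_i r i 0) (\row_i r i 1) (X 0 p c) (X 1 p c) k l) => //.
  exact: comp_anti.
apply/row_matrixP => i; rewrite rE; apply/rowP => j.
by rewrite !mxE !big_ord1 !mxE.
Qed.

Lemma comp_smooth pi c : bivector_field pi -> smooth_on (cimg c) (local_comp pi c).
Proof. by move=> [_ H]; exact: H. Qed.

Lemma comp_cont pi c p : bivector_field pi -> dom c p ->
  {for p, continuous (fun q => components (pi q) c)}.
Proof.
move=> fp cp.
apply: (@near_eq_continuous _ _ (fun q => local_comp pi c (coord c q))).
  apply: filterS (open_nbhs_nbhs (conj (dom_open c) cp)) => q cq.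
  by rewrite /local_comp coordK.
apply: (continuous_comp (coord_cont cp)).
by apply: (smooth_on_continuous (comp_smooth c fp)); exact: coord_cimg.
Qed.

(** Where w_kl is nonzero, rows k and l form the frame. They are independent by their entries in
    columns k and l, and they span the image by the Plucker relations. *)
Lemma rank2_regular pi : bivector_field pi -> (forall p, rank2 (pi p)) -> regular 2 pi.
Proof.
move=> fp rk p; have [bp _] := fp.
have [c cp] := @dom_cover _ _ M p.
have [dw w0] : dec (components (pi p) c) /\ components (pi p) c != 0 by apply: rk; rewrite bp.
have [k [l wkl]] : exists k l, components (pi p) c k l != 0.
  apply: contra_notP (elimN eqP w0) => H; apply/matrixP => i j; rewrite mxE.
  by apply: contra_notP H => /eqP h; exists i, j.
pose U := dom c `&` (fun q => components (pi q) c k l) @^-1` [set s : R | s != 0].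
have oU : open U.
  apply: (open_preim (dom_open c)); last exact: open_neq0.
  by move=> q cq; apply: entry_continuous; exact: comp_cont.
pose ix (a : 'I_2) := if a == 0 then k else l.
pose X (a : 'I_2) q d : 'rV[R]_n :=
  if pselect (dom d q) then row (ix a) (components (pi q) c) *m jac c d q else 0.
have XE a q d : dom d q -> X a q d = row (ix a) (components (pi q) c) *m jac c d q.
  by rewrite /X; case: pselect.
have tX a q : U q -> tangent q (X a q).
  move=> [cq _]; split=> [d|d e dq eq]; first by rewrite /X; case: pselect.
  by rewrite (XE _ _ _ dq) (XE _ _ _ eq) -mulmxA jac_comp.
have Xc a q : U q -> X a q c = row (ix a) (components (pi q) c).
  by move=> [cq _]; rewrite XE// jac_id// mulmx1.
exists U, X; split => //.
- move=> a d.
  have sub : coord d @` (U `&` dom d) `<=` trans d c.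
    by move=> _ [q [[cq _] dq] <-]; exists q.
  have oW : open (coord d @` (U `&` dom d)).
    by apply: open_coord_image; [apply: openI => //; exact: dom_open|move=> q []].
  apply: (@smooth_on_eq _ _ _ _ _ (fun x => row (ix a) (local_comp pi c (tmap d c x)) *m jac c d (param d x))); first exact: oW.
    move=> _ [q [[cq _] dq] <-]; rewrite coordK// XE// /local_comp tmap_coord//.
    by rewrite coordK.
  apply: smooth_onM; first exact: oW.
    have S : smooth_on (coord d @` (U `&` dom d)) (fun x => local_comp pi c (tmap d c x)).
      apply: (smooth_on_comp oW (@coord_open _ _ M c) _ (comp_smooth c fp)).
        exact: (smooth_on_subset sub (@tmap_smooth _ _ M d c)).
      by move=> _ [q [[cq _] dq] <-]; rewrite tmap_coord//; exact: coord_cimg.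
    move=> i j m; apply: (Ck_eq oW _ (S (ix a) j m)) => x _.
    by rewrite [RHS]mxE.
  apply: (@smooth_on_eq _ _ _ _ _ (fun x => jac c d (param c (tmap d c x)))); first exact: oW.
    move=> _ [q [[cq _] dq] <-].
    by rewrite (@tmap_coord _ _ M d c q dq) (@coordK _ _ M c q cq) (@coordK _ _ M d q dq).
  apply: (smooth_on_comp oW (@open_trans _ _ M c d) _ (@jac_smooth _ _ M c d)).
    exact: (smooth_on_subset sub (@tmap_smooth _ _ M d c)).
  by move=> _ [q [[cq _] dq] <-]; rewrite tmap_coord//; exact: trans_coord.
- move=> q Uq r; rewrite sum2 => E.
  have anti i j : components (pi q) c j i = - components (pi q) c i j.
    by have := congr1 (fun A : 'M[R]_n => A i j) (comp_anti (pi q) c); rewrite !mxE.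
  have dg i : components (pi q) c i i = 0 by have := anti i i; lra.
  have := congr1 (fun Z => Z c) E; rewrite !fctE !Xc//= => Ec.
  have [cq wq] := Uq.
  have Ek := congr1 (fun Z : 'rV[R]_n => Z 0 k) Ec.
  have El := congr1 (fun Z : 'rV[R]_n => Z 0 l) Ec.
  rewrite !mxE dg mulr0 add0r (anti k l) mulrN in Ek.
  rewrite !mxE dg mulr0 addr0 in El.
  have e0 : r 0 = 0 by move/eqP: El; rewrite mulf_eq0 (negbTE wq) orbF => /eqP.
  have e1 : r 1 = 0 by move/eqP: Ek; rewrite oppr_eq0 mulf_eq0 (negbTE wq) orbF => /eqP.
  move=> [[|[|m]] hm] //.
    by rewrite -[RHS]e0; congr (r _); apply: val_inj.
  by rewrite -[RHS]e1; congr (r _); apply: val_inj.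
- move=> q Uq; have [cq wq] := Uq.
  have dq : dec (components (pi q) c) by have [] := rk q c; rewrite ?bp.
  apply/seteqP; split => Z.
    move=> [eta ceta <-].
    pose w := components (pi q) c.
    pose al := - (\sum_i eta c 0 i * w l i) / w k l.
    pose be := (\sum_i eta c 0 i * w k i) / w k l.
    exists (fun a => if a == 0 then al else be) => //.
    rewrite sum2/=; apply: (tangent_eq cq); first by apply: tangent_lin; exact: tX.
      by have := @sharp_tangent (pi q) eta; rewrite bp; exact.
    rewrite !fctE !Xc//= /sharp; apply/rowP => j; rewrite !mxE -/w.
    apply: (mulfI wq); rewrite mulr_sumr mulrDr -/w /al /be.
    rewrite [_ / _ * w k j]mulrAC [_ / _ * w l j]mulrAC ![_ * (_ / _)]mulrC !divfK//.
    rewrite mulNr !mulr_suml -sumrN -big_split/=; apply: eq_bigr => i _.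
    have := dec_pluecker i j k l dq; rewrite -/w.
    have anti a b : w b a = - w a b.
      by have := congr1 (fun A : 'M[R]_n => A a b) (comp_anti (pi q) c); rewrite !mxE.
    rewrite (anti k j) (anti l i) (anti l j); move: (eta c 0 i) (w i j) (w k l) (w k j) (w l i) (w k i) (w l j) => a b0 b1 b2 b3 b4 b5 Hp.
    have := congr1 (fun z => a * z) Hp. lra.
  move=> [r _ <-]; rewrite sum2.
  have [eta [ceta etac]] := cot_ex (r 0 *: delta_mx 0 k + r 1 *: delta_mx 0 l) cq.
  exists eta => //; apply: (tangent_eq cq).
  - by have := @sharp_tangent (pi q) eta; rewrite bp; exact.
  - by apply: tangent_lin; exact: tX.
  - by rewrite !fctE !Xc//= /sharp etac mulmxDl -!scalemxAl -!rowE.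
Qed.

End Regular.

Lemma paste_continuous (R : realType) (T Y : topologicalType) (u : T -> R) (c : R) (F G : T -> Y) :
  continuous u -> continuous F -> continuous G -> (forall z, u z = c -> F z = G z) ->
  continuous (fun z => if u z <= c then F z else G z).
Proof.
move=> uc Fc Gc FG z.
have [lt|gt|e] := ltgtP (u z) c.
- apply: (@near_eq_continuous _ _ F _ z); last exact: Fc.
  have H : \forall y \near z, u y < c by exact: (uc z _ (open_nbhs_nbhs (conj (@open_lt R c) lt))).
  by apply: filterS H => y /ltW ->.
- apply: (@near_eq_continuous _ _ G _ z); last exact: Gc.
  have H : \forall y \near z, c < u y by exact: (uc z _ (open_nbhs_nbhs (conj (@open_gt R c) gt))).
  by apply: filterS H => y h; rewrite leNgt h.
- move=> W; rewrite e lexx => nW.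
  have n1 : \forall y \near z, W (F y) by exact: Fc.
  have n2 : \forall y \near z, W (G y) by apply: Gc; rewrite -FG.
  rewrite /nbhs/=; near=> y; rewrite /=; case: ifP => _; near: y; [exact: n1|exact: n2].
Unshelve. all: by end_near. Qed.

Lemma comp2_continuous (T A B Y : topologicalType) (H : A -> B -> Y) (a : T -> A) (b : T -> B) :
  continuous (fun z : A * B => H z.1 z.2) -> continuous a -> continuous b ->
  continuous (fun z => H (a z) (b z)).
Proof.
move=> Hc ac bc z.
have abc : {for z, continuous (fun z => (a z, b z))} by apply: cvg_pair; [exact: ac|exact: bc].
exact: (@continuous_comp _ _ _ (fun z => (a z, b z)) (fun z => H z.1 z.2) z abc (Hc _)).
Qed.

(** * Homotopies of rank 2 fields *)

Section Isotopies.
Variables (R : realType) (n : nat) (M : manifold R n).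
Local Opaque partial.
Implicit Types (c d e : chart M) (p q : M) (pi : M -> bivector M).

Lemma field_by_charts pi : (forall p, base (pi p) = p) ->
  (forall p, exists c W, [/\ open W, W p, W `<=` dom c &
     smooth_on (coord c @` W) (local_comp pi c)]) -> bivector_field pi.
Proof.
move=> bp H; split=> // d i j k; apply: Ck_local => _ [p dp <-].
have [c [W [oW Wp Wc sW]]] := H p.
have oV : open (coord d @` (W `&` dom d)).
  by apply: open_coord_image; [apply: openI => //; exact: dom_open|move=> q []].
exists (coord d @` (W `&` dom d)); split; [exact: oV|by exists p|].
have oWc : open (coord c @` W) by exact: open_coord_image.
have sub : coord d @` (W `&` dom d) `<=` trans d c.
  by move=> _ [q [Wq dq] <-]; exists q => //; split => //; exact: Wc.
have S : smooth_on (coord d @` (W `&` dom d)) (fun x => local_comp pi c (tmap d c x)).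
  apply: (smooth_on_comp oV oWc _ sW).
    exact: (smooth_on_subset sub (@tmap_smooth _ _ M d c)).
  by move=> _ [q [Wq dq] <-]; rewrite (@tmap_coord _ _ M d c q dq); exists q.
have sJ : smooth_on (coord d @` (W `&` dom d)) (fun x => jac c d (param c (tmap d c x))).
  apply: (smooth_on_comp oV (@open_trans _ _ M c d) _ (@jac_smooth _ _ M c d)).
    exact: (smooth_on_subset sub (@tmap_smooth _ _ M d c)).
  move=> _ [q [Wq dq] <-]; rewrite (@tmap_coord _ _ M d c q dq).
  by apply: trans_coord => //; exact: Wc.
have sA := smooth_onM oV (smooth_onM oV (smooth_on_tr oV sJ) S) sJ.
have E : smooth_on (coord d @` (W `&` dom d)) (local_comp pi d).
  apply: (smooth_on_eq oV _ sA) => _ [q [Wq dq] <-].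
  have cq := Wc _ Wq.
  rewrite /local_comp (@tmap_coord _ _ M d c q dq) (@coordK _ _ M c q cq) (@coordK _ _ M d q dq).
  by rewrite (@comp_change _ _ _ (pi q) c d) ?bp.
exact: E.
Qed.

Lemma field_cont pi : bivector_field pi -> continuous pi.
Proof.
move=> fp p; have [bp _] := fp; have [c cp] := @dom_cover _ _ M p.
apply: (@biv_cont _ _ _ _ pi p c); last 2 first.
- by rewrite bp.
- exact: comp_cont.
by apply: (@near_eq_continuous _ _ id); [apply: nearW => q; rewrite bp|exact: cvg_id].
Qed.

(** Time runs over the whole line, which spares subspace topologies when homotopies are
    concatenated. Joint continuity is what pasting uses, and currying turns it into a path for the
    compact-open topology. *)
Definition homotopic pi pi' (A : set M) := exists H : R -> M -> bivector M,
  [/\ forall t, bivector_field (H t), forall t p, rank2 (H t p),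
      continuous (fun z : R * M => H z.1 z.2),
      H 0 = pi /\ H 1 = pi' & forall t p, ~ A p -> H t p = pi p].

Lemma homotopic_field pi pi' A : homotopic pi pi' A -> bivector_field pi'.
Proof. by move=> [H [fH _ _ [_ <-] _]]. Qed.

Lemma homotopic_rank2 pi pi' A : homotopic pi pi' A -> forall p, rank2 (pi' p).
Proof. by move=> [H [_ rH _ [_ <-] _]]. Qed.

Lemma homotopic_off pi pi' A p : homotopic pi pi' A -> ~ A p -> pi' p = pi p.
Proof. by move=> [H [_ _ _ [_ <-] sH]] /sH ->. Qed.

Lemma homotopic_refl pi A : bivector_field pi -> (forall p, rank2 (pi p)) -> homotopic pi pi A.
Proof.
move=> fp rp; exists (fun=> pi); split=> //.
by move=> z; apply: (continuous_comp (@cont_snd _ _ z)); exact: field_cont.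
Qed.

Lemma homotopic_trans pi pi' pi'' A B : homotopic pi pi' A -> homotopic pi' pi'' B -> homotopic pi pi'' (A `|` B).
Proof.
move=> [F [fF rF cF [F0 F1] sF]] [G [fG rG cG [G0 G1] sG]].
exists (fun t => if t <= 2^-1 then F (2 * t) else G (2 * t - 1)); split.
- by move=> t; case: ifP.
- by move=> t p; case: ifP.
- have E : (fun z : R * M => (if z.1 <= 2^-1 then F (2 * z.1) else G (2 * z.1 - 1)) z.2) =
    (fun z => if z.1 <= 2^-1 then F (2 * z.1) z.2 else G (2 * z.1 - 1) z.2).
    by apply/funext => z; case: ifP.
  have c1 : continuous (fun z : R * M => 2 * z.1).
    by move=> z; apply: cvgM; [exact: cvg_cst|exact: cont_fst].
  have c2 : continuous (fun z : R * M => 2 * z.1 - 1).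
    by move=> z; apply: cvgB; [exact: c1|exact: cvg_cst].
  rewrite E; apply: paste_continuous.
  + exact: cont_fst.
  + exact: (comp2_continuous cF c1 (@cont_snd _ _)).
  + exact: (comp2_continuous cG c2 (@cont_snd _ _)).
  + by move=> z ->; rewrite divff// subrr F1 G0.
- split; first by rewrite invr_ge0 ler0n mulr0.
  rewrite ifF; last by apply/negbTE; rewrite -ltNge invf_lt1// ltr1n.
  by rewrite mulr1 -[2](natrD _ 1 1) natrD addrK.
- move=> t p AB; have nA : ~ A p by move=> a; apply: AB; left.
  have nB : ~ B p by move=> a; apply: AB; right.
  case: ifP => _; first exact: sF.
  by rewrite sG// -F1 sF.
Qed.

Lemma homotopic_subset pi pi' A B : A `<=` B -> homotopic pi pi' A -> homotopic pi pi' B.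
Proof.
move=> AB [F [fF rF cF F01 sF]]; exists F; split=> // t p nB.
by apply: sF => /AB.
Qed.

Lemma field_near pi : (forall p, exists pi', bivector_field pi' /\ \forall q \near p, pi q = pi' q) ->
  bivector_field pi.
Proof.
move=> H; have bp p : base (pi p) = p.
  by have [pi' [[bp' _] /nbhs_singleton ->]] := H p.
apply: field_by_charts => // p; have [pi' [fp' np]] := H p.
have [c cp] := @dom_cover _ _ M p.
have W := open_interior [set q | pi q = pi' q].
exists c, ([set q | pi q = pi' q]^° `&` dom c); split.
- by apply: openI; [exact: W|exact: dom_open].
- by split.
- by move=> q [].
have oW : open (coord c @` ([set q | pi q = pi' q]^° `&` dom c)).
  by apply: open_coord_image; [apply: openI; [exact: W|exact: dom_open]|move=> q []].
apply: (smooth_on_eq oW (F := local_comp pi' c)).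
  move=> _ [q [Wq cq] <-]; rewrite /local_comp coordK//.
  by have /= -> := interior_subset Wq.
apply: (smooth_on_subset _ (comp_smooth c fp')).
by move=> _ [q [Wq cq] <-]; exact: coord_cimg.
Qed.

(** Homotopy number k runs from time t_k = 1 - 1/(k+1) to t_(k+1). Near a given point only finitely
    many of them move the field, so there the infinite concatenation equals a finite one, also at
    time 1. *)
Lemma homotopic_limit (pik : nat -> M -> bivector M) (A : nat -> set M) :
  (forall k, homotopic (pik k) (pik k.+1) (A k)) ->
  (forall p, exists N, \forall q \near p, forall k, (N <= k)%N -> ~ A k q) ->
  exists pi', homotopic (pik 0%N) pi' setT /\
    forall p, exists N, \forall q \near p, forall k, (N <= k)%N -> pi' q = pik k q.
Proof.
move=> /choice[H HH] lf.
have fH k t : bivector_field (H k t) by have [] := HH k.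
have rH k t p : rank2 (H k t p) by have [_ h _ _ _] := HH k; exact: h.
have cH k : continuous (fun z : R * M => H k z.1 z.2) by have [] := HH k.
have H0 k : H k 0 = pik k by have [_ _ _ []] := HH k.
have H1 k : H k 1 = pik k.+1 by have [_ _ _ []] := HH k.
have sH k t p : ~ A k p -> H k t p = pik k p by have [_ _ _ _ h] := HH k; exact: h.
pose tk k : R := 1 - k.+1%:R^-1.
have tk0 : tk 0%N = 0 by rewrite /tk invr1 subrr.
have tkS k : tk k < tk k.+1.
  by rewrite /tk ltrD2l ltrN2 ltf_pV2 ?posrE ?ltr0n// ltr_nat.
have tk1 k : tk k < 1 by rewrite /tk ltrBlDr ltrDl invr_gt0 ltr0n.
have tkle k : 0 <= tk k.
  by elim: k => [|k IH]; [rewrite tk0|exact: (le_trans IH (ltW (tkS k)))].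
(* The clock of stage k; it is cut off only above, since [F] consults it only after t_k. *)
pose cl k (t : R) : R := Order.min 1 ((t - tk k) / (tk k.+1 - tk k)).
pose F := fix F k : R -> M -> bivector M := if k is k'.+1 then
   fun t => if t <= tk k' then F k' t else H k' (cl k' t) else fun=> pik 0%N.
have FS k t : F k.+1 t = if t <= tk k then F k t else H k (cl k t) by [].
have clt k t : tk k.+1 <= t -> cl k t = 1.
  move=> h; apply/min_idPl; rewrite ler_pdivlMr ?subr_gt0// mul1r lerB//.
have Ft k t : tk k <= t -> F k t = pik k.
  case: k => // k h; rewrite FS leNgt (lt_le_trans (tkS k) h) /=.
  by rewrite clt// H1.
have cF k : continuous (fun z : R * M => F k z.1 z.2).
  elim: k => [|k IH].
    have f0 : bivector_field (pik 0%N) by rewrite -H0.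
    by move=> z; apply: (continuous_comp (@cont_snd _ _ z)); exact: field_cont.
  have E : (fun z : R * M => F k.+1 z.1 z.2) =
    (fun z => if z.1 <= tk k then F k z.1 z.2 else H k (cl k z.1) z.2).
    by apply/funext => z; rewrite FS; case: ifP.
  rewrite E; apply: paste_continuous => //; first exact: cont_fst.
    apply: (comp2_continuous (cH k) _ (@cont_snd _ _)) => z.
    have ca : {for z, continuous (fun z : R * M => (z.1 - tk k) / (tk k.+1 - tk k))}.
      by apply: cvgM; [apply: cvgB; [exact: cont_fst|exact: cvg_cst]|exact: cvg_cst].
    have c1 : {for z, continuous (fun _ : R * M => (1 : R))} by exact: cvg_cst.
    exact: (@continuous_min R _ _ _ z c1 ca).
  by move=> z ->; rewrite Ft// /cl subrr mul0r (min_idPr _)// H0.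
have fF k t : bivector_field (F k t).
  by elim: k => [|k IH]; [rewrite /= -H0|rewrite FS; case: ifP].
have rF k t p : rank2 (F k t p).
  by elim: k => [|k IH]; [rewrite /= -H0|rewrite FS; case: ifP].
have F0 k : F k 0 = pik 0%N by elim: k => // k IH; rewrite FS tkle.
have F1 k : F k 1 = pik k by rewrite Ft// ltW.
have Fst N q : (forall k, (N <= k)%N -> ~ A k q) -> forall k t, (N <= k)%N -> F k t q = F N t q.
  move=> HN; elim=> [|k IH] t; first by rewrite leqn0 => /eqP ->.
  rewrite leq_eqVlt => /predU1P[->//|]; rewrite ltnS => Nk.
  rewrite FS; case: ifP => [_|]; first exact: IH.
  move/negbT; rewrite -ltNge => h; rewrite -IH// Ft ?ltW// sH//; exact: HN.
have [N NP] := choice lf.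
pose G t p := F (N p) t p.
(* The stage N p need not be locally constant. Comparing two stages with the larger one allows it to
   be frozen near p. *)
have GN p : \forall q \near p, forall t, G t q = F (N p) t q.
  apply: filterS (NP p) => q Hq t; rewrite /G.
  have Hqq := nbhs_singleton (NP q).
  rewrite -(Fst _ _ Hqq (maxn (N p) (N q)) t (leq_maxr _ _)).
  by rewrite -(Fst _ _ Hq (maxn (N p) (N q)) t (leq_maxl _ _)).
exists (G 1); split.
  exists G; split=> //.
  - move=> t; apply: field_near => p; exists (F (N p) t); split=> //.
    by apply: filterS (GN p) => q ->.
  - by move=> t p; exact: rF.
  - move=> z; apply: (@near_eq_continuous _ _ (fun y : R * M => F (N z.2) y.1 y.2)); last exact: cF.
    have h : \forall y \near z, forall t, G t y.2 = F (N z.2) t y.2.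
      exact: (@cont_snd R M z _ (GN z.2)).
    by apply: (filterS _ h) => y Hy; rewrite Hy.
  - by split=> //; apply/funext => p; rewrite /G F0.
  - by move=> t p; case.
move=> p; exists (N p); near=> q => k Nk.
rewrite (_ : G 1 q = F (N p) 1 q); last by near: q; apply: filterS (GN p) => q ->.
by rewrite -F1 (Fst (N p) q _ k)//; near: q; exact: NP.
Unshelve. all: by end_near. Qed.

End Isotopies.

Lemma comp2_continuous_at (T A B Y : topologicalType) (H : A -> B -> Y) (a : T -> A) (b : T -> B) z :
  {for (a z, b z), continuous (fun y : A * B => H y.1 y.2)} ->
  {for z, continuous a} -> {for z, continuous b} -> {for z, continuous (fun z => H (a z) (b z))}.
Proof.
move=> Hc ac bc.
have abc : {for z, continuous (fun z => (a z, b z))} by apply: cvg_pair; [exact: ac|exact: bc].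
exact: (@continuous_comp _ _ _ (fun z => (a z, b z)) (fun z => H z.1 z.2) z abc Hc).
Qed.

(** * From families in a chart to homotopies on M; Poisson points *)

Section LocalModification.
Variables (R : realType) (n : nat) (M : manifold R n).
Local Opaque partial.
Implicit Types (c d e : chart M) (p q : M) (pi : M -> bivector M).

Lemma open_param_compl c (K : set 'rV[R]_n) : compact K -> K `<=` cimg c ->
  open (~` (param c @` K)).
Proof.
move=> cK Kc; apply: closed_openC; apply: compact_closed; first exact: points_hausdorff.
exact: compact_param_image.
Qed.

(** The image of K is compact, hence closed in the Hausdorff space M. So a point outside the chart
    has a neighbourhood on which nothing changes. *)
Lemma homotopic_chart c (K : set 'rV[R]_n) pi (P : R -> 'rV[R]_n -> 'M[R]_n) :
  bivector_field pi -> (forall p, rank2 (pi p)) -> compact K -> K `<=` cimg c ->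
  (forall t, smooth_on (cimg c) (P t)) ->
  (forall t x, cimg c x -> dec (P t x) /\ P t x != 0) ->
  (forall t x, cimg c x -> ~ K x -> P t x = local_comp pi c x) ->
  (forall t x, cimg c x -> {for (t, x), continuous (fun z : R * 'rV[R]_n => P z.1 z.2)}) ->
  (forall x, cimg c x -> P 0 x = local_comp pi c x) ->
  exists pi', homotopic pi pi' (param c @` K) /\ forall x, cimg c x -> local_comp pi' c x = P 1 x.
Proof.
move=> fp rp cK Kc sP dP offP cP P0; have [bp _] := fp.
have /choice[H HH] : forall t, exists Ht : M -> bivector M, forall p,
    (dom c p -> base (Ht p) = p /\ components (Ht p) c = P t (coord c p)) /\
    (~ dom c p -> Ht p = pi p).
  move=> t; suff /choice[f Hf] : forall p, exists b : bivector M,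
    (dom c p -> base b = p /\ components b c = P t (coord c p)) /\ (~ dom c p -> b = pi p).
    by exists f.
  move=> p.
  have [cp|ncp] := pselect (dom c p); last by exists (pi p); split.
  have [b [bb bc]] := biv_ex cp (dec_anti (dP t _ (coord_cimg cp)).1).
  by exists b; split.
have Hc t p : dom c p -> components (H t p) c = P t (coord c p) by move=> /(HH t p).1[].
have Hb t p : base (H t p) = p.
  have [cp|ncp] := pselect (dom c p); first by have [] := (HH t p).1 cp.
  by rewrite (HH t p).2.
have Hoff t p : ~ (param c @` K) p -> H t p = pi p.
  move=> nK; have [cp|ncp] := pselect (dom c p); last exact: (HH t p).2.
  apply: (@biv_eq _ _ _ _ _ c); rewrite ?Hb ?bp// Hc// offP//.
  - by rewrite /local_comp coordK.
  - exact: coord_cimg.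
  - by move=> Kp; apply: nK; exists (coord c p) => //; rewrite coordK.
have Hloc t x : cimg c x -> local_comp (H t) c x = P t x.
  by move=> cx; rewrite /local_comp Hc ?paramK//; exact: param_dom.
have oKC := open_param_compl cK Kc.
have compl p : ~ dom c p -> ~ (param c @` K) p.
  by move=> nc [x Kx E]; apply: nc; rewrite -E; apply: param_dom; exact: Kc.
exists (H 1); split; last by move=> x cx; exact: Hloc.
exists H; split.
- move=> t; apply: field_by_charts => // p.
  have [cp|ncp] := pselect (dom c p).
    exists c, (dom c); split => //; first exact: dom_open.
    apply: (smooth_on_eq (@coord_open _ _ M c) _ (sP t)) => x cx.
    by rewrite Hloc.
  have [d dp] := @dom_cover _ _ M p.
  have oW : open (dom d `&` ~` (param c @` K)) by apply: openI => //; exact: dom_open.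
  exists d, (dom d `&` ~` (param c @` K)); split.
  - exact: oW.
  - by split => //; exact: compl.
  - by move=> q [].
  have oW' : open (coord d @` (dom d `&` ~` (param c @` K))).
    by apply: open_coord_image => // q [].
  apply: (smooth_on_eq oW' (F := local_comp pi d)).
    by move=> _ [q [dq Kq] <-]; rewrite /local_comp coordK// Hoff.
  apply: (smooth_on_subset _ (comp_smooth d fp)).
  by move=> _ [q [dq _] <-]; exact: coord_cimg.
- move=> t p; have [cp|ncp] := pselect (dom c p); last by rewrite (HH t p).2.
  have [d1 d2] := dP t _ (coord_cimg cp).
  by apply: (@rank2_chart _ _ _ _ c); rewrite ?Hb// Hc.
- move=> [t p]; have [cp|ncp] := pselect (dom c p).
    apply: (@biv_cont _ _ _ _ (fun z : R * M => H z.1 z.2) (t, p) c).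
    + rewrite (_ : (fun z : R * M => _) = snd); last by apply/funext => z; rewrite Hb.
      exact: cont_snd.
    + by rewrite Hb.
    + apply: (@near_eq_continuous _ _ (fun z : R * M => P z.1 (coord c z.2))).
        have h : \forall z \near (t, p), dom c z.2.
          exact: (@cont_snd R M (t, p) _ (open_nbhs_nbhs (conj (dom_open c) cp))).
        by apply: (filterS _ h) => z cz; rewrite Hc.
      have bc := @continuous_comp _ _ _ (@snd R M) (coord c) (t, p) (@cont_snd R M (t, p)) (coord_cont cp).
      exact: (@comp2_continuous_at _ _ _ _ P fst _ (t, p) (cP t _ (coord_cimg cp)) (@cont_fst R M _) bc).
  apply: (@near_eq_continuous _ _ (fun z : R * M => pi z.2)).
    have h : \forall z \near (t, p), ~ (param c @` K) z.2.
      exact: (@cont_snd R M (t, p) _ (open_nbhs_nbhs (conj oKC (compl _ ncp)))).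
    by apply: (filterS _ h) => z cz; rewrite Hoff.
  exact: (@continuous_comp _ _ _ (@snd R M) pi (t, p) (@cont_snd R M (t, p)) (@field_cont _ _ _ pi fp p)).
- split=> //; apply/funext => p.
  have [cp|ncp] := pselect (dom c p); last by rewrite (HH 0 p).2.
  apply: (@biv_eq _ _ _ _ _ c); rewrite ?Hb ?bp// Hc// P0; last exact: coord_cimg.
  by rewrite /local_comp coordK.
- by move=> t p nK; exact: Hoff.
Qed.

Definition poisson_at pi p := forall c, dom c p ->
  forall i j k, sch (local_comp pi c) (coord c p) i j k = 0.

(** The transition map relates the two coordinate expressions, so [sch_related] carries the
    vanishing over. *)
Lemma poisson_at_chart pi c p : bivector_field pi -> dom c p ->
  (forall i j k, sch (local_comp pi c) (coord c p) i j k = 0) -> poisson_at pi p.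
Proof.
move=> fp cp H d dp i j k; have [bp _] := fp.
rewrite -(@tmap_coord _ _ M c d p cp).
rewrite (@sch_related _ _ (trans c d) (cimg d) (tmap c d) (local_comp pi c)).
- by rewrite big1// => a _; rewrite big1// => b _; rewrite big1// => e _; rewrite H mulr0.
- exact: open_trans.
- exact: coord_open.
- exact: tmap_smooth.
- apply: (smooth_on_subset _ (comp_smooth c fp)) => _ [q [cq _] <-]; exact: coord_cimg.
- exact: comp_smooth.
- by move=> _ [q [cq dq] <-]; rewrite (@tmap_coord _ _ M c d q cq); exact: coord_cimg.
- by move=> y _; exact: comp_anti.
- move=> _ [q [cq dq] <-]; rewrite (@tmap_coord _ _ M c d q cq) -jacE//.
  rewrite /local_comp (@coordK _ _ M c q cq) (@coordK _ _ M d q dq).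
  by rewrite (@comp_change _ _ _ (pi q) c d) ?bp.
- exact: trans_coord.
Qed.

Lemma poisson_at_near pi pi' p : (\forall q \near p, pi q = pi' q) -> poisson_at pi p -> poisson_at pi' p.
Proof.
move=> np H c cp i j k; rewrite -(H c cp i j k); apply/esym.
have oW : open ([set q | pi q = pi' q]^° `&` dom c).
  by apply: openI; [exact: open_interior|exact: dom_open].
apply: (@sch_eq _ _ (coord c @` ([set q | pi q = pi' q]^° `&` dom c))).
- by apply: open_coord_image => // q [].
- by exists p.
- move=> _ [q [Wq cq] <-]; rewrite /local_comp coordK//.
  by have /= -> := interior_subset Wq.
Qed.

(** Vanishing of the bracket is a closed condition. Passing to the interior makes the good set open
    and its complement, the singular set, closed. *)
Definition poisson_interior pi : set M := [set p | poisson_at pi p]^°.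

Lemma open_poisson_interior pi : open (poisson_interior pi).
Proof. exact: open_interior. Qed.

Lemma poisson_interior_sub pi p : poisson_interior pi p -> poisson_at pi p.
Proof. exact: interior_subset. Qed.

Lemma poisson_interior_open pi (U : set M) : open U -> (forall p, U p -> poisson_at pi p) -> U `<=` poisson_interior pi.
Proof.
by move=> oU H p Up; apply: filterS (open_nbhs_nbhs (conj oU Up)) => q /H.
Qed.

Lemma poisson_interior_near pi pi' (U : set M) : open U -> (forall p, U p -> pi' p = pi p) ->
  U `&` poisson_interior pi `<=` poisson_interior pi'.
Proof.
move=> oU H; apply: poisson_interior_open; first by apply: openI => //; exact: open_poisson_interior.
move=> p [Up Zp]; apply: (@poisson_at_near pi); last exact: poisson_interior_sub.
by apply: filterS (open_nbhs_nbhs (conj oU Up)) => q /H.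
Qed.

Lemma poisson_at_Poisson pi : (forall p, poisson_at pi p) -> Poisson pi.
Proof.
move=> H c _ [p cp <-] i j k; rewrite /schouten.
have E a b (d : 'I_n) : \sum_(l < n) (local_comp pi c (coord c p) a l *
      partial l (fun y => local_comp pi c y b d) (coord c p) +
    local_comp pi c (coord c p) a l *
      partial l (fun y => local_comp pi c y b d) (coord c p)) =
    2 * sch0 (local_comp pi c) (coord c p) a b d.
  by rewrite big_split/= /sch0 mulr2n mulrDl mul1r.
by rewrite !E -!mulrDr -/(sch _ _ _ _ _) H// mulr0.
Qed.

Lemma homotopic_homotopy pi pi' A : homotopic pi pi' A -> (forall p, poisson_at pi' p) ->
  exists pi_ : R -> {compact-open, M -> bivector M},
    [/\ homotopy pi_, forall t, t \in `[0, 1] -> regular 2 (pi_ t),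
      pi_ 0 = pi & Poisson (pi_ 1)].
Proof.
move=> [H [fH rH cH [H0 H1] _]] po.
exists H; split => //.
- split=> [t _|]; first exact: fH.
  by apply: continuous_subspaceT; exact: (continuous_curry_fun cH).
- by move=> t _; exact: rank2_regular.
- by rewrite H1; exact: poisson_at_Poisson.
Qed.

End LocalModification.

(** * Pulls supported in a chart *)

Section PullOnManifold.
Variables (R : realType) (n : nat) (M : manifold R n).
Local Opaque partial.

(** Extends a family over [0, 1] to all times, as [homotopic] asks. *)
Definition clamp (t : R) : R := Order.max 0 (Order.min 1 t).

Lemma clamp_itv t : 0 <= clamp t <= 1.
Proof. by rewrite /clamp le_max lexx ge_max ler01 ge_min lexx. Qed.

Lemma clamp0 : clamp 0 = 0.
Proof. by rewrite /clamp (min_idPr ler01) maxxx. Qed.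

Lemma clamp1 : clamp 1 = 1.
Proof. by rewrite /clamp minxx (max_idPr ler01). Qed.

Lemma clamp_continuous : continuous clamp.
Proof.
move=> t.
have cc (a : R) : {for t, continuous (fun _ : R => a)} by exact: cvg_cst.
have ci : {for t, continuous (fun s : R => s)} by exact: cvg_id.
exact: (@continuous_max R _ _ _ t (cc 0) (@continuous_min R _ _ _ t (cc 1) ci)).
Qed.

(** The homotopy scales the height from 0 to h. Decomposability along it is automatic; that the
    points stay in the chart, that A is invertible and that the field does not vanish must be
    supplied. *)
Lemma homotopic_pull (c : chart M) (K U : set 'rV[R]_n) v (h : 'rV[R]_n -> R) (pi : M -> bivector M) :
  bivector_field pi -> (forall p, rank2 (pi p)) ->
  compact K -> K `<=` U -> open U -> U `<=` cimg c -> smooth_on U v -> sm setT h ->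
  (forall x, ~ K x -> h x = 0) ->
  (forall s x, 0 <= s <= 1 -> K x ->
    [/\ cimg c (x + (s * h x) *: v x), Amat v (s * h x) x \in unitmx &
        Psi (local_comp pi c) v (s * h x) (s *: grad h x) x != 0]) ->
  exists pi', [/\ homotopic pi pi' (param c @` K),
    forall x, U x -> local_comp pi' c x = Psi (local_comp pi c) v (h x) (grad h x) x &
    forall x, U x -> poisson_at pi (param c (x + h x *: v x)) -> poisson_at pi' (param c x)].
Proof.
move=> fp rp cK KU oU Uc vs hs h0 HK; have [bp _] := fp.
set p := local_comp pi c.
have oO : open (cimg c) by exact: coord_open.
have ps : smooth_on (cimg c) p by exact: comp_smooth.
have prk x : cimg c x -> dec (p x) /\ p x != 0.
  by move=> cx; apply: rp; rewrite bp; exact: param_dom.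
have pd x : cimg c x -> dec (p x) by move=> /prk[].
have clK : closed K by apply: compact_closed => //; exact: norm_hausdorff.
have oKC : open (~` K) by exact: closed_openC.
have g0 x : ~ K x -> grad h x = 0.
  move=> nK; apply/rowP => i; rewrite mxE [RHS]mxE.
  by rewrite (partial_eq (U := ~` K) (g := fun=> 0) i oKC nK)// partial_cst.
have HU s x : 0 <= s <= 1 -> U x ->
    [/\ cimg c (x + (s * h x) *: v x), Amat v (s * h x) x \in unitmx &
        Psi p v (s * h x) (s *: grad h x) x != 0].
  move=> s01 Ux; have [Kx|nK] := pselect (K x); first exact: HK.
  rewrite h0// g0// mulr0 scaler0 Psi0 scale0r addr0 /Amat scale0r addr0 unitmx1.
  by split => //; [exact: Uc|exact: (prk x (Uc _ Ux)).2].
have KUn : forall x, ~ U x -> ~ K x by move=> x nU /KU.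
pose P t x : 'M[R]_n := if pselect (U x) then Psi p v (clamp t * h x) (clamp t *: grad h x) x else p x.
have PU t x : U x -> P t x = Psi p v (clamp t * h x) (clamp t *: grad h x) x.
  by rewrite /P; case: pselect.
have PK t x : ~ K x -> P t x = p x.
  move=> nK; have [Ux|nU] := pselect (U x); last by rewrite /P; case: pselect.
  by rewrite PU// h0// g0// mulr0 scaler0 Psi0.
have hU W : sm W h by move=> k; exact: (Ck_subset (fun x _ => I) (hs k)).
have shs t : sm U (fun x => clamp t * h x).
  by move=> k; apply: CkM; [exact: oU|exact: Ck_cst|exact: hU].
have sgs t : smooth_on U (fun x => clamp t *: grad h x).
  apply: smooth_onZ; [exact: oU|by move=> k; exact: Ck_cst|].
  exact: (smooth_on_grad oU (hU U)).
have sPsi t : smooth_on U (fun x => Psi p v (clamp t * h x) (clamp t *: grad h x) x).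
  apply: (smooth_on_Psi oU oU oO (@smooth_on_id _ _ U) (shs t) (sgs t) vs ps).
  - by [].
  - by move=> x Ux; have [] := HU _ _ (clamp_itv t) Ux.
  - by move=> x Ux; have [] := HU _ _ (clamp_itv t) Ux.
have oOK : open (cimg c `&` ~` K) by exact: openI.
have sP t : smooth_on (cimg c) (P t).
  move=> i j k; apply: Ck_local => x cx; have [Ux|nU] := pselect (U x).
    exists U; split; [exact: oU|exact: Ux|].
    by apply: (Ck_eq oU _ (sPsi t i j k)) => y Uy; rewrite PU.
  exists (cimg c `&` ~` K); split; [exact: oOK|by split => //; exact: KUn|].
  apply: (Ck_eq oOK (f := fun y => p y i j)).
    by move=> y [_ nK]; rewrite PK.
  exact: (Ck_subset (@subIsetl _ _ _) (ps i j k)).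
have dP t x : cimg c x -> dec (P t x) /\ P t x != 0.
  move=> cx; have [Ux|nU] := pselect (U x); last by rewrite PK; [exact: prk|exact: KUn].
  have [s1 _ s3] := HU _ _ (clamp_itv t) Ux.
  by rewrite PU//; split => //; apply: Psi_dec; exact: pd.
have cP t x : cimg c x -> {for (t, x), continuous (fun z : R * 'rV[R]_n => P z.1 z.2)}.
  move=> cx; have [Ux|nU] := pselect (U x).
    apply: (@near_eq_continuous _ _ (fun z : R * 'rV[R]_n =>
       Psi p v (clamp z.1 * h z.2) (clamp z.1 *: grad h z.2) z.2)).
      have e : \forall z \near (t, x), U z.2.
        exact: (@cont_snd R 'rV[R]_n (t, x) _ (open_nbhs_nbhs (conj oU Ux))).
      by apply: (filterS _ e) => z Uz; rewrite PU.
    have sc : {for (t, x), continuous (fun z : R * 'rV[R]_n => clamp z.1)}.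
      exact: (@continuous_comp _ _ _ fst clamp (t, x) (@cont_fst R 'rV[R]_n _) (@clamp_continuous t)).
    have hc : {for (t, x), continuous (fun z : R * 'rV[R]_n => h z.2)}.
      have hx : {for x, continuous h} by exact: (sm_continuous hs I).
      exact: (@continuous_comp _ _ _ snd h (t, x) (@cont_snd R 'rV[R]_n _) hx).
    have gc : {for (t, x), continuous (fun z : R * 'rV[R]_n => grad h z.2)}.
      have gx : {for x, continuous (grad h)}.
        exact: (smooth_on_continuous (smooth_on_grad openT hs) I).
      exact: (@continuous_comp _ _ _ snd (grad h) (t, x) (@cont_snd R 'rV[R]_n _) gx).
    have xc : {for (t, x), continuous (@snd R 'rV[R]_n)} by exact: cont_snd.
    have [s1 s2 _] := HU _ _ (clamp_itv t) Ux.
    exact: (@Psi_continuous _ _ (t, x) _ U (cimg c) p v snd _ oU vs xc (continuousM sc hc) Ux _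
      oO ps (scalemx_continuous sc gc) s1 s2).
  apply: (@near_eq_continuous _ _ (fun z : R * 'rV[R]_n => p z.2)).
    have e : \forall z \near (t, x), ~ K z.2.
      exact: (@cont_snd R 'rV[R]_n (t, x) _ (open_nbhs_nbhs (conj oKC (KUn _ nU)))).
    by apply: (filterS _ e) => z nK; rewrite PK.
  exact: (@continuous_comp _ _ _ snd p (t, x) (@cont_snd R 'rV[R]_n _) (smooth_on_continuous ps cx)).
have P0 x : cimg c x -> P 0 x = local_comp pi c x.
  move=> cx; have [Ux|nU] := pselect (U x); last by rewrite PK; [|exact: KUn].
  by rewrite PU// clamp0 mul0r scale0r Psi0.
have [pi' [iso E]] := homotopic_chart fp rp cK (fun x Kx => Uc _ (KU _ Kx)) sP dP (fun t x _ => @PK t x) cP P0.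
have EU x : U x -> local_comp pi' c x = Psi p v (h x) (grad h x) x.
  by move=> Ux; rewrite E; [rewrite PU// clamp1 mul1r scale1r|exact: Uc].
exists pi'; split => // x Ux po.
have cx := Uc _ Ux.
have H1 y : U y -> cimg c (y + h y *: v y) /\ Amat v (h y) y \in unitmx.
  by move=> Uy; have [] := HU 1 y _ Uy; rewrite ?ler01 ?lexx// mul1r.
apply: (@poisson_at_chart _ _ _ _ c); [exact: (homotopic_field iso)|exact: param_dom|].
move=> i j k; rewrite paramK//.
rewrite (sch_eq i j k oU Ux EU).
apply: (sch_Psi oU oO vs ps pd (hU U)) => //.
- by move=> y /H1[].
- by move=> y /H1[].
- have [cs _] := H1 _ Ux.
  by move=> a b d; have := po c (param_dom cs) a b d; rewrite paramK.
Qed.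

End PullOnManifold.

Lemma nbhs0_pos (R : realType) (P : set R) : nbhs (0 : R) P -> exists e, 0 < e /\ P e.
Proof.
move=> /nbhs_ballP[d /= d0 dP]; exists (d / 2); split; first by rewrite divr_gt0.
apply: dP; rewrite /ball/= sub0r normrN ger0_norm ?divr_ge0 ?ltW//.
by rewrite ltr_pdivrMr// ltr_pMr// ltr1n.
Qed.

Lemma near_lt_nat (T : Type) (F : set_system T) (FF : Filter F) (P : nat -> T -> Prop) N :
  (forall i, (i < N)%N -> \forall x \near F, P i x) ->
  \forall x \near F, forall i, (i < N)%N -> P i x.
Proof.
elim: N => [|N IH] H; first by apply: (@filterS _ F _ setT) => //; exact: filterT.
have H1 := IH (fun i h => H i (ltnW h)); have H2 := H N (ltnSn N).
apply: (@filterS2 _ F _ _ _ _ _ H1 H2) => x h1 h2 i.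
by rewrite ltnS leq_eqVlt => /predU1P[->//|]; exact: h1.
Qed.

(** * Making a field Poisson near a piece of hyperplane *)

Section FaceNear.
Variables (R : realType) (n : nat).
Variables (O : set 'rV[R]_n) (p : 'rV[R]_n -> 'M[R]_n) (l : 'cV[R]_n) (c0 : R).
Variable chi : 'rV[R]_n -> R.
Hypotheses (oO : open O) (ps : smooth_on O p) (pd : forall x, O x -> dec (p x)).
Hypothesis chis : sm setT chi.

(** Compactness of K makes the bound on e in [face_close] uniform. [Rel] restricts the value of the
    field together with its base point, so that open conditions in the bundle can be used. *)
Lemma face_near (K : set 'rV[R]_n) (Rel : set ('rV[R]_n * 'M[R]_n)) (N : set 'rV[R]_n) :
  compact K -> K `<=` Og O p l -> (forall x, K x -> nbhs (x, p x) Rel) ->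
  (forall x, K x -> nbhs x N) ->
  \forall e \near (0 : R), e != 0 -> forall x s, K x -> 0 <= s <= 1 ->
    [/\ Rel (x, Psi p (face_field p l) (s * face_height l c0 chi e x) (s *: grad (face_height l c0 chi e) x) x),
        N (x + (s * face_height l c0 chi e x) *: face_field p l x) &
        Amat (face_field p l) (s * face_height l c0 chi e x) x \in unitmx].
Proof.
move=> cK KO HR HN.
pose P (e : R) x := forall s, e != 0 -> 0 <= s <= 1 ->
    [/\ Rel (x, Psi p (face_field p l) (s * face_height l c0 chi e x) (s *: grad (face_height l c0 chi e) x) x),
        N (x + (s * face_height l c0 chi e x) *: face_field p l x) &
        Amat (face_field p l) (s * face_height l c0 chi e x) x \in unitmx].
have /compact_near_coveringP/(_ _ (nbhs (0 : R)) P _) H := cK.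
suff {H} H' : forall x, K x -> \forall x' \near x & e \near nbhs (0 : R), P e x'.
  by apply: filterS (H H') => e Pe e0 x s Kx s01; exact: Pe.
move=> x1 Kx1; have [[A W] /= [xA xW] AW] := HR _ Kx1.
have [[B D] /= [xB xD] BD] := face_close oO ps pd chis (KO _ Kx1) xW (HN _ Kx1).
exists (A `&` B, D); first by split => //=; exact: filterI.
move=> [x e] /= [[Ax Bx] De] s e0 s01.
have [t [ht hE gE]] := face_height_param l c0 chis x e0.
rewrite hE gE; have [h1 h2 h3] := BD (x, e) (conj Bx De) s t s01 ht.
by split => //; apply: AW; split.
Qed.

End FaceNear.

Lemma open_mx_neq0 (R : realType) m n : open [set w : 'M[R]_(m, n) | w != 0].
Proof.
rewrite (_ : [set w : 'M[R]_(m, n) | w != 0] = ~` [set 0]).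
  by apply: closed_openC; apply: accessible_closed_set1; apply: hausdorff_accessible; exact: norm_hausdorff.
by apply/seteqP; split => w /eqP.
Qed.

Section FaceMove.
Variables (R : realType) (n : nat) (M : manifold R n).
Local Opaque partial.

(** Translates open sets of bivectors into open sets of pairs (x, w). Antisymmetrizing w defines the
    map on all matrices, so that its continuity can be stated in the full matrix space. *)
Lemma biv_of (c : chart M) (pi : M -> bivector M) : (forall p, base (pi p) = p) ->
  exists mk : 'rV[R]_n * 'M[R]_n -> bivector M,
   (forall x w, cimg c x -> {for (x, w), continuous mk}) /\
   forall x b, cimg c x -> base b = param c x -> mk (x, components b c) = b.
Proof.
move=> bp.
have /choice[mk mkP] : forall z : 'rV[R]_n * 'M[R]_n, exists b : bivector M,
    cimg c z.1 -> base b = param c z.1 /\ components b c = 2^-1 *: (z.2 - z.2^T).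
  move=> z; have [cz|ncz] := pselect (cimg c z.1); last by exists (pi (param c z.1)).
  have az : (2^-1 *: (z.2 - z.2^T))^T = - (2^-1 *: (z.2 - z.2^T)).
    by apply/matrixP => i j; rewrite !mxE; lra.
  by have [b [bb bc]] := biv_ex (param_dom cz) az; exists b.
exists mk; split; last first.
  move=> x b cx bb; have [e1 e2] := mkP (x, components b c) cx.
  apply: (@biv_eq _ _ _ _ _ c); rewrite ?e1//; first exact: param_dom.
  rewrite e2 comp_anti/=; apply/matrixP => i j; rewrite !mxE; lra.
move=> x w cx.
have e : \forall z \near (x, w), cimg c z.1.
  exact: (@cont_fst 'rV[R]_n 'M[R]_n (x, w) _ (open_nbhs_nbhs (conj (@coord_open _ _ M c) cx))).
have wc : {for (x, w), continuous (@snd 'rV[R]_n 'M[R]_n)} by exact: cont_snd.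
apply: (@biv_cont _ _ _ _ mk (x, w) c).
- apply: (@near_eq_continuous _ _ (fun z : 'rV[R]_n * 'M[R]_n => param c z.1)).
    by apply: (filterS _ e) => z cz; rewrite (mkP z cz).1.
  exact: (@continuous_comp _ _ _ fst (param c) (x, w) (@cont_fst 'rV[R]_n 'M[R]_n _) (param_cont cx)).
- by rewrite (mkP (x, w) cx).1; exact: param_dom.
- apply: (@near_eq_continuous _ _ (fun z : 'rV[R]_n * 'M[R]_n => 2^-1 *: (z.2 - z.2^T))).
    by apply: (filterS _ e) => z cz; rewrite (mkP z cz).2.
  apply: (scalemx_continuous _ (submx_continuous wc (trmx_continuous wc))).
  exact: cvg_cst.
Qed.

Lemma compact_coord_part (c : chart M) (K : set 'rV[R]_n) (Z : set M) :
  compact K -> K `<=` cimg c -> compact Z ->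
  compact (coord c @` (Z `&` param c @` K)) /\
  (forall x, (coord c @` (Z `&` param c @` K)) x <-> K x /\ Z (param c x)).
Proof.
move=> cK Kc cZ; have cpK := compact_param_image cK Kc.
have clpK : closed (param c @` K) by apply: compact_closed => //; exact: points_hausdorff.
split; last first.
  move=> x; split=> [[q [Zq [y Ky yq]] <-]|[Kx Zx]].
    by rewrite -yq paramK ?yq//; exact: Kc.
  by exists (param c x); [split => //; exists x|rewrite paramK//; exact: Kc].
apply: continuous_compact; last exact: compact_closedI.
apply: continuous_in_subspaceT => q; rewrite inE => -[_ [x Kx <-]].
by apply: coord_cont; apply: param_dom; exact: Kc.
Qed.

(* The pull has height of order e, but its gradient does not tend to 0 with e;
   the moved field still tends to pi because v is chosen tangent to pi with
   l(v) = 1, so that Psi does not feel the component of the gradient along l. *)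
Lemma face_move (c : chart M) l (c0 : R) chi (K F G : set 'rV[R]_n) (Z : set M) N
    (C : nat -> set M) (Ob : nat -> set (bivector M)) (pi : M -> bivector M) :
  bivector_field pi -> (forall p, rank2 (pi p)) -> sm setT chi ->
  compact K -> K `<=` cimg c -> (forall x, K x -> lrow l (local_comp pi c x) != 0) ->
  (forall x, ~ K x -> chi x = 0) -> open G -> (forall x, G x -> chi x = 1) ->
  F `<=` G -> (forall x, F x -> (x *m l) 0 0 = c0) ->
  compact Z -> Z `<=` poisson_interior pi ->
  (forall i, (i < N)%N -> [/\ compact (C i), open (Ob i) & forall p, C i p -> Ob i (pi p)]) ->
  exists pi', [/\ homotopic pi pi' (param c @` K), param c @` F `<=` poisson_interior pi', Z `<=` poisson_interior pi' &
    forall i, (i < N)%N -> forall p, C i p -> Ob i (pi' p)].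
Proof.
move=> fp rp chis cK Kc Kl chi0 oG chi1 FG Fl cZ Zp HC; have [bp _] := fp.
set p := local_comp pi c.
have oO : open (cimg c) by exact: coord_open.
have ps : smooth_on (cimg c) p by exact: comp_smooth.
have prk x : cimg c x -> dec (p x) /\ p x != 0.
  by move=> cx; apply: rp; rewrite bp; exact: param_dom.
have pd x : cimg c x -> dec (p x) by move=> /prk[].
have oOg := open_Og oO ps (l := l).
have KOg : K `<=` Og (cimg c) p l by move=> x Kx; apply/OgP; split; [exact: Kc|exact: Kl].
have GK : G `<=` K.
  by move=> x Gx; apply: contrapT => /chi0; rewrite chi1// => /eqP; rewrite oner_eq0.
pose h e := face_height l c0 chi e; pose v := face_field p l.
(* Three bounds on e: the fields of the homotopy stay nonzero, points of Z are displaced within the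
   Poisson region, and the field stays in [Ob i] over [C i]. *)
have near1 : \forall e \near (0 : R), e != 0 -> forall x s, K x -> 0 <= s <= 1 ->
    [/\ [set z : 'rV[R]_n * 'M[R]_n | z.2 != 0] (x, Psi p v (s * h e x) (s *: grad (h e) x) x),
        cimg c (x + (s * h e x) *: v x) & Amat v (s * h e x) x \in unitmx].
  apply: (face_near c0 oO ps pd chis cK KOg) => x Kx.
    have on : open ([set: 'rV[R]_n * 'M[R]_n] `&` snd @^-1` [set w : 'M[R]_n | w != 0]).
      by apply: (open_preim openT); [move=> z _; exact: cont_snd|exact: open_mx_neq0].
    have := open_nbhs_nbhs (conj on (conj I (prk x (Kc _ Kx)).2 : _ (x, p x))).
    by apply: filterS => z [].
  by apply: open_nbhs_nbhs; split => //; exact: Kc.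
have [cKZ KZP] := compact_coord_part cK Kc cZ.
pose NZ := cimg c `&` param c @^-1` poisson_interior pi.
have oNZ : open NZ by apply: open_preim => //; [exact: param_cont|exact: open_poisson_interior].
have near2 : \forall e \near (0 : R), e != 0 -> forall x s, (coord c @` (Z `&` param c @` K)) x -> 0 <= s <= 1 ->
    [/\ [set: 'rV[R]_n * 'M[R]_n] (x, Psi p v (s * h e x) (s *: grad (h e) x) x),
        NZ (x + (s * h e x) *: v x) & Amat v (s * h e x) x \in unitmx].
  apply: (face_near c0 oO ps pd chis cKZ).
  - by move=> x /KZP[/KOg].
  - by move=> x _; exact: filterT.
  - move=> x /KZP[Kx Zx]; apply: open_nbhs_nbhs; split => //; split; first exact: Kc.
    exact: Zp.
have [mk [mkc mkE]] := biv_of c bp.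
pose Q3 i (e : R) := e != 0 -> forall x s, (coord c @` (C i `&` param c @` K)) x -> 0 <= s <= 1 ->
    [/\ (mk @^-1` Ob i) (x, Psi p v (s * h e x) (s *: grad (h e) x) x),
        setT (x + (s * h e x) *: v x) & Amat v (s * h e x) x \in unitmx].
have near3 : \forall e \near (0 : R), forall i, (i < N)%N -> Q3 i e.
  apply: (@near_lt_nat R (nbhs (0 : R)) _ Q3) => i iN; have [cC oOb COb] := HC i iN.
  have [cKC KCP] := compact_coord_part cK Kc cC.
  apply: (@face_near _ _ (cimg c) p l c0 chi oO ps pd chis _ (mk @^-1` Ob i) setT cKC).
  - by move=> x /KCP[/KOg].
  - move=> x /KCP[Kx Cx]; have cx := Kc _ Kx.
    apply: (mkc x (p x) cx); rewrite mkE//; first by apply: open_nbhs_nbhs; split => //; exact: COb.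
  - by move=> x _; exact: filterT.
have [e [e_gt0 [[P1 P2] P3]]] := nbhs0_pos (filterI (filterI near1 near2) near3).
have e0 : e != 0 by rewrite gt_eqF.
have sh : sm setT (h e) by exact: sm_face_height.
have h0 x : ~ K x -> h e x = 0 by move=> /chi0; rewrite /h /face_height => ->; rewrite mul0r.
have vs : smooth_on (Og (cimg c) p l) v by exact: smooth_face_field.
have [pi' [iso E po]] := homotopic_pull fp rp cK KOg oOg (@OgO _ _ _ _ _) vs sh h0
   (fun s x s01 Kx => let: And3 a b d := P1 e0 x s Kx s01 in And3 b d a).
have one01 : 0 <= (1 : R) <= 1 by rewrite ler01 lexx.
have fp' := homotopic_field iso; have [bp' _] := fp'.
exists pi'; split => //.
(* On U the cutoff is 1 and |u| < e, so U is collapsed into the hyperplane and [sch_Psi_flat]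
   applies. *)
- pose U := Og (cimg c) p l `&` G `&` (fun x => `|face_coord l c0 x / e|) @^-1` [set s | s < 1].
  have oU : open U.
    apply: (open_preim (openI oOg oG)); last exact: open_lt.
    move=> x _; have fc : {for x, continuous (fun y => face_coord l c0 y / e)}.
      apply: continuousM; last exact: cst_continuous.
      exact: (sm_continuous (sm_face_coord l c0 openT) I).
    exact: (@continuous_comp _ _ _ (fun y => face_coord l c0 y / e) (fun s : R => `|s|) x fc (@norm_continuous _ R _)).
  have UOg : U `<=` Og (cimg c) p l by move=> x [[]].
  have UK : U `<=` K by move=> x [[_ /GK]].
  have UO : U `<=` cimg c by move=> x /UOg/OgO.
  have FU : F `<=` U.
    move=> x Fx; have Gx := FG _ Fx; split; first by split => //; apply: KOg; exact: GK.
    by rewrite /= /face_coord Fl// subrr mul0r normr0.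
  suff Up : param c @` U `<=` poisson_interior pi' by move=> _ [x Fx <-]; apply: Up; exists x => //; exact: FU.
  apply: poisson_interior_open; first exact: open_param_image.
  move=> _ [x Ux <-]; apply: (@poisson_at_chart _ _ _ _ c) => //; first by apply: param_dom; exact: UO.
  move=> i j k; rewrite paramK; last exact: UO.
  have E' y : U y -> local_comp pi' c y = Psi p v (h e y) (grad (h e) y) y by move=> /UOg/E.
  rewrite (sch_eq i j k oU Ux E').
  apply: (@sch_Psi_flat _ _ U (cimg c) v p (h e) l c0) => //.
  + exact: (smooth_on_subset UOg vs).
  + by move=> k'; exact: (Ck_subset (fun _ _ => I) (sh k')).
  + by move=> y /UK Ky; have [_ +  _] := P1 e0 y 1 Ky one01; rewrite mul1r.
  + by move=> y /UK Ky; have [_ _] := P1 e0 y 1 Ky one01; rewrite mul1r.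
  + by move=> y /UOg/OgP[cy ly]; have [] := lvecP (pd y cy) ly.
  + move=> y [[_ Gy] /= yl]; rewrite /h /face_height chi1// mul1r sig_mid; last exact: ltW.
    by rewrite mulrN mulrCA divff// mulr1 /face_coord opprB.
- move=> q Zq; have [[x Kx xq]|nq] := pselect ((param c @` K) q); last first.
    apply: (@poisson_interior_near _ _ _ pi pi' (~` (param c @` K))).
    + exact: open_param_compl.
    + by move=> q' nq'; exact: (homotopic_off iso nq').
    + by split => //; exact: Zp.
  have Zx : (coord c @` (Z `&` param c @` K)) x by apply/KZP; rewrite xq.
  have [_] := P2 e0 x 1 Zx one01; rewrite mul1r => NZx _.
  pose U := Og (cimg c) p l `&` (fun y => y + h e y *: v y) @^-1` NZ.
  have oU : open U.
    apply: (open_preim oOg); last exact: oNZ.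
    move=> y Oy.
    have box_coord : {for y, continuous (fun z : 'rV[R]_n => z)} by exact: cvg_id.
    exact: (@shift_continuous _ _ y _ _ v (fun z => z) (h e) vs box_coord (sm_continuous sh I) Oy).
  have Up : param c @` U `<=` poisson_interior pi'.
    apply: poisson_interior_open; first by apply: open_param_image => // y [/OgO].
    by move=> _ [y [Oy [_ Zy]] <-]; apply: po => //; exact: poisson_interior_sub.
  by rewrite -xq; apply: Up; exists x => //; split => //; exact: KOg.
- move=> i iN q Cq; have [cC oOb COb] := HC i iN.
  have [[x Kx xq]|nq] := pselect ((param c @` K) q); last first.
    by rewrite (homotopic_off iso nq); exact: COb.
  have [cKC KCP] := compact_coord_part cK Kc cC.
  have Cx : (coord c @` (C i `&` param c @` K)) x by apply/KCP; rewrite xq.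
  have [+ _ _] := P3 i iN e0 x 1 Cx one01.
  rewrite mul1r scale1r -E; last exact: KOg.
  by rewrite /= /local_comp xq mkE// ?bp'//; exact: Kc.
Qed.

End FaceMove.

Section FlatBounds.
Variable R : realType.

Lemma flat_le_id (t : R) : 0 <= t -> flat t <= t.
Proof.
rewrite le_eqVlt => /predU1P[<-|t0]; first by rewrite flat0.
rewrite /flat /expinv t0 expr0 mul1r expRN.
have H : 1 + t^-1 <= expR t^-1 by exact: expR_ge1Dx.
have t1 : 0 < t^-1 by rewrite invr_gt0.
rewrite -[leRHS]invrK lef_pV2 ?posrE ?expR_gt0//.
by apply: le_trans H; rewrite lerDr ler01.
Qed.

Lemma flat_mono (s t : R) : s <= t -> flat s <= flat t.
Proof.
move=> st; have [s0|s0] := leP s 0; first by rewrite flat0// flat_ge0.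
have t0 := lt_le_trans s0 st.
by rewrite /flat /expinv s0 t0 !expr0 !mul1r ler_expR lerN2 lef_pV2 ?posrE.
Qed.

End FlatBounds.

(** * Cubes *)

Section Boxes.
Variables (R : realType) (n : nat) (M : manifold R n).

(* Cubes are described in the affine coordinates (x - bx) bL of the chart bc. *)
Record box := Box { bc : chart M; bx : 'rV[R]_n; bL : 'M[R]_n; bLu : bL \in unitmx }.

Implicit Types (b : box) (x p : 'rV[R]_n).

Definition box_coord b x : 'rV[R]_n := (x - bx b) *m bL b.

Lemma box_coordK b x : bx b + box_coord b x *m invmx (bL b) = x.
Proof. by rewrite /box_coord mulmxK ?bLu// addrC subrK. Qed.

Lemma box_coord_of b (w : 'rV[R]_n) : box_coord b (bx b + w *m invmx (bL b)) = w.
Proof. by rewrite /box_coord addrC addKr mulmxKV ?bLu. Qed.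

Lemma box_coord_ray b x p (h : R) : box_coord b (x + h *: (x - p)) = box_coord b x + h *: (box_coord b x - box_coord b p).
Proof.
rewrite /box_coord -mulmxBl opprB addrA subrK scalemxAl -mulmxDl; congr (_ *m _).
by rewrite addrAC.
Qed.

Lemma box_coord_rayE b x p (h : R) k :
  box_coord b (x + h *: (x - p)) 0 k = box_coord b x 0 k + h * (box_coord b x 0 k - box_coord b p 0 k).
Proof. by rewrite box_coord_ray !mxE. Qed.

Lemma box_coord_continuous b : continuous (box_coord b).
Proof.
move=> x; have xc : {for x, continuous (fun y : 'rV[R]_n => y)} by exact: cvg_id.
have bc' : {for x, continuous (fun _ : 'rV[R]_n => bx b)} by exact: cst_continuous.
have lc' : {for x, continuous (fun _ : 'rV[R]_n => bL b)} by exact: cst_continuous.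
exact: (mulmx_continuous (submx_continuous xc bc') lc').
Qed.

Lemma box_coord_entry_continuous b k : continuous (fun x => box_coord b x 0 k).
Proof. by move=> x; apply: entry_continuous; exact: box_coord_continuous. Qed.

Definition ocube b (r : R) := [set x | forall k, `|box_coord b x 0 k| < r].
Definition ccube b (r : R) := [set x | forall k, `|box_coord b x 0 k| <= r].
Definition wall b := [set x | ccube b 1 x /\ exists k, `|box_coord b x 0 k| = 1].

Lemma open_ocube b r : open (ocube b r).
Proof.
rewrite openE => x Hx.
apply: (@filter_forall _ _ (fun k z => `|box_coord b z 0 k| < r) (nbhs x)) => k.
have fc : {for x, continuous (fun y => `|box_coord b y 0 k|)}.
  exact: (@continuous_comp _ _ _ (fun y => box_coord b y 0 k) (fun s : R => `|s|) x
    (@box_coord_entry_continuous b k x) (@norm_continuous _ R _)).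
exact: (fc _ (open_nbhs_nbhs (conj (@open_lt R r) (Hx k)))).
Qed.

Lemma compact_ccube b r : compact (ccube b r).
Proof.
pose C := [set w : 'rV[R]_n | forall k, `[- r, r]%classic (w ord0 k)].
have cC : compact C by apply: (@rV_compact R n (fun=> `[- r, r]%classic)) => k; exact: segment_compact.
rewrite (_ : ccube b r = (fun w => bx b + w *m invmx (bL b)) @` C); last first.
  apply/seteqP; split=> [x Hx|_ [w Hw <-] k].
    by exists (box_coord b x); [move=> k; rewrite /= in_itv/= -ler_norml; exact: Hx|rewrite box_coordK].
  by rewrite box_coord_of ler_norml; have := Hw k; rewrite /= in_itv.
apply: continuous_compact => //; apply: continuous_subspaceT => w.
have wc : {for w, continuous (fun y : 'rV[R]_n => y)} by exact: cvg_id.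
have bc' : {for w, continuous (fun _ : 'rV[R]_n => bx b)} by exact: cst_continuous.
have lc' : {for w, continuous (fun _ : 'rV[R]_n => invmx (bL b))} by exact: cst_continuous.
exact: (addmx_continuous bc' (mulmx_continuous wc lc')).
Qed.

Lemma ccube_sub b r s : r <= s -> ccube b r `<=` ccube b s.
Proof. by move=> rs x Hx k; exact: (le_trans (Hx k)). Qed.

Lemma ocube_ccube b r : ocube b r `<=` ccube b r.
Proof. by move=> x Hx k; exact: ltW. Qed.

Lemma ccube1 b x : ccube b 1 x -> ocube b 1 x \/ wall b x.
Proof.
move=> Hx; have [[k wk]|nk] := pselect (exists k, `|box_coord b x 0 k| = 1).
  by right; split => //; exists k.
left=> k; rewrite lt_neqAle Hx andbT; apply/eqP => e; apply: nk; by exists k.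
Qed.

Lemma compact_wall b : compact (wall b).
Proof.
have -> : wall b = ccube b 1 `&` ~` ocube b 1.
  apply/seteqP; split => x [Hx].
    by move=> [k yk]; split => // /(_ k); rewrite yk ltxx.
  by move=> nx; case: (ccube1 Hx).
apply: compact_closedI; first exact: compact_ccube.
by apply: open_closedC; exact: open_ocube.
Qed.

Lemma small_ocube b p (V : set 'rV[R]_n) : nbhs p V ->
  exists r, 0 < r /\ forall x, (forall k, `|box_coord b x 0 k - box_coord b p 0 k| < r) -> V x.
Proof.
move=> pV.
have fc : {for (box_coord b p), continuous (fun w : 'rV[R]_n => bx b + w *m invmx (bL b))}.
  have wc : {for (box_coord b p), continuous (fun y : 'rV[R]_n => y)} by exact: cvg_id.
  have bc' : {for (box_coord b p), continuous (fun _ : 'rV[R]_n => bx b)} by exact: cst_continuous.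
  have lc' : {for (box_coord b p), continuous (fun _ : 'rV[R]_n => invmx (bL b))} by exact: cst_continuous.
  exact: (addmx_continuous bc' (mulmx_continuous wc lc')).
have : nbhs (box_coord b p) ((fun w : 'rV[R]_n => bx b + w *m invmx (bL b)) @^-1` V).
  by apply: fc; rewrite box_coordK.
move=> /nbhs_ballP[r /= r0 rV]; exists r; split => // x Hx.
rewrite -(box_coordK b x); apply: rV; split => // i j; rewrite (ord1 i).
by rewrite /ball/= distrC; exact: Hx.
Qed.

(* Vanishes off the open unit cube, positive on it, and so small near its
   boundary that a pull by [tau * cbump] preserves the cube. *)
Definition cbump b x : R := \prod_k flat (1 - box_coord b x 0 k ^+ 2).

Lemma bump_ge0 b x : 0 <= cbump b x.
Proof. by apply: prodr_ge0 => k _; exact: flat_ge0. Qed.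

Lemma bump_out b x k : 1 <= `|box_coord b x 0 k| -> cbump b x = 0.
Proof.
move=> h; rewrite /cbump (bigD1 k)//= flat0 ?mul0r// subr_le0.
by rewrite -real_normK ?num_real// exprn_ege1.
Qed.

Lemma bump_out_ocube b x : ~ ocube b 1 x -> cbump b x = 0.
Proof.
move=> nx; apply: contrapT => h; apply: nx => k; rewrite ltNge; apply/negP => /bump_out.
exact: h.
Qed.

Lemma flat_le1 (t : R) : t <= 1 -> flat t <= 1.
Proof. by move=> h; apply: (le_trans (flat_mono h)); exact: flat_le_id. Qed.

Lemma sqr_le1 (s : R) : 1 - s ^+ 2 <= 1.
Proof. by rewrite lerBlDr lerDl sqr_ge0. Qed.

Lemma bump_le b x k : `|box_coord b x 0 k| <= 1 -> cbump b x <= 1 - box_coord b x 0 k ^+ 2.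
Proof.
move=> h; rewrite /cbump (bigD1 k)//=.
have h1 : 0 <= 1 - box_coord b x 0 k ^+ 2 by rewrite subr_ge0 -real_normK ?num_real// exprn_ile1.
rewrite -[leRHS]mulr1; apply: ler_pM => //; first exact: flat_ge0.
- by apply: prodr_ge0 => j _; exact: flat_ge0.
- exact: flat_le_id.
- by apply: prodr_ile1 => j _; rewrite flat_ge0/= flat_le1// sqr_le1.
Qed.

Lemma bump_lower b (r : R) : 0 <= r < 1 -> exists be, 0 < be /\ forall x, ccube b r x -> be <= cbump b x.
Proof.
move=> /andP[r0 r1]; exists (\prod_(k < n) flat (1 - r ^+ 2)); split.
  by apply: prodr_gt0 => k _; rewrite flat_gt0// subr_gt0 exprn_ilt1.
move=> x Hx; apply: ler_prod => k _; rewrite flat_ge0/=; apply: flat_mono.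
by rewrite lerD2l lerN2 -[X in X <= _]real_normK ?num_real// lerXn2r ?nnegrE.
Qed.

Lemma sm_box_coord b k : sm setT (fun x => box_coord b x 0 k).
Proof.
have H : smooth_on setT (box_coord b).
  apply: smooth_onM; [exact: openT| |exact: smooth_on_cst].
  by apply: smooth_onB; [exact: openT|exact: smooth_on_id|exact: smooth_on_cst].
exact: H.
Qed.

Lemma sm_cbump b : sm setT (cbump b).
Proof.
move=> j; apply: Ck_prod => [|k _]; first exact: openT.
apply: sm_flat; first exact: openT.
move=> i; apply: CkB; [exact: openT|exact: Ck_cst|].
by apply: CkM; [exact: openT|exact: sm_box_coord|exact: sm_box_coord].
Qed.

Definition mcube b : set M := param (bc b) @` ocube b 1.
(** Radius 3 leaves room around the unit cube for the cutoff [ramp]; all modifications belonging to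
    b take place here. *)
Definition msupp b : set M := param (bc b) @` ccube b 3.
Definition mwall b : set M := param (bc b) @` wall b.

End Boxes.

(** * Contracting the singular set of one cube *)

Section Contraction.
Variables (R : realType) (n : nat) (M : manifold R n).
Local Opaque partial.
Variables (b : box M) (p : 'rV[R]_n).
Local Notation c := (bc b).
Hypotheses (bc1 : ccube b 1 `<=` cimg c) (p1 : ocube b 1 p).

Definition ct (s : R) x : 'rV[R]_n := x + (s * cbump b x) *: (x - p).

(** The displacement is at most 2 h <= (1 - y^2) / 4 <= (1 - |y|) / 2, half the distance to the
    wall; hence the constant 8. *)
Lemma ct_bound (y q h : R) : `|y| <= 1 -> `|q| <= 1 -> 0 <= h -> h * 8 <= 1 - y ^+ 2 ->
  `|y + h * (y - q)| <= (1 + `|y|) / 2.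
Proof.
rewrite ler_norml => /andP[y1 y2]; rewrite ler_norml => /andP[q1 q2] h0 h8.
have [y0|y0] := leP 0 y; first by rewrite (ger0_norm y0) ler_norml; apply/andP; split; nra.
by rewrite (ltr0_norm y0) ler_norml; apply/andP; split; nra.
Qed.

Lemma ct_bump s x k : 0 <= s <= 8^-1 -> `|box_coord b x 0 k| <= 1 ->
  `|box_coord b (ct s x) 0 k| <= (1 + `|box_coord b x 0 k|) / 2.
Proof.
move=> /andP[s0 s8] h; rewrite box_coord_rayE; apply: ct_bound => //.
- exact: ltW.
- by rewrite mulr_ge0// bump_ge0.
- have := bump_le h; have := bump_ge0 b x; move: (cbump b x) (box_coord b x 0 k) => B y B0 BB.
  rewrite mulrAC; apply: le_trans BB; rewrite -[leRHS]mul1r ler_wpM2r//.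
  by rewrite -ler_pdivlMr// div1r.
Qed.

Lemma ct_ocube s x : 0 <= s <= 8^-1 -> ocube b 1 x -> ocube b 1 (ct s x).
Proof.
by move=> hs Hx k; apply: (le_lt_trans (ct_bump hs (ltW (Hx k)))); have := Hx k; lra.
Qed.

Lemma ct_out s x : ~ ocube b 1 x -> ct s x = x.
Proof. by move=> /bump_out_ocube E; rewrite /ct E mulr0 scale0r addr0. Qed.

Lemma ct_cimg s x : 0 <= s <= 8^-1 -> cimg c x -> cimg c (ct s x).
Proof.
move=> hs cx; have [Hx|/ct_out ->//] := pselect (ocube b 1 x).
by apply: bc1; apply: ocube_ccube; exact: ct_ocube.
Qed.

(** For this step size D stays above 1/2 during the whole homotopy, as [contract_step] verifies. *)
Lemma tau_ex : exists tau : R, 0 < tau <= 8^-1 /\ forall x, ccube b 1 x ->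
  `|tau * ((x - p) *m (grad (cbump b) x)^T) 0 0| < 2^-1.
Proof.
pose f (x : 'rV[R]_n) : R := ((x - p) *m (grad (cbump b) x)^T) 0 0.
have fc x : {for x, continuous f}.
  have xc : {for x, continuous (fun y : 'rV[R]_n => y)} by exact: cvg_id.
  have pc : {for x, continuous (fun _ : 'rV[R]_n => p)} by exact: cst_continuous.
  have gc := smooth_on_continuous (smooth_on_grad openT (sm_cbump b)) (I : setT x).
  exact: entry_continuous (mulmx_continuous (submx_continuous xc pc) (trmx_continuous gc)).
pose P (t : R) x := `|t * f x| < 2^-1.
have /compact_near_coveringP/(_ _ (nbhs (0 : R)) P _) H := @compact_ccube _ _ _ b 1.
suff HH : \forall t \near (0 : R), forall x, ccube b 1 x -> P t x.
  have H8 : \forall t \near (0 : R), t <= 8^-1.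
    have h : nbhs (0 : R) [set t : R | t < 8^-1] by apply: open_nbhs_nbhs; split; [exact: open_lt|rewrite /= invr_gt0].
    by apply: (filterS _ h) => t /ltW.
  have [t [t0 [t1 t8]]] := nbhs0_pos (filterI HH H8).
  by exists t; rewrite t0 t8; split.
apply: H => x _.
have gc : {for (x, 0 : R), continuous (fun z : 'rV[R]_n * R => `|z.2 * f z.1|)}.
  have z2 : {for (x, 0 : R), continuous (@snd 'rV[R]_n R)} by exact: cont_snd.
  have z1 := @continuous_comp _ _ _ fst f (x, 0 : R) (@cont_fst 'rV[R]_n R _) (fc x).
  exact: (@continuous_comp _ _ _ _ (fun s : R => `|s|) _ (continuousM z2 z1) (@norm_continuous _ R _)).
have := gc _ (open_nbhs_nbhs (conj (@open_lt R 2^-1) _ )); rewrite /= mul0r normr0.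
by move=> /(_ (_ : 0 < 2^-1)); apply; rewrite invr_gt0.
Qed.

Lemma jacm_sub x : jacm (fun y : 'rV[R]_n => y - p) x = 1%:M.
Proof.
rewrite -(jacm_id x); apply/matrixP => i j; rewrite [LHS]mxE [RHS]mxE.
have -> : (fun y : 'rV[R]_n => (y - p) 0 j) = (fun y : 'rV[R]_n => y 0 j + (- p 0 j)).
  by apply/funext => y; rewrite !mxE.
rewrite (partialD (U := setT) i (Ck_coord_sm setT j) _ I).
  by rewrite partial_cst addr0.
by move=> k; exact: Ck_cst.
Qed.

(** The field v = x - p has derivative 1, so A is the scalar 1 + h. The bound on tau keeps D
    positive, and [Phi_rel] then forbids the pulled field to vanish. *)
Lemma contract_step tau (pi : M -> bivector M) :
  0 < tau <= 8^-1 -> (forall x, ccube b 1 x ->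
  `|tau * ((x - p) *m (grad (cbump b) x)^T) 0 0| < 2^-1) ->
  bivector_field pi -> (forall q, rank2 (pi q)) ->
  exists pi', homotopic pi pi' (param c @` ccube b 1) /\
   forall x, cimg c x -> poisson_interior pi (param c (ct tau x)) -> poisson_interior pi' (param c x).
Proof.
move=> /andP[t0 t8] tP fp rp; have [bp _] := fp.
have oO : open (cimg c) by exact: coord_open.
have cs U : sm U (fun _ : 'rV[R]_n => tau) by move=> k; exact: Ck_cst.
have hs : sm setT (fun x => tau * cbump b x).
  by move=> k; apply: CkM; [exact: openT|exact: Ck_cst|exact: sm_cbump].
have gE x : grad (fun x => tau * cbump b x) x = tau *: grad (cbump b) x.
  apply/rowP => i; rewrite [LHS]mxE [RHS]mxE (partialM i (cs setT) (sm_cbump b) I).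
  by rewrite partial_cst mulr0 addr0 [grad _ _ _ _]mxE.
have vs : smooth_on (cimg c) (fun x => x - p).
  by apply: smooth_onB; [exact: oO|exact: smooth_on_id|exact: smooth_on_cst].
have h0 x : ~ ccube b 1 x -> tau * cbump b x = 0.
  by move=> nx; rewrite bump_out_ocube ?mulr0// => /ocube_ccube.
have [||pi' [iso E po]] := @homotopic_pull _ _ _ c (ccube b 1) (cimg c) (fun x => x - p)
   (fun x => tau * cbump b x) pi fp rp (@compact_ccube _ _ _ b 1) bc1 oO _ vs hs h0 _.
- by [].
- move=> s x /andP[s0 s1] Hx.
  have st : 0 <= s * tau <= 8^-1.
    by rewrite mulr_ge0 ?(ltW t0)//=; apply: le_trans t8; rewrite ler_piMl// ltW.
  have B0 := bump_ge0 b x.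
  have h1 : 0 <= s * (tau * cbump b x) by rewrite mulrA mulr_ge0//; case/andP: st.
  have u1 : 1 + s * (tau * cbump b x) != 0 by rewrite gt_eqF// ltr_pwDl.
  have AE : Amat (fun x => x - p) (s * (tau * cbump b x)) x = (1 + s * (tau * cbump b x))%:M.
    by rewrite /Amat jacm_sub raddfD/= scale_scalar_mx mulr1.
  have Au : Amat (fun x => x - p) (s * (tau * cbump b x)) x \in unitmx.
    by rewrite AE unitmxE det_scalar unitrX// unitfE.
  have cx : cimg c (x + (s * (tau * cbump b x)) *: (x - p)).
    by rewrite mulrA; apply: (ct_cimg st); exact: bc1.
  split => //; apply/eqP => P0.
  have [dw w0] : dec (local_comp pi c (x + (s * (tau * cbump b x)) *: (x - p))) /\
     local_comp pi c (x + (s * (tau * cbump b x)) *: (x - p)) != 0.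
    by apply: rp; rewrite bp; exact: param_dom.
  move: P0; rewrite /Psi.
  set A := Amat _ _ _; set w := local_comp _ _ _ in dw w0 *.
  set T := (_^T *m w *m _) => P0.
  have T0 : T != 0 by rewrite /T; apply: congr_neq0 => //; rewrite unitmx_inv.
  have aT : T^T = - T by apply: dec_anti; exact: dec_congr.
  have := Phi_rel ((x - p) *m invmx A) (s *: grad (fun x => tau * cbump b x) x) aT.
  rewrite P0 mulmx0 mul0mx => /esym/eqP; rewrite scaler_eq0 (negbTE T0) orbF.
  rewrite /A AE invmx_scalar mul_mx_scalar gE.
  have -> : (s *: (tau *: grad (cbump b) x))^T = s *: (tau *: (grad (cbump b) x)^T).
    by rewrite [LHS]linearZ/= [X in s *: X]linearZ.
  rewrite -scalemxAl -!scalemxAr scalerA scalerA mxE.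
  have := tP x Hx; move: (((x - p) *m _) 0 0) => f.
  move: h1 u1; move: (s * (tau * cbump b x)) => h h1 u1; rewrite ltr_norml => /andP[f1 f2].
  have -> : (1 + h)^-1 * (s * tau) * f = (s / (1 + h)) * (tau * f) by field.
  have k1 : 0 <= s / (1 + h) <= 1.
    by rewrite divr_ge0 ?addr_ge0//= ler_pdivrMr ?ltr_pwDl// mul1r; lra.
  by case/andP: k1 => k0 k1 /eqP; move: (tau * f) (s / (1 + h)) f1 f2 k0 k1 => z k f1 f2 k0 k1 e; nra.
exists pi'; split => // x cx Zx.
pose NZ := cimg c `&` param c @^-1` poisson_interior pi.
have oNZ : open NZ by apply: open_preim => //; [exact: param_cont|exact: open_poisson_interior].
pose U := cimg c `&` ct tau @^-1` NZ.
have oU : open U.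
  apply: (open_preim oO); last exact: oNZ.
  move=> y cy; have yc' : {for y, continuous (fun z : 'rV[R]_n => z)} by exact: cvg_id.
  exact: (@shift_continuous _ _ y _ _ (fun x => x - p) (fun z => z) (fun x => tau * cbump b x) vs yc'
     (sm_continuous hs I) cy).
have Up : param c @` U `<=` poisson_interior pi'.
  apply: poisson_interior_open; first by apply: open_param_image => // y [].
  by move=> _ [y [cy [_ Zy]] <-]; apply: po => //; exact: poisson_interior_sub.
have st : 0 <= tau <= 8^-1 by rewrite (ltW t0) t8.
by apply: Up; exists x => //; split => //; split => //; exact: ct_cimg.
Qed.

Lemma contract_iter tau (pi : M -> bivector M) :
  0 < tau <= 8^-1 -> (forall x, ccube b 1 x ->
  `|tau * ((x - p) *m (grad (cbump b) x)^T) 0 0| < 2^-1) ->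
  bivector_field pi -> (forall q, rank2 (pi q)) -> forall k,
  exists pi', homotopic pi pi' (param c @` ccube b 1) /\
   forall x, cimg c x -> poisson_interior pi (param c (iter k (ct tau) x)) -> poisson_interior pi' (param c x).
Proof.
move=> t8 tP fp rp; elim=> [|k [pi1 [iso1 H1]]].
  by exists pi; split; [exact: homotopic_refl|].
have [pi' [iso H]] := contract_step t8 tP (homotopic_field iso1) (homotopic_rank2 iso1).
exists pi'; split; first by have := homotopic_trans iso1 iso; rewrite setUid.
move=> x cx; rewrite iterSr => Zx; apply: H => //; apply: H1 => //.
by apply: ct_cimg => //; case/andP: t8 => /ltW -> ->.
Qed.

(** The singular set is closed and misses the wall, so it lies in a smaller cube, where [cbump] has
    a positive lower bound and the expansion has a uniform rate. *)
Lemma sing_margin (pi : M -> bivector M) : mwall b `<=` poisson_interior pi ->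
  exists r : R, 0 <= r < 1 /\ ccube b r p /\
   forall x, ccube b 1 x -> ~ poisson_interior pi (param c x) -> ccube b r x.
Proof.
move=> wZ.
pose P (e : R) x := ~ poisson_interior pi (param c x) -> ccube b (1 - e) x.
have loc x : ocube b 1 x -> \forall x' \near x & e \near nbhs (0 : R), ccube b (1 - e) x'.
  move=> Hx.
  have fc k : {for (x, 0 : R), continuous (fun z : 'rV[R]_n * R => `|box_coord b z.1 0 k| + z.2)}.
    have z2 : {for (x, 0 : R), continuous (@snd 'rV[R]_n R)} by exact: cont_snd.
    have z1 := @continuous_comp _ _ _ fst (fun y => box_coord b y 0 k) (x, 0 : R) (@cont_fst 'rV[R]_n R _) (@box_coord_entry_continuous _ _ _ b k x).
    have z3 := @continuous_comp _ _ _ _ (fun s : R => `|s|) _ z1 (@norm_continuous _ R _).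
    exact: continuousD z3 z2.
  have x1 k : `|box_coord b x 0 k| + 0 < 1 by rewrite addr0; exact: Hx.
  have fk k : \forall z \near (x, 0 : R), `|box_coord b z.1 0 k| + z.2 < 1.
    exact: (fc k _ (open_nbhs_nbhs (conj (@open_lt R 1) (x1 k)))).
  have := @filter_forall _ _ (fun k z => `|box_coord b z.1 0 k| + z.2 < 1) (nbhs (x, 0 : R)) _ fk.
  move=> [[A B] HAB sub]; exists (A, B) => // -[x' e] AB k.
  by have /= := sub (x', e) AB k; lra.
have /compact_near_coveringP/(_ _ (nbhs (0 : R)) P _) H := @compact_ccube _ _ _ b 1.
have {}H : \forall t \near (0 : R), forall x, ccube b 1 x -> P t x.
  apply: H => x Hx.
  have [Zx|nZ] := pselect (poisson_interior pi (param c x)).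
    have h : \forall y \near x, poisson_interior pi (param c y).
      exact: (param_cont (bc1 Hx) (open_nbhs_nbhs (conj (@open_poisson_interior _ _ _ pi) Zx))).
    by exists ([set y | poisson_interior pi (param c y)], setT); [split => //; exact: filterT|case=> y e [/= Zy _] /(_ Zy)].
  have ox : ocube b 1 x by case: (ccube1 Hx) => // wx; exfalso; apply: nZ; apply: wZ; exists x.
  have [[A B] HAB sub] := loc x ox; exists (A, B) => // -[x' e] AB _.
  exact: (sub (x', e) AB).
have Hp : \forall e \near (0 : R), ccube b (1 - e) p.
  have [[A B] /= [xA xB] AB] := loc p p1.
  by apply: filterS xB => e Be; apply: (AB (p, e)); split => //; exact: nbhs_singleton.
have [e [e0 [H1 H2]]] := nbhs0_pos (filterI H Hp).
exists (Order.max 0 (1 - e)); split; first by rewrite le_max lexx gt_max ltr01/=; lra.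
have sub := @ccube_sub _ _ _ b _ _ (_ : 1 - e <= Order.max 0 (1 - e)).
split; first by apply: sub => //; rewrite le_max lexx orbT.
by move=> x Hx nZ; apply: sub; [rewrite le_max lexx orbT|exact: H1].
Qed.

(** The point x lies on the segment from p to its image, and cubes are convex. *)
Lemma back_step (r s : R) x : 0 <= s -> ccube b r p -> ccube b r (x + s *: (x - p)) -> ccube b r x.
Proof.
move=> s0 Hp Hx k; have := Hp k; have := Hx k; rewrite box_coord_rayE !ler_norml.
by move: (box_coord b x 0 k) (box_coord b p 0 k) => y q /andP[h1 h2] /andP[h3 h4]; apply/andP; split; nra.
Qed.

(** An orbit that ends in the cube of radius r has always been there, and each step in it multiplies
    the distance to p by at least 1 + tau be. *)
Lemma back_iter tau (r be : R) k x : 0 <= tau -> 0 <= be -> ccube b r p ->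
  (forall x, ccube b r x -> be <= cbump b x) -> ccube b r (iter k (ct tau) x) ->
  ccube b r x /\ forall i, `|box_coord b x 0 i - box_coord b p 0 i| * (1 + tau * be) ^+ k <=
                           `|box_coord b (iter k (ct tau) x) 0 i - box_coord b p 0 i|.
Proof.
move=> t0 be0 Hp Hb; elim: k x => [|k IH] x; first by move=> H; split=> // i; rewrite expr0 mulr1.
rewrite iterSr => /IH[H1 H2].
have Hx : ccube b r x.
  by apply: (back_step (s := tau * cbump b x)) => //; rewrite mulr_ge0// bump_ge0.
split=> // i; apply: le_trans (H2 i); rewrite exprS mulrA ler_wpM2r//.
  by rewrite exprn_ge0// addr_ge0// mulr_ge0.
rewrite box_coord_rayE; have B := Hb _ Hx.
have -> : box_coord b x 0 i + tau * cbump b x * (box_coord b x 0 i - box_coord b p 0 i) - box_coord b p 0 i =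
   (1 + tau * cbump b x) * (box_coord b x 0 i - box_coord b p 0 i) by ring.
rewrite normrM [X in _ <= X]mulrC ler_wpM2l// ger0_norm; first by rewrite lerD2l ler_wpM2l.
by rewrite addr_ge0// mulr_ge0// bump_ge0.
Qed.

Lemma bernoulli (a : R) k : 0 <= a -> k%:R * a <= (1 + a) ^+ k.
Proof.
move=> a0; suff : 1 + k%:R * a <= (1 + a) ^+ k by move=> h; apply: le_trans h; lra.
elim: k => [|k IH]; first by rewrite mul0r addr0 expr0.
rewrite exprS; have := mulr_ge0 (mulr_ge0 (ler0n R k) a0) a0.
have : (1 + a) * (1 + k%:R * a) <= (1 + a) * (1 + a) ^+ k by rewrite ler_wpM2l// addr_ge0.
rewrite -natr1; nra.
Qed.

(* The pull sends x to f^-1 of the singular set, so an expansion f contracts. *)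
Lemma box_contract (pi : M -> bivector M) (V : set M) :
  bivector_field pi -> (forall q, rank2 (pi q)) -> mwall b `<=` poisson_interior pi ->
  open V -> V (param c p) ->
  exists pi', [/\ homotopic pi pi' (param c @` ccube b 1),
    forall q, ~ mcube b q -> poisson_interior pi q -> poisson_interior pi' q &
    forall q, mcube b q -> ~ poisson_interior pi' q -> V q].
Proof.
move=> fp rp wZ oV Vp.
have [tau [t8 tP]] := tau_ex; have [t0 t1] := andP t8.
have t08 : 0 <= tau <= 8^-1 by rewrite (ltW t0) t1.
have [r [r01 [rp' rS]]] := sing_margin wZ.
have [be [be0 Hb]] := bump_lower b r01.
have pV : nbhs p (param c @^-1` V).
  by apply: (param_cont (bc1 (ocube_ccube p1))); exact: open_nbhs_nbhs.
have [rho [rho0 Hrho]] := small_ocube b pV.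
(* Two points of the unit cube differ by at most 2 in each coordinate. By [bernoulli], k steps would
   spread a distance rho beyond that. *)
pose k := Num.bound (2 / (rho * (tau * be))).
have kP : 2 < rho * (k%:R * (tau * be)).
  have := archi_boundP (_ : 0 <= 2 / (rho * (tau * be))); rewrite -/k => /(_ _).
  rewrite ltr_pdivrMr ?mulr_gt0// => h; rewrite mulrCA; apply: h.
  by rewrite divr_ge0// ?mulr_ge0// ltW// mulr_gt0.
have [pi' [iso H]] := contract_iter t8 tP fp rp k.
exists pi'; split => // q.
  move=> nq Zq; have [cq|ncq] := pselect (dom c q).
    have nx : ~ ocube b 1 (coord c q) by move=> oq; apply: nq; exists (coord c q) => //; rewrite coordK.
    have it j : iter j (ct tau) (coord c q) = coord c q by elim: j => // j IH; rewrite /= IH ct_out.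
    have := H (coord c q) (coord_cimg cq); rewrite it coordK//; exact.
  apply: (@poisson_interior_near _ _ _ pi pi' (~` (param c @` ccube b 1))).
  - by apply: open_param_compl => //; exact: compact_ccube.
  - by move=> q' nq'; exact: (homotopic_off iso nq').
  - by split => // -[x Hx xq]; apply: ncq; rewrite -xq; apply: param_dom; exact: bc1.
move=> [x ox <-] nZ.
have cx : cimg c x by apply: bc1; exact: ocube_ccube.
have oi j : ocube b 1 (iter j (ct tau) x) by elim: j => // j IH; rewrite /=; exact: ct_ocube.
have nZk : ~ poisson_interior pi (param c (iter k (ct tau) x)) by move=> Zk; apply: nZ; exact: H.
have [_ Hi] := back_iter (ltW t0) (ltW be0) rp' Hb (rS _ (ocube_ccube (oi k)) nZk).
apply: Hrho => i; rewrite ltNge; apply/negP => rhoa; have hi := Hi i.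
have hb := bernoulli k (mulr_ge0 (ltW t0) (ltW be0)).
have h5 : `|box_coord b (iter k (ct tau) x) 0 i - box_coord b p 0 i| <= 2.
  have := oi k i; have := p1 i; rewrite !ltr_norml ler_norml => /andP[h1 h2] /andP[h3 h4].
  by apply/andP; split; lra.
have := ler_pM (ltW rho0) (_ : 0 <= k%:R * (tau * be)) rhoa hb.
by move=> /(_ (mulr_ge0 (ler0n _ _) (mulr_ge0 (ltW t0) (ltW be0)))); lra.
Qed.

End Contraction.

(** Dependent choice carrying an invariant; it builds the infinite sequences of homotopies. *)
Lemma dependent_iter (T : Type) (Inv : nat -> T -> Prop) (Rl : nat -> T -> T -> Prop) x0 :
  Inv 0%N x0 -> (forall k x, Inv k x -> exists y, Rl k x y /\ Inv k.+1 y) ->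
  exists f : nat -> T, f 0%N = x0 /\ forall k, Rl k (f k) (f k.+1) /\ Inv k (f k).
Proof.
move=> I0 H.
have /choice[g gP] : forall z : nat * T, exists y, Inv z.1 z.2 -> Rl z.1 z.2 y /\ Inv z.1.+1 y.
  by move=> [k x]; have [/H[y hy]|n] := pselect (Inv k x); [exists y|exists x].
pose f := fix f k := if k is k'.+1 then g (k', f k') else x0.
have fI k : Inv k (f k) by elim: k => // k IH; exact: (gP (k, f k) IH).2.
by exists f; split => // k; split => //; exact: (gP (k, f k) (fI k)).1.
Qed.

(** * Cleaning the walls *)

Section Walls.
Variables (R : realType) (n : nat) (M : manifold R n).
Local Opaque partial.
Implicit Types (b : box M) (pi : M -> bivector M) (B : nat -> option (box M)).

(** Transversality of pi to all coordinate hyperplanes of b, on the whole support: the hypothesis of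
    [face_move] for each face. *)
Definition good pi b := forall x, ccube b 3 x -> forall k,
  lrow (col k (bL b)) (local_comp pi (bc b) x) != 0.

Definition oset (f : box M -> set M) (o : option (box M)) : set M :=
  if o is Some b then f b else set0.

Definition locally_finite B := forall p : M, exists N,
  \forall q \near p, forall j, (N <= j)%N -> ~ oset (@msupp _ _ _) (B j) q.

Lemma locally_finite_compact B (K : set M) : locally_finite B -> compact K ->
  exists N, forall q, K q -> forall j, (N <= j)%N -> ~ oset (@msupp _ _ _) (B j) q.
Proof.
move=> lf cK.
pose P (N : nat) q := forall j, (N <= j)%N -> ~ oset (@msupp _ _ _) (B j) q.
have /compact_near_coveringP/(_ _ (\oo) P _) H := cK.
have [|N _ HN] := H _.
  move=> p _; have [N HN] := lf p.
  exists ([set q | forall j, (N <= j)%N -> ~ oset (@msupp _ _ _) (B j) q], [set m | (N <= m)%N]).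
    by split => //; exists N.
  by move=> [q m] /= [Hq Nm] j mj; apply: Hq; exact: (leq_trans Nm).
by exists N; exact: (HN N (leqnn N)).
Qed.

Lemma poisson_interior_near_eq pi pi' q : (\forall q' \near q, pi' q' = pi q') -> poisson_interior pi q -> poisson_interior pi' q.
Proof.
move=> E Zq; apply: (@poisson_interior_near _ _ _ pi pi' [set q' | pi' q' = pi q']^°).
- exact: open_interior.
- by move=> q' /interior_subset.
- by split.
Qed.

Definition face b k (e : bool) := [set x | ccube b 1 x /\ box_coord b x 0 k = if e then 1 else -1].

Lemma compact_face b k e : compact (face b k e).
Proof.
rewrite (_ : face b k e = ccube b 1 `&` (fun x => box_coord b x 0 k) @^-1` [set if e then 1 else -1]); last first.
  by apply/seteqP; split => x [].
apply: compact_closedI; first exact: compact_ccube.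
apply: closed_comp; first by move=> x _; exact: box_coord_entry_continuous.
exact: closed_eq.
Qed.

(** The condition [good] as an open set of bivectors, the form in which [face_move] can preserve
    it. *)
Definition transverse b : set (bivector M) :=
  [set u | dom (bc b) (base u) /\ [set w | forall k, lrow (col k (bL b)) w != 0] (components u (bc b))].

Lemma open_transverse b : open (transverse b).
Proof.
apply: biv_open; [exact: dom_open|by []|].
rewrite openE => w Hw; apply: (@filter_forall _ _ (fun k z => lrow (col k (bL b)) z != 0) (nbhs w)) => k.
have lc : {for w, continuous (fun z => lrow (col k (bL b)) z)}.
  by apply: mulmx_continuous; [exact: cst_continuous|exact: cvg_id].
exact: (lc _ (open_nbhs_nbhs (conj (@open_mx_neq0 _ _ _) (Hw k)))).
Qed.

Lemma good_transverse pi b : bivector_field pi -> ccube b 3 `<=` cimg (bc b) ->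
  good pi b <-> forall p, msupp b p -> transverse b (pi p).
Proof.
move=> [bp _] bK; split=> [H _ [x Hx <-]|H x Hx k].
  by split; [rewrite bp; apply: param_dom; exact: bK|move=> k; exact: H].
by have [_] := H _ (ex_intro2 _ _ x Hx erefl); apply.
Qed.

(** The factor 2/3 places the descent of [plateau] between radius 3/2 and radius 3, so the faces lie
    where the cutoff is 1. *)
Definition ramp b x : R := \prod_k plateau (2 / 3 * box_coord b x 0 k).

Lemma sm_ramp b : sm setT (ramp b).
Proof.
move=> j; apply: Ck_prod => [|k _]; first exact: openT.
apply: sm_plateau; first exact: openT.
by move=> i; apply: CkM; [exact: openT|exact: Ck_cst|exact: sm_box_coord].
Qed.

Lemma ramp0 b x : ~ ccube b 3 x -> ramp b x = 0.
Proof.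
move=> nx; apply: contrapT => r0; apply: nx => k; rewrite leNgt; apply/negP => h; apply: r0.
rewrite /ramp (bigD1 k)//= plateau0 ?mul0r// normrM ger0_norm; lra.
Qed.

Lemma ramp1 b x : ocube b (3 / 2) x -> ramp b x = 1.
Proof.
move=> Hx; rewrite /ramp big1// => k _; apply: plateau1.
have := Hx k; rewrite normrM ger0_norm; lra.
Qed.

(** Only finitely many boxes meet the compact support of b. Keeping them transverse is a finite
    number of open conditions, and the other boxes see no change. *)
Lemma face_step B b k e pi (Z : set M) :
  bivector_field pi -> (forall q, rank2 (pi q)) -> locally_finite B ->
  (forall j b', B j = Some b' -> ccube b' 3 `<=` cimg (bc b')) ->
  (forall j b', B j = Some b' -> good pi b') ->
  ccube b 3 `<=` cimg (bc b) -> good pi b -> compact Z -> Z `<=` poisson_interior pi ->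
  exists pi', [/\ homotopic pi pi' (msupp b), forall j b', B j = Some b' -> good pi' b',
     Z `<=` poisson_interior pi' & param (bc b) @` face b k e `<=` poisson_interior pi'].
Proof.
move=> fp rp lf HB HG bK gb cZ Zp.
have cb := @compact_ccube _ _ _ b 3.
have [N HN] := locally_finite_compact lf (compact_param_image cb bK).
pose C j := oset (@msupp _ _ _) (B j).
pose Ob j := if B j is Some b' then transverse b' else setT.
have HC j : (j < N)%N -> [/\ compact (C j), open (Ob j) & forall p, C j p -> Ob j (pi p)].
  move=> _; rewrite /C /Ob; case E : (B j) => [b'|] /=; last first.
    by split => //; [exact: compact0|exact: openT].
  split; last by apply/(good_transverse fp (HB _ _ E)); exact: HG E.
    by apply: compact_param_image; [exact: compact_ccube|exact: HB E].
  exact: open_transverse.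
pose sg : R := if e then 1 else -1.
have FG : face b k e `<=` ocube b (3 / 2).
  by move=> x [Hx _] m; apply: (le_lt_trans (Hx m)); lra.
have Fl x : face b k e x -> (x *m col k (bL b)) 0 0 = sg + (bx b *m bL b) 0 k.
  move=> [_ yE]; rewrite /sg -yE /box_coord mulmxBl.
  have -> : (x *m col k (bL b)) 0 0 = (x *m bL b) 0 k.
    by rewrite !mxE; apply: eq_bigr => m _; rewrite mxE.
  by move: (x *m bL b) (bx b *m bL b) => u v; rewrite !mxE subrK.
have [pi' [iso Fp Zp' HO]] := @face_move _ _ _ _ (col k (bL b)) _ (ramp b) _ _ _ Z N C Ob pi fp rp
   (@sm_ramp b) cb bK (fun x Hx => gb x Hx k) (@ramp0 b) (@open_ocube _ _ _ b (3 / 2)) (@ramp1 b) FG Fl cZ Zp HC.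
exists pi'; split => // j b' E.
apply/(good_transverse (homotopic_field iso) (HB _ _ E)) => p Hp.
have [jN|Nj] := ltnP j N.
  by have := HO j jN p; rewrite /C /Ob E; apply.
have nb : ~ msupp b p by move=> bp; have := HN p bp j Nj; rewrite E; apply.
by rewrite (homotopic_off iso nb); move: p Hp {nb}; apply/(good_transverse fp (HB _ _ E)); exact: HG E.
Qed.

Lemma faces_step B b (s : seq ('I_n * bool)) pi (Z : set M) :
  bivector_field pi -> (forall q, rank2 (pi q)) -> locally_finite B ->
  (forall j b', B j = Some b' -> ccube b' 3 `<=` cimg (bc b')) ->
  (forall j b', B j = Some b' -> good pi b') ->
  (exists j, B j = Some b) -> compact Z -> Z `<=` poisson_interior pi ->
  exists pi', [/\ homotopic pi pi' (msupp b), forall j b', B j = Some b' -> good pi' b',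
     Z `<=` poisson_interior pi' & forall f, f \in s -> param (bc b) @` face b f.1 f.2 `<=` poisson_interior pi'].
Proof.
move=> fp rp lf HB HG [jb Eb] cZ Zp.
elim: s pi Z fp rp HG cZ Zp => [|[k e] s IH] pi Z fp rp HG cZ Zp.
  by exists pi; split => //; exact: homotopic_refl.
have [pi1 [iso1 G1 Z1 F1]] := face_step k e fp rp lf HB HG (HB _ _ Eb) (HG _ _ Eb) cZ Zp.
have cZ1 : compact (Z `|` param (bc b) @` face b k e).
  apply: compactU => //; apply: compact_param_image; first exact: compact_face.
  by move=> x [Hx _]; apply: (HB _ _ Eb); apply: ccube_sub Hx; lra.
have ZF : Z `|` param (bc b) @` face b k e `<=` poisson_interior pi1 by move=> q [/Z1|/F1].
have [pi' [iso G' Z' F']] := IH pi1 _ (homotopic_field iso1) (homotopic_rank2 iso1) G1 cZ1 ZF.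
exists pi'; split; [|exact: G'| |].
- by have := homotopic_trans iso1 iso; rewrite setUid.
- by move=> q Zq; apply: Z'; left.
- move=> f; rewrite inE => /predU1P[->|/F'//] q Fq; by apply: Z'; right.
Qed.

Lemma mwall_faces b q : mwall b q -> exists k e, (param (bc b) @` face b k e) q.
Proof.
move=> [x [Hx [k /eqP]]]; rewrite eqr_norml ler01 andbT => /orP[] /eqP yk <-.
  by exists k, true, x.
by exists k, false, x.
Qed.

(** Boxes are treated one by one. The walls already treated form a compact set Z, which each later
    move keeps Poisson; local finiteness of the supports gives the limit. *)
Lemma clean_walls B pi : bivector_field pi -> (forall q, rank2 (pi q)) -> locally_finite B ->
  (forall j b, B j = Some b -> ccube b 3 `<=` cimg (bc b)) ->
  (forall j b, B j = Some b -> good pi b) ->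
  exists pi', homotopic pi pi' setT /\ forall j b, B j = Some b -> mwall b `<=` poisson_interior pi'.
Proof.
move=> fp rp lf HB HG.
pose ow j := oset (@mwall _ _ _) (B j).
pose Z := fix Z k := if k is k'.+1 then Z k' `|` ow k' else set0.
have ZP k q : Z k q <-> exists2 j, (j < k)%N & ow j q.
  elim: k => [|k IH] /=; first by split => // -[].
  split=> [[/IH[j jk oj]|ok]|[j]].
  - by exists j => //; exact: ltnW.
  - by exists k.
  - rewrite ltnS leq_eqVlt => /predU1P[->|jk oj]; first by right.
    by left; apply/IH; exists j.
have cow j : compact (ow j).
  rewrite /ow; case E : (B j) => [b|] /=; last exact: compact0.
  apply: compact_param_image; first exact: compact_wall.
  by move=> x [Hx _]; apply: (HB _ _ E); apply: ccube_sub Hx; lra.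
have cZ k : compact (Z k) by elim: k => [|k IH]; [exact: compact0|apply: compactU].
pose Inv k (q : M -> bivector M) := [/\ bivector_field q, forall x, rank2 (q x),
   forall j b, B j = Some b -> good q b & Z k `<=` poisson_interior q].
pose Rl k q q' := homotopic q q' (oset (@msupp _ _ _) (B k)).
have [||f [f0 fP]] := @dependent_iter _ Inv Rl pi.
- by split.
- move=> k q [fq rq Gq Zq]; rewrite /Rl; case E : (B k) => [b|]; last first.
    exists q; split; first exact: homotopic_refl.
    by split => // x [/Zq//|]; rewrite /ow E.
  have [q' [iso G' Z' F']] := faces_step (enum {: 'I_n * bool}) fq rq lf HB Gq (ex_intro _ k E) (cZ k) Zq.
  exists q'; split => //; split => //; [exact: homotopic_field iso|exact: homotopic_rank2 iso|].
  move=> x [/Z'//|]; rewrite /ow E => /mwall_faces[i [e xe]].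
  by apply: (F' (i, e)) => //; rewrite mem_enum.
have [pi' [iso near']] := @homotopic_limit _ _ _ f (fun k => oset (@msupp _ _ _) (B k)) (fun k => (fP k).1) lf.
exists pi'; rewrite -f0; split => // j b E q wq.
have [N HN] := near' q.
have [_ [_ _ _ Zf]] := fP (maxn N j.+1).
apply: (@poisson_interior_near_eq (f (maxn N j.+1))).
  by apply: filterS HN => q' /(_ _ (leq_maxl _ _)).
by apply: Zf; apply/ZP; exists j; [exact: leq_maxr|rewrite /ow E].
Qed.

End Walls.

(** The near-covering form of compactness is applied to the filter of finite lists directed by
    inclusion. *)
Lemma compact_finite_cover (T : topologicalType) (K : set T) (U : T -> set T) :
  compact K -> (forall x, K x -> open (U x) /\ U x x) ->
  exists l : seq T, (forall x, x \in l -> K x) /\ forall q, K q -> exists2 x, x \in l & U x q.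
Proof.
move=> cK HU.
pose F (P : set (seq T)) := exists l0 : seq T, forall l, {subset l0 <= l} -> P l.
have FF : Filter F.
  split=> [|P Q [l1 H1] [l2 H2]|P Q PQ [l0 H]].
  - by exists [::].
  - exists (l1 ++ l2) => l sub; split; [apply: H1|apply: H2] => x xl; apply: sub.
      by rewrite mem_cat xl.
    by rewrite mem_cat xl orbT.
  - by exists l0 => l /H /PQ.
pose P (l : seq T) q := exists2 x, x \in l & K x /\ U x q.
have /compact_near_coveringP/(_ _ F P FF) H := cK.
have [|l0 /(_ l0) Hl] := H _.
  move=> x Kx; have [oU Ux] := HU x Kx.
  exists (U x, [set l : seq T | x \in l]).
    by split; [exact: open_nbhs_nbhs|exists [:: x] => l; apply; rewrite inE].
  by move=> [q l] /= [Uq xl]; exists x.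
exists [seq x <- l0 | `[< K x >]]; split=> [x|q Kq].
  by rewrite mem_filter => /andP[/asboolP].
have [//|x xl [Kx Ux]] := Hl _ q Kq.
by exists x => //; rewrite mem_filter xl andbT; apply/asboolP.
Qed.

(** * Locally finite covers by transverse cubes *)

Section Cover.
Variables (R : realType) (n : nat) (M : manifold R n).
Local Opaque partial.
Implicit Types (b : box M) (pi : M -> bivector M) (B : nat -> option (box M)).

Lemma col_shear (k0 k : 'I_n) (a : 'rV[R]_n) (w : 'M[R]_n) :
  lrow (col k (1%:M + (delta_mx k0 0 : 'cV_n) *m a)) w = row k w + a 0 k *: row k0 w.
Proof.
have -> : col k (1%:M + (delta_mx k0 0 : 'cV_n) *m a) = delta_mx k 0 + a 0 k *: delta_mx k0 0.
  apply/colP => i; rewrite !mxE big_ord1 !mxE !eqxx !andbT; congr (_ + _).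
  by rewrite mulrC.
rewrite /lrow.
have -> : (delta_mx k 0 + a 0 k *: (delta_mx k0 0 : 'cV[R]_n))^T =
   delta_mx 0 k + a 0 k *: delta_mx 0 k0.
  by rewrite [LHS]linearD/= trmx_delta [X in _ + X]linearZ/= trmx_delta.
by rewrite mulmxDl -scalemxAl -!rowE.
Qed.

(** Some basis covector k0 is not killed by w. Adding it to every basis covector that is killed
    gives a basis without killed members. *)
Lemma good_frame (w : 'M[R]_n) : w != 0 ->
  exists L : 'M[R]_n, L \in unitmx /\ forall k, lrow (col k L) w != 0.
Proof.
move=> w0.
have [k0 rk0] : exists k0, row k0 w != 0.
  apply: contra_notP (elimN eqP w0) => H; apply/row_matrixP => i; rewrite row0.
  by apply: contra_notP H => /eqP h; exists i.
pose a : 'rV[R]_n := \row_k (row k w == 0)%:R.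
have a0 : a *m (delta_mx k0 0 : 'cV_n) = 0.
  by rewrite -colE; apply/matrixP => i j; rewrite !mxE (negbTE rk0).
exists (1%:M + (delta_mx k0 0 : 'cV_n) *m a); split.
  have E : (1%:M + (delta_mx k0 0 : 'cV_n) *m a) *m (1%:M - (delta_mx k0 0 : 'cV_n) *m a) = 1%:M.
    rewrite mulmxDl mul1mx mulmxBr mulmx1 -mulmxA [a *m _]mulmxA a0 mul0mx mulmx0 subr0.
    by rewrite subrK.
  by have [u _] := mulmx1_unit E; exact: u.
move=> k; rewrite col_shear mxE; have [E|nE] := eqVneq (row k w) 0.
  by rewrite E add0r scale1r.
by rewrite scale0r addr0.
Qed.

Lemma good_box pi p (G : set M) : bivector_field pi -> (forall q, rank2 (pi q)) ->
  open G -> G p ->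
  exists b, [/\ ccube b 3 `<=` cimg (bc b), good pi b, mcube b p & msupp b `<=` G].
Proof.
move=> fp rp oG Gp; have [bp _] := fp; have [c cp] := @dom_cover _ _ M p.
have cx := coord_cimg cp; set x0 := coord c p in cx.
have [dw w0] : dec (local_comp pi c x0) /\ local_comp pi c x0 != 0.
  by rewrite /local_comp /x0 coordK//; apply: rp; rewrite bp.
have [L [Lu HL]] := good_frame w0.
have pc := smooth_on_continuous (comp_smooth c fp) cx.
have n1 : \forall x \near x0, cimg c x by apply: open_nbhs_nbhs; split => //; exact: coord_open.
have n2 : \forall x \near x0, G (param c x).
  by apply: (param_cont cx); rewrite /x0 coordK//; exact: open_nbhs_nbhs.
have n3 : \forall x \near x0, forall k, lrow (col k L) (local_comp pi c x) != 0.
  apply: (@filter_forall _ _ (fun k z => lrow (col k L) (local_comp pi c z) != 0) (nbhs x0)) => k.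
  have lc : {for x0, continuous (fun z => lrow (col k L) (local_comp pi c z))}.
    by apply: mulmx_continuous; [exact: cst_continuous|exact: pc].
  exact: (lc _ (open_nbhs_nbhs (conj (@open_mx_neq0 _ _ _) (HL k)))).
pose b0 := @Box _ _ M c x0 L Lu.
have [r [r0 Hr]] := small_ocube b0 (filterI n1 (filterI n2 n3)).
(* With this scale the cube of radius 3 has radius 3 r / 4 < r in the old coordinates. *)
have s0 : 4 / r != 0 by rewrite gt_eqF// divr_gt0.
have sLu : (4 / r) *: L \in unitmx.
  by rewrite -mul_scalar_mx unitmx_mul Lu andbT unitmxE det_scalar unitrX// unitfE.
pose b := @Box _ _ M c x0 ((4 / r) *: L) sLu.
have ycE x k : box_coord b x 0 k = 4 / r * box_coord b0 x 0 k by rewrite /box_coord -scalemxAr mxE.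
have yc0 k : box_coord b0 x0 0 k = 0 by rewrite /box_coord subrr mul0mx mxE.
have Hb x : ccube b 3 x -> [/\ cimg c x, G (param c x) & forall k, lrow (col k L) (local_comp pi c x) != 0].
  move=> Hx; have [|h1 [h2 h3]] := Hr x; last by split.
  have r40 : 0 <= 4 / r by rewrite divr_ge0// ltW.
  move=> k; have h := Hx k; rewrite ycE normrM (ger0_norm r40) mulrAC ler_pdivrMr// in h.
  by rewrite yc0 subr0; have := normr_ge0 (box_coord b0 x 0 k); lra.
exists b; split.
- by move=> x /Hb[].
- move=> x /Hb[_ _ H] k.
  have -> : lrow (col k (bL b)) (local_comp pi (bc b) x) = (4 / r) *: lrow (col k L) (local_comp pi c x).
    have -> : col k (bL b) = (4 / r) *: col k L by apply/colP => i; rewrite !mxE.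
    by rewrite /lrow [X in X *m _]linearZ/= -scalemxAl.
  by rewrite scaler_eq0 negb_or s0 H.
- exists x0; last by rewrite /x0 /= coordK.
  by move=> k; rewrite ycE yc0 mulr0 normr0.
- by move=> _ [x /Hb[]] ? ? ? <-.
Qed.

Lemma open_mcube b : ccube b 3 `<=` cimg (bc b) -> open (mcube b).
Proof.
move=> bK; apply: open_param_image; first exact: open_ocube.
by move=> x /ocube_ccube Hx; apply: bK; apply: ccube_sub Hx; lra.
Qed.

Lemma compact_msupp b : ccube b 3 `<=` cimg (bc b) -> compact (msupp b).
Proof. by move=> bK; apply: compact_param_image => //; exact: compact_ccube. Qed.

Lemma mcube_msupp b : mcube b `<=` msupp b.
Proof.
by move=> _ [x /ocube_ccube Hx <-]; exists x => //; apply: ccube_sub Hx; lra.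
Qed.

(** The index is the number of a basic open set; a basic set contained in some cube selects one such
    cube. *)
Lemma countable_cover pi : bivector_field pi -> (forall q, rank2 (pi q)) ->
  exists e : nat -> option (box M), (forall j b, e j = Some b -> ccube b 3 `<=` cimg (bc b)) /\
    forall p, exists j, oset (@mcube _ _ _) (e j) p.
Proof.
move=> fp rp.
have /choice[be Hbe] : forall p, exists b, [/\ ccube b 3 `<=` cimg (bc b), good pi b, mcube b p & msupp b `<=` setT].
  by move=> p; exact: (good_box fp rp openT).
have [BB cB [oB bB]] := @points_second_countable _ _ M.
have [g gi] : exists g : set M -> nat, {in BB &, injective g} by apply/countable_injP.
have /choice[e He] : forall i, exists o : option (box M),
   (forall b, o = Some b -> ccube b 3 `<=` cimg (bc b)) /\
   forall p U, BB U -> g U = i -> U `<=` mcube (be p) -> exists2 b, o = Some b & U `<=` mcube b.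
  move=> i; have [[p [U [BU gU UM]]]|H] := pselect (exists p U, [/\ BB U, g U = i & U `<=` mcube (be p)]).
    exists (Some (be p)); split=> [b [<-]|p' U' BU' gU' _]; first by have [] := Hbe p.
    exists (be p) => //; have -> // : U' = U.
    by apply: gi; rewrite ?inE// gU gU'.
  by exists None; split=> // p U BU gU UM; exfalso; apply: H; exists p, U.
exists e; split=> [j b|p]; first exact: (He j).1.
have [bK _ bp _] := Hbe p.
have [U [BU Up] UM] := bB p _ (open_nbhs_nbhs (conj (open_mcube bK) bp)).
have [b Eb Ub] := (He (g U)).2 p U BU erefl UM.
by exists (g U); rewrite Eb; exact: Ub.
Qed.

(** An exhaustion of M: [ks] enumerates stages with each compact set [C] inside the next open set
    [W]. Every compact shell [T s] receives finitely many cubes, whose supports lie in [G s] and so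
    avoid the earlier stages. *)
Lemma locally_finite_cover pi : bivector_field pi -> (forall q, rank2 (pi q)) ->
  exists B, [/\ locally_finite B, forall j b, B j = Some b -> ccube b 3 `<=` cimg (bc b),
    forall j b, B j = Some b -> good pi b & forall p, exists j, oset (@mcube _ _ _) (B j) p].
Proof.
move=> fp rp; have [e [eK eC]] := countable_cover fp rp.
pose W := fix W k : set M := if k is k'.+1 then W k' `|` oset (@mcube _ _ _) (e k') else set0.
pose C := fix C k : set M := if k is k'.+1 then C k' `|` oset (@msupp _ _ _) (e k') else set0.
have oW k : open (W k).
  elim: k => [|k IH]; first exact: open0.
  apply: openU => //; case E : (e k) => [b|] /=; last exact: open0.
  by apply: open_mcube; exact: eK E.
have cC k : compact (C k).
  elim: k => [|k IH]; first exact: compact0.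
  apply: compactU => //; case E : (e k) => [b|] /=; last exact: compact0.
  by apply: compact_msupp; exact: eK E.
have WC k : W k `<=` C k.
  elim: k => // k IH q [/IH|]; first by left.
  by case E : (e k) => [b|]//= /mcube_msupp; right; rewrite E.
have Wm k k' : (k <= k')%N -> W k `<=` W k'.
  elim: k' => [|k' IH]; first by rewrite leqn0 => /eqP ->.
  rewrite leq_eqVlt => /predU1P[->//|]; rewrite ltnS => /IH H q /H; by left.
have Cm k k' : (k <= k')%N -> C k `<=` C k'.
  elim: k' => [|k' IH]; first by rewrite leqn0 => /eqP ->.
  rewrite leq_eqVlt => /predU1P[->//|]; rewrite ltnS => /IH H q /H; by left.
have We p : exists k, W k p by have [j pj] := eC p; exists j.+1; right.
have /choice[phi Hphi] : forall k, exists m, (k < m)%N /\ C k `<=` W m.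
  move=> k; pose P m q := W m q.
  have /compact_near_coveringP/(_ _ (\oo) P _) H := cC k.
  have [|N _ HN] := H _.
    move=> p _; have [m Wp] := We p.
    exists (W m, [set j | (m <= j)%N]); first by split; [exact: (open_nbhs_nbhs (conj (oW m) Wp))|exists m].
    by move=> [q j] /= [Wq mj]; exact: Wm mj _ Wq.
  by exists (maxn N k.+1); split; [exact: leq_maxr|exact: HN (leq_maxl _ _)].
pose ks s := iter s phi 0%N.
have ksS s : (ks s < ks s.+1)%N by exact: (Hphi (ks s)).1.
have ksm s t : (s <= t)%N -> (ks s <= ks t)%N.
  elim: t => [|t IH]; first by rewrite leqn0 => /eqP ->.
  rewrite leq_eqVlt => /predU1P[->//|]; rewrite ltnS => /IH h; exact: (leq_trans h (ltnW (ksS t))).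
have ksid s : (s <= ks s)%N by elim: s => // s IH; exact: (leq_ltn_trans IH (ksS s)).
have CW s : C (ks s) `<=` W (ks s.+1) by exact: (Hphi (ks s)).2.
pose T s := C (ks s.+1) `\` W (ks s).
(* For s = 0 the predecessor is 0 again, and [C (ks 0)] is empty, so nothing is removed. *)
pose G s := W (ks s.+2) `\` C (ks s.-1).
have cT s : compact (T s).
  apply: (subclosed_compact _ (cC (ks s.+1))); last by move=> q [].
  apply: closedI; last by apply: open_closedC.
  by apply: compact_closed => //; exact: points_hausdorff.
have oG s : open (G s).
  apply: openI => //; apply: closed_openC; apply: compact_closed => //; exact: points_hausdorff.
have TG s : T s `<=` G s.
  move=> q [Cq nW]; split; first exact: CW.
  by case: s nW {Cq} => [|s] nW //= /CW.
have /choice[l Hl] : forall s, exists l : seq (box M),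
   (forall i b, onth l i = Some b -> [/\ ccube b 3 `<=` cimg (bc b), good pi b & msupp b `<=` G s]) /\
   forall q, T s q -> exists i b, onth l i = Some b /\ mcube b q.
  move=> s.
  have /choice[be Hbe] : forall p, exists b, T s p ->
      [/\ ccube b 3 `<=` cimg (bc b), good pi b, mcube b p & msupp b `<=` G s].
    move=> p; have [Tp|nT] := pselect (T s p).
      by have [b Hb] := good_box fp rp (oG s) (TG _ _ Tp); exists b.
    have [b _] := good_box fp rp openT (I : setT p).
    by exists b.
  have [||l [lT lC]] := @compact_finite_cover _ (T s) (fun p => mcube (be p)).
  - exact: cT.
  - by move=> x Tx; have [bK _ bx _] := Hbe _ Tx; split => //; exact: open_mcube.
  exists (map be l); split.
    move=> i b; rewrite onth_map; case E : (onth l i) => [x|]//= [<-].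
    have xl : x \in l by apply/onthP; exists i.
    by have [] := Hbe x (lT _ xl).
  move=> q /lC[x /onthP[i Ei] xq]; exists i, (be x); split => //.
  by rewrite onth_map Ei.
pose B j := if @pickle_inv (nat * nat)%type j is Some si then onth (l si.1) si.2 else None.
have BP j b : B j = Some b -> exists s i, j = pickle (s, i) /\ onth (l s) i = Some b.
  rewrite /B; have := @pickle_invK (nat * nat)%type j.
  by case: pickle_inv => [[s i]|]//= Ej E; exists s, i.
have BE s i : B (pickle (s, i)) = onth (l s) i by rewrite /B pickleK_inv.
exists B; split.
- move=> p; have [k Wp] := We p.
  (* Supports that meet W k come from shells s < k + 2, and N exceeds all codes of their boxes. *)
  pose N := (\max_(s < k.+2) \max_(i < size (l s)) pickle (s : nat, i : nat)).+1.
  exists N; have := open_nbhs_nbhs (conj (oW k) Wp); apply: filterS => q Wq j Nj.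
  case E : (B j) => [b|]//= bq; have [s [i [ej Ei]]] := BP _ _ E.
  have [_ _ bG] := (Hl s).1 _ _ Ei; have [_ nC] := bG _ bq.
  have ks_lt : (s < k.+2)%N.
    rewrite ltnNge; apply/negP => ks'; apply: nC.
    apply: (Cm k); last exact: WC.
    by apply: leq_trans (ksid _); case: s ks' {ej Ei bG} => // s; rewrite !ltnS => /ltnW.
  have il : (i < size (l s))%N.
    by rewrite -onthTE Ei.
  move: Nj; rewrite ej /N ltnNge => /negP; apply.
  apply: leq_trans (leq_bigmax (Ordinal ks_lt)).
  exact: (leq_bigmax (F := fun i : 'I_(size (l s)) => pickle (s, i : nat)) (Ordinal il)).
- by move=> j b /BP[s [i [_ Ei]]]; have [] := (Hl s).1 _ _ Ei.
- by move=> j b /BP[s [i [_ Ei]]]; have [] := (Hl s).1 _ _ Ei.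
- move=> p; have [k Wp] := We p.
  have [s [nW Ws]] : exists s, ~ W (ks s) p /\ W (ks s.+1) p.
    have : W (ks k) p by exact: Wm (ksid k) _ Wp.
    elim: k {Wp} => // k IH Wk1; have [/IH//|nW] := pselect (W (ks k) p).
    by exists k.
  have [i [b [Ei bp]]] := (Hl s).2 p (conj (WC _ _ Ws) nW).
  by exists (pickle (s, i)); rewrite BE Ei.
Qed.

End Cover.

(** * Escaping to infinity *)

Section Graph.
Local Open Scope nat_scope.
Variable adj : nat -> nat -> Prop.
Hypothesis adjC : forall i j, adj i j -> adj j i.
Hypothesis adj_fin : forall i, exists m, forall j, adj i j -> j < m.

(** The bound N controls supports: a push along such a path changes the field only in boxes of index
    at least N, see [clear_path]. *)
Inductive reach (N : nat) : nat -> nat -> Prop :=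
| reach_refl i : N <= i -> reach N i i
| reach_step i j k : N <= i -> adj i j -> reach N j k -> reach N i k.

Lemma reach_ge N i j : reach N i j -> N <= i.
Proof. by case. Qed.

Lemma reach_trans N i j k : reach N i j -> reach N j k -> reach N i k.
Proof. by elim=> // i' j' k' Ni a _ IH /IH; exact: reach_step. Qed.

Lemma reach_sym N i j : reach N i j -> reach N j i.
Proof.
elim=> [i' h|i' j' k' Ni a r IH]; first exact: reach_refl.
apply: (reach_trans IH); apply: (reach_step (reach_ge r) (adjC a)).
exact: reach_refl.
Qed.

Definition inf_reach N i := forall m, exists2 j, m <= j & reach N i j.

Lemma inf_reach_trans N i j : reach N i j -> inf_reach N j -> inf_reach N i.
Proof. by move=> r H m; have [k mk rk] := H m; exists k => //; exact: reach_trans rk. Qed.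

(** A path that meets N is cut just before its first visit there. *)
Lemma reach_remove N i j : reach N i j -> i <> N ->
  reach N.+1 i j \/ exists2 b, reach N.+1 i b & adj b N.
Proof.
have gt k : N <= k -> k <> N -> N < k by move=> h /eqP; rewrite ltn_neqAle eq_sym h andbT.
elim=> [i' h|i' j' k' Ni a r IH] iN; first by left; apply: reach_refl; exact: gt.
have Ni' := gt _ Ni iN.
have [E|/eqP nE] := eqVneq j' N; first by right; exists i'; [exact: reach_refl|rewrite -E].
have [r'|[b r' ab]] := IH nE; first by left; exact: (reach_step Ni' a).
by right; exists b => //; exact: (reach_step Ni' a).
Qed.

(* Only finitely many components stay finite after removing finitely many
   vertices: each of them contains a neighbour of a removed vertex. *)
Lemma escape (V : nat -> Prop) : (forall i, V i -> inf_reach 0 i) ->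
  forall N, exists g, forall i, V i -> g <= i -> inf_reach N i.
Proof.
move=> V0; elim=> [|N [g Hg]]; first by exists 0 => i /V0.
have [m Hm] := adj_fin N.
have [M HM] : exists M, forall b, b < m -> ~ inf_reach N.+1 b -> forall j, reach N.+1 b j -> j < M.
  elim: m {Hm} => [|m [M HM]]; first by exists 0.
  have [M' HM'] : exists M', ~ inf_reach N.+1 m -> forall j, reach N.+1 m j -> j < M'.
    have [im|nim] := pselect (inf_reach N.+1 m); first by exists 0.
    have [M' HM'] : exists M', forall j, reach N.+1 m j -> j < M'.
      apply: contra_notP nim => H k; apply: contra_notP H => H; exists k => j r.
      by rewrite ltnNge; apply/negP => kj; apply: H; exists j.
    by exists M'.
  exists (maxn M M') => b; rewrite ltnS leq_eqVlt => /predU1P[->|bm] nb j r.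
    by apply: leq_trans (leq_maxr _ _); exact: HM'.
  by apply: leq_trans (leq_maxl _ _); exact: HM r.
exists (maxn (maxn g N.+1) M) => i Vi; rewrite !geq_max => /andP[/andP[gi Ni] Mi].
apply: contrapT => ni.
have [k Hk] : exists k, forall j, reach N.+1 i j -> j < k.
  apply: contra_notP ni => H k; apply: contra_notP H => H; exists k => j r.
  by rewrite ltnNge; apply/negP => kj; apply: H; exists j.
have iN : i <> N by move=> E; rewrite E ltnn in Ni.
have [j kj r] := Hg i Vi gi k.
have [/Hk|[b rb ab]] := reach_remove r iN; first by rewrite ltnNge kj.
have nb : ~ inf_reach N.+1 b by move=> /(inf_reach_trans rb).
by have := HM b (Hm _ (adjC ab)) nb i (reach_sym rb); rewrite ltnNge Mi.
Qed.

(** A diagonal choice: [Nf m] is the largest N <= m such that m, if in V, still escapes through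
    vertices at least N. Its growth will make the infinitely many pushes locally finite. *)
Lemma escape_rate (V : nat -> Prop) : (forall i, V i -> inf_reach 0 i) ->
  exists Nf : nat -> nat, (forall i, V i -> inf_reach (Nf i) i) /\
    forall J, exists m0, forall m, m0 <= m -> J <= Nf m.
Proof.
move=> V0; have /choice[g Hg] := escape V0.
have /choice[Nf HNf] : forall m, exists N, (V m -> inf_reach N m) /\
    forall J, J <= m -> g J <= m -> J <= N.
  move=> m; pose P N := (N <= m) && `[< V m -> inf_reach N m >].
  have P0 : exists N, P N by exists 0; apply/andP; split => //; apply/asboolP; exact: V0.
  have Pm N : P N -> N <= m by move=> /andP[].
  case: (ex_maxnP P0 Pm) => N /andP[_ /asboolP HN] mx; exists N; split => // J Jm gJ.
  by apply: mx; rewrite /P Jm; apply/asboolP => Vm; exact: Hg.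
exists Nf; split=> [i|J]; first exact: (HNf i).1.
exists (maxn J (g J)) => m; rewrite geq_max => /andP[Jm gJ]; exact: (HNf m).2.
Qed.

End Graph.

(** * Pushing singular sets along chains of overlapping cubes *)

Section StageTwo.
Variables (R : realType) (n : nat) (M : manifold R n).
Local Opaque partial.
Variable B : nat -> option (box M).
Hypothesis lf : locally_finite B.
Hypothesis BK : forall j b, B j = Some b -> ccube b 3 `<=` cimg (bc b).
Hypothesis BC : forall p, exists j, oset (@mcube _ _ _) (B j) p.
Implicit Types (pi : M -> bivector M) (q : M).

Local Notation Q j := (oset (@mcube R n M) (B j)).
Local Notation K j := (oset (@msupp R n M) (B j)).

Definition overlap i j := exists q, Q i q /\ Q j q.

Lemma overlapC i j : overlap i j -> overlap j i.
Proof. by move=> [q []]; exists q. Qed.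

Lemma QK j : Q j `<=` K j.
Proof. by case: (B j) => [b|]//=; exact: mcube_msupp. Qed.

Lemma open_Q j : open (Q j).
Proof.
case E : (B j) => [b|] /=; last exact: open0.
by apply: open_mcube; exact: BK E.
Qed.

Lemma compact_K j : compact (K j).
Proof.
case E : (B j) => [b|] /=; last exact: compact0.
by apply: compact_msupp; exact: BK E.
Qed.

Lemma overlap_fin i : exists m, forall j, overlap i j -> (j < m)%N.
Proof.
have [N HN] := locally_finite_compact lf (@compact_K i).
exists N => j [q [iq jq]]; rewrite ltnNge; apply/negP => Nj.
exact: (HN q (QK iq) j Nj (QK jq)).
Qed.

(** If only finitely many cubes were reached from i, their union would be open, closed because any
    cube that meets it is reached too, and compact as a closed subset of finitely many supports. It
    would contain a component of M, which would then be compact. *)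
Lemma open_components i : open_manifold M -> (exists q, Q i q) -> inf_reach overlap 0 i.
Proof.
move=> oM [p ip]; apply: contrapT => ni; apply: (oM p).
have [k Hk] : exists k, forall j, reach overlap 0 i j -> (j < k)%N.
  apply: contra_notP ni => H k; apply: contra_notP H => H; exists k => j r.
  by rewrite ltnNge; apply/negP => kj; apply: H; exists j.
pose U : set M := [set q | exists2 j, reach overlap 0 i j & Q j q].
have oU : open U.
  rewrite openE => q [j r jq]; apply: filterS (open_nbhs_nbhs (conj (@open_Q j) jq)) => q' jq'.
  by exists j.
have cU : closed U.
  rewrite -[U]setCK; apply: open_closedC; rewrite openE => q nq.
  have [j jq] := BC q; apply: filterS (open_nbhs_nbhs (conj (@open_Q j) jq)) => q' jq' [k' r kq'].
  apply: nq; exists j => //; apply: (reach_trans r).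
  by apply: (@reach_step _ _ _ j) => //; [exists q'|exact: reach_refl].
pose KK := fix KK m : set M := if m is m'.+1 then KK m' `|` K m' else set0.
have cKK m : compact (KK m) by elim: m => [|m IH]; [exact: compact0|apply: compactU => //; exact: compact_K].
have KKP m j q : (j < m)%N -> K j q -> KK m q.
  elim: m => // m IH; rewrite ltnS leq_eqVlt => /predU1P[->|jm] Kq; first by right.
  by left; exact: IH.
have cpU : compact U.
  by apply: (subclosed_compact cU (cKK k)) => q [j /Hk jk /QK]; exact: KKP.
apply: (subclosed_compact _ cpU); first by apply: component_closed; exact: closedT.
have Up : U p by exists i => //; exact: reach_refl.
have Cp := connected_component_refl (I : [set: M] p).
have CU := @component_connected M setT p (connected_component setT p `&` U) _ _ _.
rewrite -CU; first by move=> q [].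
- by exists p.
- by exists U.
- by exists U.
Qed.

Definition clean pi := forall j, oset (@mwall _ _ _) (B j) `<=` poisson_interior pi.

(** A wall has empty interior, since scaling a wall point outward from the centre of the cube leaves
    the wall. *)
Lemma open_off_wall b (G : set M) : ccube b 3 `<=` cimg (bc b) -> open G -> G !=set0 ->
  open (G `\` mwall b) /\ (G `\` mwall b) !=set0.
Proof.
move=> bK oG [q Gq].
have wK : wall b `<=` cimg (bc b) by move=> x [Hx _]; apply: bK; apply: ccube_sub Hx; lra.
have cw := @compact_wall _ _ _ b.
split; first by apply: openI => //; exact: open_param_compl.
have [[x wx xq]|nq] := pselect (mwall b q); last by exists q; split.
have cx := wK _ wx.
have gc : {for (0 : R), continuous (fun e : R => x + e *: (x - bx b))}.
  have e1 : {for (0 : R), continuous (fun e : R => e)} by exact: cvg_id.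
  have x1 : {for (0 : R), continuous (fun _ : R => x - bx b)} by exact: cst_continuous.
  have x2 : {for (0 : R), continuous (fun _ : R => x)} by exact: cst_continuous.
  exact: (addmx_continuous x2 (scalemx_continuous e1 x1)).
have nG : nbhs x (cimg (bc b) `&` param (bc b) @^-1` G).
  apply: filterI; first by apply: open_nbhs_nbhs; split => //; exact: coord_open.
  by apply: (param_cont cx); rewrite xq; exact: open_nbhs_nbhs.
have [e [e0 [ce Ge]]] : exists e, 0 < e /\ (cimg (bc b) `&` param (bc b) @^-1` G) (x + e *: (x - bx b)).
  by apply: nbhs0_pos; apply: gc; rewrite scale0r addr0.
exists (param (bc b) (x + e *: (x - bx b))); split => // -[x' [Hx' _] E].
have Ex : x' = x + e *: (x - bx b).
  rewrite -(paramK ce) -E paramK//; apply: bK; apply: ccube_sub Hx'; lra.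
have [_ [k yk]] := wx; have := Hx' k.
have y0 : box_coord b (bx b) 0 k = 0 by rewrite /box_coord subrr mul0mx mxE.
rewrite Ex box_coord_rayE y0 subr0 -[X in X + _]mul1r -mulrDl normrM yk mulr1 ger0_norm; lra.
Qed.

(** A singular set pushed into a target that met the wall of another cube could destroy [clean], so
    targets are chosen off all walls. *)
Lemma off_walls (G : set M) : open G -> G !=set0 ->
  exists V, [/\ open V, V !=set0, V `<=` G & forall j q, V q -> ~ oset (@mwall _ _ _) (B j) q].
Proof.
move=> oG [p Gp]; have [N HN] := lf p.
pose G0 := G `&` [set q | forall j, (N <= j)%N -> ~ K j q]^°.
have oG0 : open G0 by apply: openI => //; exact: open_interior.
have G0p : G0 !=set0 by exists p; split.
have [V [oV V0 VG HV]] : exists V, [/\ open V, V !=set0, V `<=` G0 &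
    forall j, (j < N)%N -> forall q, V q -> ~ oset (@mwall _ _ _) (B j) q].
  elim: N {HN} G0 oG0 G0p => [|N IH] G0 oG0 G0p; first by exists G0; split.
  have [V [oV V0 VG HV]] := IH G0 oG0 G0p.
  case E : (B N) => [b|]; last first.
    exists V; split => // j; rewrite ltnS leq_eqVlt => /predU1P[->|/HV//] q _.
    by rewrite E.
  have [oV' V0'] := open_off_wall (BK E) oV V0.
  exists (V `\` mwall b); split => //; first by move=> q [/VG].
  move=> j; rewrite ltnS leq_eqVlt => /predU1P[->|/HV h] q [Vq nq]; last exact: h.
  by rewrite E.
exists V; split => //; first by move=> q /VG[].
move=> j q Vq; have [/HV|Nj] := ltnP j N; first exact.
have [_ /interior_subset /(_ j Nj)] := VG _ Vq.
case E : (B j) => [b|]//= nK [x [Hx _] xq]; apply: nK; exists x => //.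
by apply: ccube_sub Hx; lra.
Qed.

(* D is the union of the cubes contracted along the path. *)
Lemma clear_path N i j : reach overlap N i j -> forall pi,
  bivector_field pi -> (forall q, rank2 (pi q)) -> clean pi ->
  exists pi' (D : set M), [/\ homotopic pi pi' [set q | exists2 k, (N <= k)%N & K k q],
    clean pi', forall q, Q i q -> D q \/ Q j q,
    forall q, D q -> ~ poisson_interior pi' q -> Q j q &
    forall q, ~ D q -> ~ poisson_interior pi' q -> ~ poisson_interior pi q].
Proof.
elim=> [{}i Ni|{}i {}j k Ni [p0 [ip0 jp0]] r IH] pi fp rp cl.
  by exists pi, set0; split => //; [exact: homotopic_refl|right].
(* The target lies in the overlap with the next cube of the path, so what remains singular can be
   pushed further. *)
have [V [oV [p Vp] VQ Vw]] := off_walls (openI (@open_Q i) (@open_Q j)) (ex_intro _ p0 (conj ip0 jp0)).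
have [ip jp] := VQ _ Vp.
case E : (B i) ip => [b|]//= -[x ox xp].
have b1 : ccube b 1 `<=` cimg (bc b) by move=> y Hy; apply: (BK E); apply: ccube_sub Hy; lra.
have wZ : mwall b `<=` poisson_interior pi by have := cl i; rewrite E.
have Vx : V (param (bc b) x) by rewrite xp.
have [pi1 [iso1 H1 H2]] := box_contract b1 ox fp rp wZ oV Vx.
have cl1 : clean pi1.
  move=> m q wq; have [qb|nqb] := pselect (mcube b q).
    by apply: contrapT => /(H2 q qb) Vq; exact: (Vw m q Vq wq).
  by apply: H1 => //; exact: cl wq.
have [pi' [D [iso cl' D1 D2 D3]]] := IH pi1 (homotopic_field iso1) (homotopic_rank2 iso1) cl1.
exists pi', (mcube b `|` D); split => //.
- apply: homotopic_subset (homotopic_trans iso1 iso) => q [|//] [y Hy yq].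
  exists i => //; rewrite E; exists y => //; apply: ccube_sub Hy; lra.
- by move=> q bq; left; left.
(* A point of cube i outside the later D that is still singular was singular after the first push,
   hence lies in the next cube, which the induction places in D or in the last cube. *)
- move=> q Dq nZ; have [Dq'|nD] := pselect (D q); first exact: D2.
  case: Dq => // bq; have [_ jq] := VQ _ (H2 q bq (D3 q nD nZ)).
  by case: (D1 q jq).
- move=> q nDq nZ Zq; apply: (D3 q _ nZ); first by move=> Dq; apply: nDq; right.
  by apply: H1 => // bq; apply: nDq; left.
Qed.

(** Stage m pushes the singular set of cube m into a cube y disjoint from cubes 0, ..., m. The path
    may cross cubes cleared before, but whatever is singular on it ends in y, so they are clear
    again at the end of the stage. *)
Lemma clear_all pi : open_manifold M -> bivector_field pi -> (forall q, rank2 (pi q)) -> clean pi ->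
  exists pi', homotopic pi pi' setT /\ forall q, poisson_at pi' q.
Proof.
move=> oM fp rp cl.
have [Nf [Hinf Hrate]] := @escape_rate overlap overlapC overlap_fin (fun i => exists q, Q i q)
  (fun i => @open_components i oM).
pose A m : set M := [set q | exists2 k, (Nf m <= k)%N & K k q].
pose Inv m (f : M -> bivector M) := [/\ bivector_field f, forall q, rank2 (f q), clean f &
  forall i, (i < m)%N -> Q i `<=` poisson_interior f].
have [||f [f0 fP]] := @dependent_iter _ Inv (fun m f f' => homotopic f f' (A m)) pi.
- by split.
- move=> m f [ff rf cf Zf].
  have [Vm|nV] := pselect (exists q, Q m q); last first.
    exists f; split; first exact: homotopic_refl.
    split => // i; rewrite ltnS leq_eqVlt => /predU1P[->|/Zf//] q mq.
    by exfalso; apply: nV; exists q.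
  (* Every cube that overlaps one of cubes 0, ..., m has index below T, so any target of index at
     least T is disjoint from them. *)
  have [T HT] : exists T, forall i j, (i <= m)%N -> overlap i j -> (j < T)%N.
    elim: {Vm} m {Zf} => [|m [T HT]].
      have [T HT] := overlap_fin 0; exists T => i j; rewrite leqn0 => /eqP ->; exact: HT.
    have [T' HT'] := overlap_fin m.+1; exists (maxn T T') => i j.
    rewrite leq_eqVlt => /predU1P[->|]; first by move=> /HT' h; exact: (leq_trans h (leq_maxr _ _)).
    by rewrite ltnS => /HT H /H h; exact: (leq_trans h (leq_maxl _ _)).
  have [y Ty ry] := Hinf m Vm T.
  have ny i : (i <= m)%N -> ~ overlap i y by move=> im /(HT i y im); rewrite ltnNge Ty.
  have [f' [D [iso cf' D1 D2 D3]]] := clear_path ry ff rf cf.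
  exists f'; split; first exact: iso.
  split; [exact: homotopic_field iso|exact: homotopic_rank2 iso|exact: cf'|].
  move=> i; rewrite ltnS => im q iq; apply: contrapT => nZ.
  have [Dq|nD] := pselect (D q); first by apply: (ny i im); exists q; split => //; exact: D2.
  move: im; rewrite leq_eqVlt => /predU1P[im|im].
    have mq : Q m q by rewrite -im.
    have [//|yq] := D1 q mq.
    by apply: (ny m (leqnn m)); exists q; split => //; rewrite -im.
  by apply: (D3 q nD nZ); exact: Zf im _ iq.
(* Stage m moves the field only in supports of index at least [Nf m]. As [Nf] tends to infinity, the
   stages inherit local finiteness from the cover. *)
have lfA (p : M) : exists N, \forall q \near p, forall m, (N <= m)%N -> ~ A m q.
  have [J HJ] := lf p; have [m0 Hm0] := Hrate J.
  exists m0; apply: filterS HJ => q Hq m mm [k Nk Kk].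
  exact: (Hq k (leq_trans (Hm0 m mm) Nk) Kk).
have [pi' [iso near']] := @homotopic_limit _ _ _ f A (fun k => (fP k).1) lfA.
exists pi'; rewrite -f0; split => // q.
have [N HN] := near' q; have [i iq] := BC q.
have [_ [_ _ _ Zf]] := fP (maxn N i.+1).
apply: poisson_interior_sub; apply: (@poisson_interior_near_eq _ _ _ (f (maxn N i.+1))).
  by apply: filterS HN => q' /(_ _ (leq_maxl _ _)).
by apply: Zf iq; exact: leq_maxr.
Qed.

End StageTwo.

(** * Scaling to zero, and assembly of both statements *)

Section Scaling.
Variables (R : realType) (n : nat) (M : manifold R n).
Local Opaque partial.
Implicit Types (pi : M -> bivector M).

Lemma biv_scale_proof (a : R) (b : bivector M) : bitangent (base b) (fun c => a *: components b c).
Proof.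
have [H1 H2 H3] := components_bitangent b; split=> [c nc|c|c d bc bd].
- by rewrite H1// scaler0.
- by rewrite [LHS]linearZ/= H2 scalerN.
- by rewrite (H3 c d bc bd) -scalemxAr -scalemxAl.
Qed.

Definition biv_scale a b := Bivector (biv_scale_proof a b).

(** The path (1 - t) pi ends at the zero bivector field, whose bracket vanishes. *)
Lemma scaling_homotopy pi : bivector_field pi ->
  exists pi_ : R -> {compact-open, M -> bivector M},
    [/\ homotopy pi_, pi_ 0 = pi & Poisson (pi_ 1)].
Proof.
move=> fp; have [bp sp] := fp.
pose H (t : R) p := biv_scale (1 - t) (pi p).
have Hc t c x : local_comp (H t) c x = (1 - t) *: local_comp pi c x by [].
have cH : continuous (fun z : R * M => H z.1 z.2).
  move=> z; have [c cz] := @dom_cover _ _ M z.2.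
  apply: (@biv_cont _ _ _ _ (fun z : R * M => H z.1 z.2) z c).
  - rewrite (_ : (fun y : R * M => _) = snd); last by apply/funext => y; rewrite /= bp.
    exact: cont_snd.
  - by rewrite /= bp.
  - have ac : {for z, continuous (fun y : R * M => 1 - y.1)}.
      by apply: cvgB; [exact: cvg_cst|exact: cont_fst].
    exact: (scalemx_continuous ac (@continuous_comp _ _ _ (@snd R M) (fun q => components (pi q) c) z
      (@cont_snd R M z) (comp_cont fp cz))).
exists H; split.
- split=> [t _|]; last by apply: continuous_subspaceT; exact: (continuous_curry_fun cH).
  split=> [p|c]; first exact: bp.
  apply: smooth_onZ; [exact: coord_open|by move=> k; exact: Ck_cst|exact: sp].
- apply/funext => p; have [c cp] := @dom_cover _ _ M p.
  by apply: (@biv_eq _ _ _ _ _ c) => /=; rewrite ?bp// subr0 scale1r.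
- move=> c x cx i j k; have Z a b : local_comp (H 1) c x a b = 0.
    by rewrite Hc subrr scale0r mxE.
  have S a b d : \sum_(l < n) (local_comp (H 1) c x a l *
      partial l (fun y => local_comp (H 1) c y b d) x +
    local_comp (H 1) c x a l *
      partial l (fun y => local_comp (H 1) c y b d) x) = 0.
    by apply: big1 => l _; rewrite Z mul0r addr0.
  by rewrite /schouten !S !addr0.
Qed.

Lemma poisson_homotopy pi : open_manifold M -> bivector_field pi -> regular 2 pi ->
  exists pi_ : R -> {compact-open, M -> bivector M},
    [/\ homotopy pi_, forall t, t \in `[0, 1] -> regular 2 (pi_ t),
      pi_ 0 = pi & Poisson (pi_ 1)].
Proof.
move=> oM fp rg; have rp := regular_rank2 fp rg.
have [B [lf BK BG BC]] := locally_finite_cover fp rp.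
have [pi1 [iso1 cl]] := clean_walls fp rp lf BK BG.
have cl1 : clean B pi1.
  by move=> j; case E : (B j) => [b|]//=; exact: cl E.
have [pi2 [iso2 po]] := clear_all lf BK BC oM (homotopic_field iso1) (homotopic_rank2 iso1) cl1.
exact: (homotopic_homotopy (homotopic_trans iso1 iso2) po).
Qed.

End Scaling.

Theorem corollary1p9 (R : realType) :
  (forall (n : nat) (M : manifold R n) (pi0 : M -> bivector M),
     (4 <= n)%N -> open_manifold M ->
     bivector_field pi0 -> regular 2 pi0 ->
     exists pi_ : R -> {compact-open, M -> bivector M},
       [/\ homotopy pi_,
           forall t, t \in `[0, 1] -> regular 2 (pi_ t),
           pi_ 0 = pi0 &
           Poisson (pi_ 1)]) /\
  (forall (M : manifold R 4) (pi0 : M -> bivector M),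
     closed_manifold M ->
     bivector_field pi0 -> regular 2 pi0 ->
     exists pi_ : R -> {compact-open, M -> bivector M},
       [/\ homotopy pi_,
           pi_ 0 = pi0 &
           Poisson (pi_ 1)]).
Proof.
split=> [n M pi0 _|M pi0 _] => [|fp _]; first exact: poisson_homotopy.
exact: scaling_homotopy.
Qed.
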